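(* Let $\mathbf H$ be a smooth periodic Hankel operator with list of non-flat band functions $\mathcal E^\#$, and let $k_0\in(\omega/2)\mathbb Z$. (i) Let $E\in\mathcal E^\#$ be such that no other entry of $\mathcal E^\#$ takes the value $E(k_0)$ at $k_0$. Then $E(k)=E(2k_0-k)$ for all $k$, and $k_0$ is a non-degenerate extremum of $E$: $E'(k_0)=0$ and $E''(k_0)\neq0$. (ii) Suppose two distinct entries $E_1,E_2$ of $\mathcal E^\#$ satisfy $E_1(k_0)=E_2(k_0)$. Then $E_2(k)=E_1(2k_0-k)$ for all $k$, and $E_1'(k_0)=-E_2'(k_0)\neq0$.
   Context: Fix $T>0$, $\omega=2\pi/T$. $p$ is a real-valued $T$-periodic function with Fourier coefficients $\widetilde p_\ell=\frac1T\int_0^Te^{-i\ell\omega x}p(x)dx$ satisfying $\sum_\ell|\widetilde p_\ell|(1+\ell^2)^{1/4}<\infty$; $\mathbf H$ is the Hankel operator on $L^2(\mathbb R_+)$ with kernel $h(t)=p(\log t)/t$ (a smooth periodic Hankel operator). For $k\in\mathbb R$, $H(k)$ is the trace class self-adjoint operator on $\ell^2(\mathbb Z)$ with matrix $[H(k)]_{n,m}=B(\frac12-i\omega n-ik,\frac12+i\omega m+ik)\widetilde p_{n-m}$, $B(z_1,z_2)=\Gamma(z_1)\Gamma(z_2)/\Gamma(z_1+z_2)$. Band functions: there is a (unique up to ordering) finite or countable list $\mathcal E$, repetitions allowed, of non-vanishing real analytic real-valued functions on $\mathbb R$ such that for every $k$ the non-zero eigenvalues of $H(k)$, counted with multiplicity,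 are exactly the values $E(k)$, $E\in\mathcal E$, counted with repetition. A band function is flat if constant and non-flat otherwise; $\mathcal E^\#$ is the sublist of non-flat ones. *)

(* Defs.v *)
From HB Require Import structures.
From mathcomp Require Import all_boot all_order all_algebra.
From mathcomp Require Import all_classical all_reals all_analysis.
From mathcomp Require Import complex.
Set Implicit Arguments. Unset Strict Implicit. Unset Printing Implicit Defensive.
Import Order.TTheory GRing.Theory Num.Theory ComplexField.
Import numFieldNormedType.Exports.
Local Open Scope classical_set_scope.
Local Open Scope ring_scope.

Section Defs.
Variable R : realType.
Local Notation mu := (@lebesgue_measure R).

Definition omega (T : R) : R := 2 * pi / T.

Definition mkC (a b : R) : R[i] := Complex a b.
Definition reC (z : R[i]) : R := @complex.Re R z.
Definition imC (z : R[i]) : R := @complex.Im R z.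

(* Euler Gamma function for Re z > 0:
   Gamma(z) = int_0^oo t^(z-1) e^(-t) dt, with t^(x-1+iy) = t^(x-1)(cos(y ln t) + i sin(y ln t)). *)
Definition GammaC (z : R[i]) : R[i] :=
  let x := reC z in let y := imC z in
  mkC (\int[mu]_(t in `]0, +oo[) (t `^ (x - 1) * expR (- t) * cos (y * ln t)))
      (\int[mu]_(t in `]0, +oo[) (t `^ (x - 1) * expR (- t) * sin (y * ln t))).

Definition BetaC (z1 z2 : R[i]) : R[i] := GammaC z1 * GammaC z2 / GammaC (z1 + z2).

Definition fourier_coef (T : R) (p : R -> R) (l : int) : R[i] :=
  mkC (T^-1 * \int[mu]_(x in `[0, T]) (cos (l%:~R * omega T * x) * p x))
      (- (T^-1 * \int[mu]_(x in `[0, T]) (sin (l%:~R * omega T * x) * p x))).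

Definition modC (z : R[i]) : R := Num.sqrt (reC z ^+ 2 + imC z ^+ 2).

(* sum_{l in Z} |p~_l| (1 + l^2)^(1/4) < oo  (nonnegative terms: bounded partial sums) *)
Definition fourier_summable (T : R) (p : R -> R) : Prop :=
  exists M : R, forall N : nat,
    \sum_(j < (2 * N).+1)
       (let l : int := (j%:Z - N%:Z)%R in
        modC (fourier_coef T p l) * powR (1 + l%:~R ^+ 2) (4^-1)) <= M.

Definition Hk (T : R) (p : R -> R) (k : R) (n m : int) : R[i] :=
  BetaC (mkC (2^-1) (- (omega T * n%:~R) - k)) (mkC (2^-1) (omega T * m%:~R + k))
  * fourier_coef T p (n - m).

Definition l2 (x : int -> R[i]) : Prop :=
  exists M : R, forall N : nat,
    \sum_(j < (2 * N).+1) (let n : int := (j%:Z - N%:Z)%R in reC (x n) ^+ 2 + imC (x n) ^+ 2) <= M.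

Definition matvec_partial (A : int -> int -> R[i]) (x : int -> R[i]) (n : int) (N : nat) : R[i] :=
  \sum_(j < (2 * N).+1) (let m : int := (j%:Z - N%:Z)%R in A n m * x m).

Definition eigen_eq (A : int -> int -> R[i]) (lam : R[i]) (x : int -> R[i]) : Prop :=
  forall n : int,
    ((fun N => reC (matvec_partial A x n N)) @ \oo --> reC (lam * x n)) /\
    ((fun N => imC (matvec_partial A x n N)) @ \oo --> imC (lam * x n)).

Definition lin_indep (q : nat) (v : 'I_q -> int -> R[i]) : Prop :=
  forall c : 'I_q -> R[i], (forall n : int, \sum_(j < q) c j * v j n = 0) -> forall j, c j = 0.

Definition eig_mult_ge (A : int -> int -> R[i]) (lam : R[i]) (q : nat) : Prop :=
  exists v : 'I_q -> int -> R[i], lin_indep v /\ forall j, l2 (v j) /\ eigen_eq A lam (v j).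

Definition real_analytic (f : R -> R) : Prop :=
  forall x0 : R, exists r : R, 0 < r /\ exists a : nat -> R,
    forall x : R, `|x - x0| < r ->
      (fun N : nat => \sum_(j < N) a j * (x - x0) ^+ j) @ \oo --> f x.

(* E : I -> (R -> R) is the list of band functions of H:
   non-vanishing real-analytic functions such that for every k the non-zero
   eigenvalues of H(k), counted with multiplicity, are exactly the E i k, counted with repetition *)
Definition band_functions (T : R) (p : R -> R) (I : countType) (E : I -> R -> R) : Prop :=
  (forall i, real_analytic (E i)) /\
  (forall i k, E i k != 0) /\
  (forall (k : R) (lam : R[i]), lam != 0 -> forall q : nat,
     eig_mult_ge (Hk T p k) lam q <->
     exists f : 'I_q -> I, injective f /\ forall j, mkC (E (f j) k) 0 = lam).

Definition flat (f : R -> R) : Prop := exists c : R, forall k, f k = c.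

End Defs.

(* Main.v *)
Require Import Defs.
From HB Require Import structures.
From mathcomp Require Import all_boot all_order all_algebra.
From mathcomp Require Import all_classical all_reals all_analysis.
From mathcomp Require Import fingroup perm complex qpoly measurable_realfun.
From mathcomp Require Import ring lra zify.
Set Implicit Arguments. Unset Strict Implicit. Unset Printing Implicit Defensive.
Import Order.TTheory GRing.Theory Num.Theory ComplexField Normc.
Import numFieldNormedType.Exports.
Local Open Scope classical_set_scope.
Local Open Scope ring_scope.

(* Writing [D_n = Gamma (1/2 - i (omega n + k))], the matrix is [H(k) = D q(n - m) D^*], and
   [|Gamma (1/2 + i y)|^2] is proportional to [1 / cosh (pi y)].  Up to conjugation by a diagonal matrix,
   [H(k)] is a fixed Toeplitz matrix weighted on both sides by [sech (pi (k + omega n))^(1/2)].  As a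
   function of [e^(pi k)] the determinants of its finite sections are rational with simple poles, and
   passing to the limit the partial fraction expansion gives, for every [mu],
     [det (1 - mu H(k)) - det (1 - mu H(k')) = B(mu) (f k - f k')],
   where [f k = \sum_n sech (pi (k + omega n))] is even and [omega]-periodic, and has non-degenerate
   critical points at [(omega / 2) Z].  So near a band value [1 / mu0] taken at [k0] the bands
   satisfy [h^r rho(h) = f k0 - f k] with [h = 1 / E(k) - 1 / E(k0)] and [rho(0) <> 0].  As [f k0 - f k]
   is of exact order two, [r] is 1 or 2: if [r = 1] there is one band and it inherits the non-degenerate
   critical point; if [r = 2] it has two branches of non-zero opposite slopes, exchanged by the
   reflection [k -> 2 k0 - k], under which the spectrum of [H(k)] is invariant. *)

(** * Determinants and norms of rings *)

(** Determinants are only taken on finite windows: when the entries are absolutely summable, the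
    sections converge, with errors bounded by increments of the exponential of the entry sum. This
    is where the weight [(1 + l^2)^(1/4)] enters: the l-th diagonal of [H(k)] sums to
    [O(|p_l| |l|^(1/2))]. The partial fractions also produce a tanh sum. It is removed by
    periodicity in k: window limits do not see a shift of the index, whereas the tanh sum grows over
    a period. The same expansion, for a diagonal matrix whose determinant is an explicit product,
    shows that the critical points of [f] are non-degenerate. The coefficient [B(mu)] may vanish at
    [mu0], but it is analytic in [mu] and not identically zero near [mu0] when a non-flat band
    passes there, so it only lowers the exponent [r]. Double eigenvalues serve to exclude two
    identical non-flat entries of the list, which would force [f] to be locally constant. *)

Section DetNorm.
Variables (R : realType) (A : comNzRingType) (nu : A -> R).
Hypothesis nu_ge0 : forall x, 0 <= nu x.
Hypothesis nu0 : nu 0 = 0.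
Hypothesis nu1 : nu 1 = 1.
Hypothesis nuN : forall x, nu (- x) = nu x.
Hypothesis nuD : forall x y, nu (x + y) <= nu x + nu y.
Hypothesis nuM : forall x y, nu (x * y) <= nu x * nu y.

Lemma nu_sum (J : Type) (r : seq J) (P : pred J) (F : J -> A) :
  nu (\sum_(j <- r | P j) F j) <= \sum_(j <- r | P j) nu (F j).
Proof.
elim/big_rec2: _ => [|j y x _ le]; first by rewrite nu0.
exact: le_trans (nuD _ _) (lerD _ le).
Qed.

Lemma nu_prod (J : Type) (r : seq J) (P : pred J) (F : J -> A) :
  nu (\prod_(j <- r | P j) F j) <= \prod_(j <- r | P j) nu (F j).
Proof.
elim/big_rec2: _ => [|j y x _ le]; first by rewrite nu1.
exact: le_trans (nuM _ _) (ler_wpM2l _ le).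
Qed.

Lemma nu_sign (b : bool) x : nu ((-1) ^+ b * x) = nu x.
Proof. by case: b; rewrite ?mulN1r ?nuN ?mul1r. Qed.

(** Majorant principle: expanded, the difference is a sum of monomials with coefficient one, each
    dominated by the same monomial in the bounds. *)
Lemma nu_prod_diff (J : Type) (r : seq J) (b d : J -> A) (B D : J -> R) :
  (forall j, nu (b j) <= B j) -> (forall j, nu (d j) <= D j) ->
  nu (\prod_(j <- r) (b j + d j) - \prod_(j <- r) b j)
    <= \prod_(j <- r) (B j + D j) - \prod_(j <- r) B j.
Proof.
move=> hb hd; elim: r => [|j r IH]; first by rewrite !big_nil !subrr nu0.
have B0 i : 0 <= B i by exact: le_trans (hb i).
have D0 i : 0 <= D i by exact: le_trans (hd i).
rewrite !big_cons.
set p := \prod_(j <- r) (b j + d j) in IH *; set q := \prod_(j <- r) b j in IH *.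
set P := \prod_(j <- r) (B j + D j) in IH *; set Q := \prod_(j <- r) B j in IH *.
have -> : (b j + d j) * p - b j * q = b j * (p - q) + d j * p by ring.
have -> : (B j + D j) * P - B j * Q = B j * (P - Q) + D j * P by ring.
apply: le_trans (nuD _ _) _; apply: lerD.
  by apply: le_trans (nuM _ _) _; apply: ler_pM.
apply: le_trans (nuM _ _) _; apply: ler_pM => //.
apply: le_trans (nu_prod _ _ _) _; apply: ler_prod => i _.
by rewrite nu_ge0 (le_trans (nuD _ _)) ?lerD.
Qed.

(** Forgetting injectivity turns a sum over permutations into a sum over all maps, which factors
    into a product of column sums. All determinant bounds below rest on this. *)
Lemma sum_perm_le_ffun n (F : {ffun 'I_n -> 'I_n} -> R) :
  (forall f, 0 <= F f) ->
  \sum_(s : 'S_n) F (pval s) <= \sum_f F f.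
Proof.
move=> F0; rewrite [leRHS](bigID (fun f : {ffun 'I_n -> 'I_n} => injectiveb f)) /=.
rewrite -[leLHS]addr0 lerD //; last by rewrite sumr_ge0.
rewrite (reindex_onto (fun s : 'S_n => pval s) (insubd (1%g : 'S_n))) /=; last first.
  by move=> f injf; rewrite insubdK.
rewrite le_eqVlt; apply/orP; left; apply/eqP/eq_bigl => s.
by rewrite (valP s) /= valKd eqxx.
Qed.

Lemma det_trE n (M : 'M[A]_n) :
  \det M = \sum_(s : 'S_n) (-1) ^+ s * \prod_j M (s j) j.
Proof.
rewrite -det_tr /determinant; apply: eq_bigr => s _; congr (_ * _).
by apply: eq_bigr => j _; rewrite mxE.
Qed.

(** The majorant principle is applied to each permutation, then the sum is enlarged to all maps. The
    norm is abstract because it is used twice: as the modulus on [R[i]], and as a weighted l1 norm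
    on polynomials in the spectral parameter. *)
Lemma nu_det_diff n (M D : 'M[A]_n) (B' D' : 'I_n -> 'I_n -> R) :
  (forall i j, nu (M i j) <= B' i j) -> (forall i j, nu (D i j) <= D' i j) ->
  nu (\det (M + D) - \det M) <=
    \prod_j (\sum_i (B' i j + D' i j)) - \prod_j \sum_i B' i j.
Proof.
move=> hb hd.
have B0 i j : 0 <= B' i j by exact: le_trans (hb i j).
have D0 i j : 0 <= D' i j by exact: le_trans (hd i j).
rewrite !det_trE -sumrB; apply: le_trans (nu_sum _ _ _) _.
rewrite !(bigA_distr_bigA (fun _ _ => _)) /= -sumrB.
apply: le_trans (sum_perm_le_ffun (F := fun f => \prod_j (B' (f j) j + D' (f j) j)
    - \prod_j B' (f j) j) _); last first.
  by move=> f; rewrite subr_ge0; apply: ler_prod => j _; rewrite B0 lerDl D0.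
apply: ler_sum => s _; rewrite -mulrBr nu_sign.
have -> : \prod_j (M + D) (s j) j = \prod_j (M (s j) j + D (s j) j).
  by apply: eq_bigr => j _; rewrite mxE.
have -> : \prod_j (B' (pval s j) j + D' (pval s j) j) =
   \prod_j (B' (s j) j + D' (s j) j) by apply: eq_bigr => j _; rewrite pvalE.
have -> : \prod_j (B' (pval s j) j) =
   \prod_j (B' (s j) j) by apply: eq_bigr => j _; rewrite pvalE.
exact: nu_prod_diff.
Qed.

Lemma nu_det n (M : 'M[A]_n) : nu (\det M) <= \prod_j \sum_i nu (M i j).
Proof.
rewrite det_trE; apply: le_trans (nu_sum _ _ _) _.
rewrite (bigA_distr_bigA (fun j i => nu (M i j))) /=.
apply: le_trans (sum_perm_le_ffun (F := fun f => \prod_j nu (M (f j) j)) _); last first.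
  by move=> f; apply: prodr_ge0.
apply: ler_sum => s _; rewrite nu_sign; apply: le_trans (nu_prod _ _ _) _.
by rewrite le_eqVlt; apply/orP; left; apply/eqP/eq_bigr => j _; rewrite pvalE.
Qed.

End DetNorm.

(** * Window sums and window sections of bi-infinite matrices *)

(** The left end is free, rather than the window being symmetric, because the residues of the
    partial fractions are sections of one kernel over windows displaced by the index of the pole. *)
Definition sec (A : Type) (a : int) (L : nat) (K : int -> int -> A) : 'M[A]_L :=
  \matrix_(i < L, j < L) K (a + (i : nat)%:Z) (a + (j : nat)%:Z).

Definition wsum (R : realType) (a : int) (L : nat) (s : int -> R) : R :=
  \sum_(j < L) s (a + (j : nat)%:Z).

Section WindowSums.
Variable R : realType.
Implicit Types (s : int -> R) (a : int).

Lemma wsumS_l a L s : wsum a L.+1 s = s a + wsum (a + 1) L s.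
Proof.
rewrite /wsum big_ord_recl addr0; congr (_ + _); apply: eq_bigr => j _.
by congr s; rewrite lift0; lia.
Qed.

Lemma wsumS_r a L s : wsum a L.+1 s = wsum a L s + s (a + L%:Z).
Proof. by rewrite /wsum big_ord_recr. Qed.

Lemma wsumD a L1 L2 s : wsum a (L1 + L2) s = wsum a L1 s + wsum (a + L1%:Z) L2 s.
Proof.
elim: L1 a => [|L1 IH] a; first by rewrite add0n {2}/wsum big_ord0 add0r addr0.
rewrite addSn !wsumS_l IH addrA (_ : a + L1.+1%:Z = a + 1 + L1%:Z) //; lia.
Qed.

Lemma eq_wsum a L s s' :
  (forall n, a <= n -> n < a + L%:Z -> s n = s' n) -> wsum a L s = wsum a L s'.
Proof. by move=> h; apply: eq_bigr => j _; apply: h; have := ltn_ord j; lia. Qed.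

Lemma ler_wsum a L s s' :
  (forall n, a <= n -> n < a + L%:Z -> s n <= s' n) -> wsum a L s <= wsum a L s'.
Proof. by move=> h; apply: ler_sum => j _; apply: h; have := ltn_ord j; lia. Qed.

Lemma wsum_ge0 a L s : (forall n, 0 <= s n) -> 0 <= wsum a L s.
Proof. by move=> h; apply: sumr_ge0. Qed.

Lemma wsum_add a L s s' : wsum a L (fun n => s n + s' n) = wsum a L s + wsum a L s'.
Proof. exact: big_split. Qed.

Lemma wsumB a L s s' : wsum a L (fun n => s n - s' n) = wsum a L s - wsum a L s'.
Proof. exact: sumrB. Qed.

Lemma wsumZ a L c s : wsum a L (fun n => c * s n) = c * wsum a L s.
Proof. by rewrite /wsum mulr_sumr. Qed.

Lemma wsum_shift a L (d : int) s : wsum a L (fun n => s (n + d)) = wsum (a + d) L s.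
Proof. by apply: eq_bigr => j _; congr s; lia. Qed.

Lemma wsum0 a L s : (forall n, a <= n -> n < a + L%:Z -> s n = 0) -> wsum a L s = 0.
Proof. by move=> h; rewrite (eq_wsum h) /wsum big1. Qed.

Lemma wsum_supp a (l L0 r : nat) s :
  (forall n, ~~ ((a + l%:Z <= n) && (n < a + l%:Z + L0%:Z)) -> s n = 0) ->
  wsum a (l + L0 + r) s = wsum (a + l%:Z) L0 s.
Proof.
move=> h; rewrite !wsumD (wsum0 (a := a)); last by move=> n h1 h2; apply: h; lia.
rewrite (wsum0 (L := r)); first by rewrite add0r addr0.
by move=> n h1 h2; apply: h; lia.
Qed.

Lemma ler_wsum_sub a (l L0 r : nat) s : (forall n, 0 <= s n) ->
  wsum (a + l%:Z) L0 s <= wsum a (l + L0 + r) s.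
Proof.
move=> h; rewrite !wsumD.
by have := wsum_ge0 a l h; have := wsum_ge0 (a + (l + L0)%N%:Z) r h; lra.
Qed.

Lemma exchange_wsum a b L M (s : int -> int -> R) :
  wsum a L (fun n => wsum b M (s n)) = wsum b M (fun m => wsum a L (s^~ m)).
Proof. exact: exchange_big. Qed.

Lemma ler_norm_wsum a L s : `|wsum a L s| <= wsum a L (fun n => `|s n|).
Proof. exact: ler_norm_sum. Qed.

End WindowSums.

Section ProdExp.
Variable R : realType.

Lemma prod1D_le_exp (J : Type) (r : seq J) (x : J -> R) : (forall j, 0 <= x j) ->
  \prod_(j <- r) (1 + x j) <= expR (\sum_(j <- r) x j).
Proof.
move=> x0; elim: r => [|j r IH]; first by rewrite !big_nil expR0.
rewrite !big_cons expRD; apply: ler_pM => //; last exact: expR_ge1Dx.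
  by rewrite addr_ge0.
by apply: prodr_ge0 => i _; rewrite addr_ge0.
Qed.

(** Passing to exponentials enlarges the difference as well as the product, since
    [x - y <= expR x - expR y] for [0 <= y <= x]. *)
Lemma prod1D_diff_le_exp (J : Type) (r : seq J) (x y : J -> R) :
  (forall j, 0 <= y j) -> (forall j, y j <= x j) ->
  \prod_(j <- r) (1 + x j) - \prod_(j <- r) (1 + y j)
    <= expR (\sum_(j <- r) x j) - expR (\sum_(j <- r) y j).
Proof.
move=> y0 yx; have x0 j : 0 <= x j by exact: le_trans (yx j).
elim: r => [|j r IH]; first by rewrite !big_nil !subrr.
rewrite !big_cons !expRD.
have P1 := prod1D_le_exp r x0.
have P0 : 0 <= \prod_(j <- r) (1 + x j).
  by apply: prodr_ge0 => i _; rewrite addr_ge0.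
move: P1 P0 IH; set p := \prod_(j <- r) (1 + x j); set q := \prod_(j <- r) (1 + y j).
set P := expR (\sum_(j <- r) x j); set Q := expR (\sum_(j <- r) y j) => P1 P0 IH.
have -> : (1 + x j) * p - (1 + y j) * q = (1 + y j) * (p - q) + (x j - y j) * p by ring.
have -> : expR (x j) * P - expR (y j) * Q
   = expR (y j) * (P - Q) + (expR (x j) - expR (y j)) * P by ring.
have PQ : 0 <= P - Q.
  by rewrite subr_ge0 ler_expR; apply: ler_sum.
have e1 := expR_ge1Dx (y j).
have e2 : x j - y j <= expR (x j) - expR (y j).
  have -> : expR (x j) = expR (y j) * expR (x j - y j) by rewrite -expRD; congr expR; ring.
  have e3 := expR_ge1Dx (x j - y j); have e4 : 1 <= expR (y j) by have := y0 j; lra.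
  have yxj := yx j; nra.
have yj := y0 j; apply: lerD.
  apply: (@le_trans _ _ ((1 + y j) * (P - Q))); first by rewrite ler_wpM2l // addr_ge0.
  by rewrite ler_wpM2r.
by apply: ler_pM => //; rewrite subr_ge0.
Qed.

End ProdExp.

Section Sections.
Variable A : comNzRingType.
Implicit Types (K : int -> int -> A) (a : int).

Lemma det_sec_cutl a L K : (forall m, K a m = 0) ->
  \det (1%:M + sec a L.+1 K) = \det (1%:M + sec (a + 1) L K).
Proof.
move=> h; rewrite (expand_det_row _ ord0) (bigD1 ord0) //= big1 ?addr0; last first.
  by move=> j j0; rewrite !mxE addr0 h eq_sym (negbTE j0) addr0 mul0r.
rewrite !mxE addr0 h eqxx addr0 mul1r /cofactor expr0 mul1r; congr (\det _).
apply/matrixP => i j; rewrite !mxE !lift0 (inj_eq (@lift_inj _ _)); congr (_ + K _ _); lia.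
Qed.

Lemma det_sec_cutr a L K : (forall m, K (a + L%:Z) m = 0) ->
  \det (1%:M + sec a L.+1 K) = \det (1%:M + sec a L K).
Proof.
move=> h; rewrite (expand_det_row _ ord_max) (bigD1 ord_max) //= big1 ?addr0; last first.
  by move=> j j0; rewrite !mxE /= h eq_sym (negbTE j0) addr0 mul0r.
rewrite !mxE /= h eqxx addr0 mul1r /cofactor -signr_odd oddD addbb expr0 mul1r; congr (\det _).
by apply/matrixP => i j; rewrite !mxE !lift_max (inj_eq (@lift_inj _ _)).
Qed.

Lemma det_sec_supp a (l L0 r : nat) K :
  (forall n m, ~~ ((a + l%:Z <= n) && (n < a + l%:Z + L0%:Z)) -> K n m = 0) ->
  \det (1%:M + sec a (l + L0 + r) K) = \det (1%:M + sec (a + l%:Z) L0 K).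
Proof.
elim: r => [|r IHr] h.
  rewrite addn0; elim: l a h => [|l IHl] a h; first by rewrite addr0.
  rewrite addSn det_sec_cutl; last by move=> m; apply: h; lia.
  have -> : a + l.+1%:Z = a + 1 + l%:Z by lia.
  by rewrite IHl // => n m hn; apply: h; lia.
rewrite addnS det_sec_cutr ?IHr // => m; apply: h; lia.
Qed.

End Sections.

Section DetSec.
Variables (R : realType) (A : comNzRingType) (nu : A -> R).
Hypothesis nu_ge0 : forall x, 0 <= nu x.
Hypothesis nu0 : nu 0 = 0.
Hypothesis nu1 : nu 1 = 1.
Hypothesis nuN : forall x, nu (- x) = nu x.
Hypothesis nuD : forall x y, nu (x + y) <= nu x + nu y.
Hypothesis nuM : forall x y, nu (x * y) <= nu x * nu y.

Definition ssum a L (K : int -> int -> A) : R :=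
  wsum a L (fun m => wsum a L (fun n => nu (K n m))).

Lemma sec_colsum a L (K : int -> int -> A) (j : 'I_L) :
  \sum_(i < L) ((i == j)%:R + nu (K (a + (i : nat)%:Z) (a + (j : nat)%:Z)))
  = 1 + wsum a L (fun n => nu (K n (a + (j : nat)%:Z))).
Proof.
rewrite big_split /=; congr (_ + _).
by rewrite (bigD1 j) //= eqxx big1 ?addr0 // => i /negbTE->.
Qed.

Lemma nu_1sec a L (K : int -> int -> A) (i j : 'I_L) :
  nu ((1%:M + sec a L K) i j) <=
    (i == j)%:R + nu (K (a + (i : nat)%:Z) (a + (j : nat)%:Z)).
Proof.
rewrite !mxE; apply: le_trans (nuD _ _) _; rewrite lerD2r.
by case: (i == j); rewrite ?nu1 ?nu0.
Qed.

Lemma nu_det_sec a L (K : int -> int -> A) :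
  nu (\det (1%:M + sec a L K)) <= expR (ssum a L K).
Proof.
apply: le_trans (nu_det nu_ge0 nu0 nu1 nuN nuD nuM _) _.
apply: le_trans (prod1D_le_exp _ _); last by move=> j; exact: wsum_ge0.
apply: ler_prod => j _; rewrite sumr_ge0 //= -sec_colsum.
by apply: ler_sum => i _; exact: nu_1sec.
Qed.

(** The increment of the determinant between nested windows is dominated by the increment of a
    monotone quantity, so boundedness of the entry sum alone gives convergence. *)
Lemma nu_det_sec_diff a (l L0 r : nat) (K : int -> int -> A) :
  nu (\det (1%:M + sec a (l + L0 + r) K) - \det (1%:M + sec (a + l%:Z) L0 K))
    <= expR (ssum a (l + L0 + r) K) - expR (ssum (a + l%:Z) L0 K).
Proof.
(* Extending the inner section by zero changes neither its determinant nor its entry sum, so both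
   determinants acquire the same size and can be compared entrywise. *)
pose inw (n : int) := (a + l%:Z <= n) && (n < a + l%:Z + L0%:Z).
pose K' n m := if inw n && inw m then K n m else 0.
have -> : \det (1%:M + sec (a + l%:Z) L0 K) = \det (1%:M + sec a (l + L0 + r) K').
  rewrite det_sec_supp; last by move=> n m; rewrite -/(inw n) /K' => /negbTE->.
  congr (\det (_ + _)); apply/matrixP => i j; rewrite !mxE /K' /inw.
  have := ltn_ord i; have := ltn_ord j; case: ifPn => //; lia.
have -> : ssum (a + l%:Z) L0 K = ssum a (l + L0 + r) K'.
  rewrite /ssum wsum_supp; last first.
    move=> m; rewrite -/(inw m) => /negbTE hm; apply: wsum0 => n _ _.
    by rewrite /K' hm andbF nu0.
  apply: eq_wsum => m h1 h2; rewrite wsum_supp; last first.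
    by move=> n; rewrite -/(inw n) /K' => /negbTE->; rewrite nu0.
  by apply: eq_wsum => n h3 h4; rewrite /K' /inw h1 h2 h3 h4.
set L := (l + L0 + r)%N.
have -> : 1%:M + sec a L K = (1%:M + sec a L K') + sec a L (fun n m => K n m - K' n m).
  by rewrite -addrA; congr (_ + _); apply/matrixP => i j; rewrite !mxE addrC subrK.
pose x (j : 'I_L) := wsum a L (fun n => nu (K n (a + (j : nat)%:Z))).
pose y (j : 'I_L) := wsum a L (fun n => nu (K' n (a + (j : nat)%:Z))).
apply: (@le_trans _ _ (\prod_j (1 + x j) - \prod_j (1 + y j))); last first.
  apply: prod1D_diff_le_exp => j; first exact: wsum_ge0.
  apply: ler_wsum => n _ _; rewrite /K'; case: ifP => // _; rewrite nu0; exact: nu_ge0.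
apply: le_trans (nu_det_diff nu_ge0 nu0 nu1 nuN nuD nuM
  (B' := fun i j => (i == j)%:R + nu (K' (a + (i : nat)%:Z) (a + (j : nat)%:Z)))
  (D' := fun i j => nu (K (a + (i : nat)%:Z) (a + (j : nat)%:Z)
          - K' (a + (i : nat)%:Z) (a + (j : nat)%:Z))) _ _) _.
- exact: nu_1sec.
- by move=> i j; rewrite mxE.
rewrite lerB //; last by apply: ler_prod => j _; rewrite -sec_colsum lexx sec_colsum addr_ge0 ?wsum_ge0.
apply: ler_prod => j _; apply/andP; split.
  by apply: sumr_ge0 => i _; rewrite !addr_ge0.
rewrite /x -sec_colsum; apply: ler_sum => i _; rewrite -addrA lerD2l /K'.
by case: ifP => _; rewrite ?subrr ?subr0 nu0 ?addr0 ?add0r.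
Qed.

End DetSec.

(** * Limits along windows *)

Section WindowLimits.
Variable R : realType.
Implicit Types (u v sigma : int -> nat -> R) (l : R).

(** The limit is over all windows containing [-N..N], whatever their ends. Limits over symmetric
    windows only would not be stable under shifts of the index. *)
Definition wlim u l := forall e, 0 < e -> exists N : nat, forall a L,
  a <= - N%:Z -> N%:Z < a + L%:Z -> `|u a L - l| < e.

Definition wdom u sigma := forall a (p L q : nat),
  `|u a (p + L + q)%N - u (a + p%:Z) L| <= sigma a (p + L + q)%N - sigma (a + p%:Z) L.

Definition wmono sigma := forall a (p L q : nat),
  sigma (a + p%:Z) L <= sigma a (p + L + q)%N.

Lemma subwindow (a b : int) (L M : nat) : a <= b -> b + M%:Z <= a + L%:Z ->
  exists p q : nat, L = (p + M + q)%N /\ b = a + p%:Z.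
Proof.
move=> ab h; exists (absz (b - a)%R), (absz (a + L%:Z - (b + M%:Z))%R).
by split; lia.
Qed.

Lemma wlim_unique u l l' : wlim u l -> wlim u l' -> l = l'.
Proof.
move=> h h'; apply/eqP; rewrite -subr_eq0 -normr_le0 leNgt; apply/negP => d0.
have e0 : 0 < `|l - l'| / 2 by lra.
have [N hN] := h _ e0; have [N' hN'] := h' _ e0.
pose M := (maxn N N').
have := hN (- M%:Z) (2 * M).+1 ltac:(lia) ltac:(lia).
have := hN' (- M%:Z) (2 * M).+1 ltac:(lia) ltac:(lia).
set x := u _ _ => h1 h2; have : `|l - l'| <= `|x - l| + `|x - l'|.
  have -> : l - l' = (x - l') - (x - l) by ring.
  by rewrite [leRHS]addrC ler_normB.
lra.
Qed.

Lemma wlimD u v l m : wlim u l -> wlim v m -> wlim (fun a L => u a L + v a L) (l + m).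
Proof.
move=> hu hv e e0; have e2 : 0 < e / 2 by lra.
have [N hN] := hu _ e2; have [N' hN'] := hv _ e2.
exists (maxn N N') => a L h1 h2.
have := hN a L ltac:(lia) ltac:(lia); have := hN' a L ltac:(lia) ltac:(lia).
have -> : u a L + v a L - (l + m) = (u a L - l) + (v a L - m) by ring.
by have := ler_normD (u a L - l) (v a L - m); lra.
Qed.

Lemma wlimZ c u l : wlim u l -> wlim (fun a L => c * u a L) (c * l).
Proof.
move=> hu e e0; have c0 : 0 < `|c| + 1 by have := normr_ge0 c; lra.
have [N hN] := hu _ (divr_gt0 e0 c0).
exists N => a L h1 h2; have := hN a L h1 h2; rewrite -mulrBr normrM ltr_pdivlMr //.
by have := normr_ge0 (u a L - l); nra.
Qed.

Lemma wlim_cst l : wlim (fun _ _ => l) l.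
Proof. by move=> e e0; exists 0%N => a L _ _; rewrite subrr normr0. Qed.

Lemma wlimB u v l m : wlim u l -> wlim v m -> wlim (fun a L => u a L - v a L) (l - m).
Proof.
move=> hu hv; rewrite -[- m]mulN1r.
rewrite (_ : (fun a L => _) = (fun a L => u a L + -1 * v a L)).
  exact: wlimD hu (wlimZ (-1) hv).
by apply/boolp.funext => a; apply/boolp.funext => L; rewrite mulN1r.
Qed.

Lemma wlim_shift (d : int) u l : wlim u l -> wlim (fun a L => u (a + d) L) l.
Proof.
move=> hu e e0; have [N hN] := hu _ e0; exists (N + `|d|)%N => a L h1 h2.
by apply: hN; lia.
Qed.

Lemma wlim_le u l c : wlim u l ->
  (exists N : nat, forall a L, a <= - N%:Z -> N%:Z < a + L%:Z -> u a L <= c) -> l <= c.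
Proof.
move=> hu [N' hN']; rewrite leNgt; apply/negP => cl.
have [N hN] := hu (l - c) ltac:(lra).
pose M := (maxn N N').
have := hN (- M%:Z) (2 * M).+1 ltac:(lia) ltac:(lia).
have := hN' (- M%:Z) (2 * M).+1 ltac:(lia) ltac:(lia).
by rewrite ltr_distl; lra.
Qed.

Lemma wlim_norm u l : wlim u l -> wlim (fun a L => `|u a L|) `|l|.
Proof.
move=> hu e e0; have [N hN] := hu _ e0; exists N => a L h1 h2.
exact: le_lt_trans (ler_dist_dist _ _) (hN a L h1 h2).
Qed.

Lemma wlim_mono sigma M : wmono sigma -> (forall a L, sigma a L <= M) ->
  exists l, wlim sigma l /\ forall a L, sigma a L <= l.
Proof.
move=> mono bnd.
pose S := [set x | exists (a : int) (L : nat), x = sigma a L].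
have S0 : S (sigma 0 0%N) by exists 0, 0%N.
have Sb : has_sup S by split; [exists (sigma 0 0%N) | exists M => _ [a [L ->]]].
exists (sup S); split; last by move=> a L; apply: sup_upper_bound => //; exists a, L.
move=> e e0; have [_ [b [K ->]] hb] := sup_adherent e0 Sb.
exists (`|b| + K)%N => a L h1 h2.
have [p [q [-> bE]]] := @subwindow a b L K ltac:(lia) ltac:(lia).
have h3 := mono a p K q; rewrite -bE in h3.
have h4 : sigma a (p + K + q)%N <= sup S by apply: sup_upper_bound => //; exists a, (p + K + q)%N.
by rewrite ltr_distl; lra.
Qed.

Lemma wdom_mono u sigma : wdom u sigma -> wmono sigma.
Proof.
by move=> h a p L q; have := h a p L q; have := normr_ge0 (u a (p + L + q)%N - u (a + p%:Z) L); lra.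
Qed.

(** Both [u + sigma] and [sigma] increase along nested windows and are bounded above, so both
    converge, and [u] is their difference. *)
Lemma wdom_wlim u sigma M : wdom u sigma ->
  (forall a L, 0 <= sigma a L <= M) -> exists l, wlim u l.
Proof.
move=> dom bnd; have mono := wdom_mono dom.
have [ls [hs _]] := wlim_mono mono (fun a L => proj2 (andP (bnd a L))).
have := @wlim_mono (fun a L => u a L + sigma a L) (`|u 0 0%N| + 4 * M).
case=> [a p L q|a L|l [hl _]].
- by have := dom a p L q; rewrite ler_norml; lra.
(* The given window and the empty window at 0 are both compared with a window [b, K] containing
   them; this bounds [u] by its value on the empty window. *)
- have [b [K [[p [q [-> ->]]] [p' [q' [hK h0]]]]]] : exists b K,
      (exists p q, K = (p + L + q)%N /\ a = b + p%:Z) /\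
      (exists p q, K = (p + 0 + q)%N /\ 0 = b + p%:Z).
    exists (- `|a|%:Z), (`|a| + `|a| + L)%N.
    by split; apply: subwindow; lia.
  have := dom b p L q; have := dom b p' 0%N q'; rewrite -hK -h0.
  have := bnd b (p + L + q)%N; have := bnd 0 0%N; have := bnd (b + p%:Z) L.
  have := ler_norm (u 0 0%N).
  by rewrite !ler_norml; lra.
exists (l - ls); have := wlimB hl hs; congr (wlim _ _).
by apply/boolp.funext => a; apply/boolp.funext => L; rewrite addrK.
Qed.

Lemma wsum_wdom (s : int -> R) :
  wdom (fun a L => wsum a L s) (fun a L => wsum a L (fun n => `|s n|)).
Proof.
move=> a p L q; rewrite !wsumD.
have -> : forall x y z : R, x + y + z - y = x + z by move=> *; ring.
rewrite [leRHS](_ : _ = wsum a p (fun n => `|s n|)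
   + wsum (a + (p + L)%N%:Z) q (fun n => `|s n|)); last by ring.
by apply: le_trans (ler_normD _ _) _; apply: lerD; exact: ler_norm_wsum.
Qed.

Definition wsummable (s : int -> R) := exists M, forall a L, wsum a L (fun n => `|s n|) <= M.

Lemma wsummable_wlim s : wsummable s -> exists l, wlim (fun a L => wsum a L s) l.
Proof.
move=> [M hM]; apply: (wdom_wlim (wsum_wdom s) (M := M)) => a L.
by rewrite hM wsum_ge0.
Qed.

Lemma wsummable_le s t C : (forall n, `|s n| <= C * `|t n|) -> wsummable t -> wsummable s.
Proof.
move=> h [M hM]; exists (`|C| * M) => a L.
apply: (@le_trans _ _ (wsum a L (fun n => `|C| * `|t n|))).
  apply: ler_wsum => n _ _; apply: le_trans (h n) _.
  by rewrite ler_wpM2r // ler_norm.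
by rewrite wsumZ ler_wpM2l.
Qed.

Lemma wsummableD s t : wsummable s -> wsummable t -> wsummable (fun n => s n + t n).
Proof.
move=> [M hM] [M' hM']; exists (M + M') => a L.
apply: (@le_trans _ _ (wsum a L (fun n => `|s n| + `|t n|))).
  by apply: ler_wsum => n _ _; exact: ler_normD.
by rewrite wsum_add lerD.
Qed.

Lemma wsummable_tail s : wsummable s -> forall e, 0 < e -> exists N : nat,
  forall a L, a <= - N%:Z -> N%:Z < a + L%:Z ->
  wsum a L (fun n => `|s n|) - wsum (- N%:Z) (2 * N).+1 (fun n => `|s n|) < e.
Proof.
move=> [M hM] e e0.
have mono : wmono (fun a L => wsum a L (fun n => `|s n|)).
  by move=> a p L q; exact: ler_wsum_sub.
have [l [hl lub]] := wlim_mono mono hM.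
have [N hN] := hl _ e0; exists N => a L h1 h2.
have := hN (- N%:Z) (2 * N).+1 ltac:(lia) ltac:(lia); have := lub a L.
by rewrite ltr_distl; lra.
Qed.

(* Tannery's theorem for a bounded weight depending on the window shifted by [- n] *)
Lemma wlim_tannery (s : int -> R) (A : int -> nat -> R) l C :
  wsummable s -> wlim A l -> (forall a L, `|A a L| <= C) ->
  forall S, wlim (fun a L => wsum a L s) S ->
  wlim (fun a L => wsum a L (fun n => A (a - n) L * s n)) (l * S).
Proof.
move=> sums hA bA S hS.
have [Ms hMs] := sums.
have lC : `|l| <= C.
  by apply: (wlim_le (wlim_norm hA)); exists 0%N => a L _ _; exact: bA.
have C0 : 0 <= C := le_trans (normr_ge0 _) lC.
have M0 : 0 <= Ms := le_trans (wsum_ge0 0 0 (fun n => normr_ge0 (s n))) (hMs 0 0%N).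
suff : wlim (fun a L => wsum a L (fun n => (A (a - n) L - l) * s n)) 0.
  move=> h; have := wlimD h (wlimZ l hS); rewrite add0r; congr (wlim _ _).
  apply/boolp.funext => a; apply/boolp.funext => L; rewrite -wsumZ -wsum_add.
  by apply: eq_wsum => n _ _; ring.
move=> e e0.
have d0 : 0 < e / (4 * (C + 1)) by apply: divr_gt0 => //; lra.
have [N1 hN1] := wsummable_tail sums d0.
have d1 : 0 < e / (4 * (Ms + 1)) by apply: divr_gt0 => //; lra.
have [N0 hN0] := hA _ d1.
exists (N0 + N1)%N => a L h1 h2; rewrite subr0.
apply: le_lt_trans (ler_norm_wsum _ _ _) _.
have [p [q [LE aE]]] := @subwindow a (- N1%:Z) L (2 * N1).+1 ltac:(lia) ltac:(lia).
have tail := hN1 a L ltac:(lia) ltac:(lia).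
pose t n := `|(A (a - n) L - l) * s n|.
have hin : wsum (- N1%:Z) (2 * N1).+1 t <= e / 4.
  apply: (@le_trans _ _ (e / (4 * (Ms + 1)) * wsum (- N1%:Z) (2 * N1).+1 (fun n => `|s n|))).
    rewrite -wsumZ; apply: ler_wsum => n n1 n2; rewrite /t normrM ler_wpM2r //.
    by apply: ltW; apply: hN0; lia.
  apply: (@le_trans _ _ (e / (4 * (Ms + 1)) * Ms)).
    by rewrite ler_wpM2l ?hMs // ltW.
  have -> : e / (4 * (Ms + 1)) * Ms = e / 4 * (Ms / (Ms + 1)) by field; lra.
  by rewrite ler_piMr ?ler_pdivrMr; lra.
have ht n : t n <= 2 * C * `|s n|.
  rewrite /t normrM ler_wpM2r //; apply: le_trans (ler_normB _ _) _.
  by have := bA (a - n) L; lra.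
have hout : wsum a L t - wsum (- N1%:Z) (2 * N1).+1 t <= e / 2.
  apply: (@le_trans _ _ (2 * C * (wsum a L (fun n => `|s n|)
      - wsum (- N1%:Z) (2 * N1).+1 (fun n => `|s n|)))).
    rewrite LE aE !wsumD.
    have i1 : wsum a p t <= 2 * C * wsum a p (fun n => `|s n|).
      by rewrite -wsumZ; apply: ler_wsum.
    have i2 : wsum (a + (p + (2 * N1).+1)%N%:Z) q t
        <= 2 * C * wsum (a + (p + (2 * N1).+1)%N%:Z) q (fun n => `|s n|).
      by rewrite -wsumZ; apply: ler_wsum.
    lra.
  apply: (@le_trans _ _ (2 * C * (e / (4 * (C + 1))))).
    by rewrite ler_wpM2l ?mulr_ge0 // ltW.
  have -> : 2 * C * (e / (4 * (C + 1))) = e / 2 * (C / (C + 1)) by field; lra.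
  by rewrite ler_piMr ?ler_pdivrMr; lra.
rewrite -/t; lra.
Qed.

End WindowLimits.

(** * Fredholm determinants as window limits *)

Section NormC.
Variable R : realType.
Implicit Types z w : R[i].

Lemma normc_ge0 z : 0 <= normc z.
Proof. by case: z => a b; exact: sqrtr_ge0. Qed.

Lemma ler_Re_normc z : `|complex.Re z| <= normc z.
Proof.
case: z => a b /=; rewrite -sqrtr_sqr; apply: ler_wsqrtr.
by rewrite lerDl sqr_ge0.
Qed.

Lemma ler_Im_normc z : `|complex.Im z| <= normc z.
Proof.
case: z => a b /=; rewrite -sqrtr_sqr; apply: ler_wsqrtr.
by rewrite lerDr sqr_ge0.
Qed.

Lemma normc_le_ReIm z : normc z <= `|complex.Re z| + `|complex.Im z|.
Proof.
case: z => a b /=; rewrite -(ger0_norm (addr_ge0 (normr_ge0 a) (normr_ge0 b))) -sqrtr_sqr.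
apply: ler_wsqrtr; rewrite -(real_normK (num_real a)) -(real_normK (num_real b)).
by have := normr_ge0 a; have := normr_ge0 b; nra.
Qed.

Lemma normc_real (x : R) : normc x%:C%C = `|x|.
Proof. by rewrite /normc /= expr0n addr0 sqrtr_sqr. Qed.

End NormC.

Definition ssumC (R : realType) := @ssum R _ (@normc R).

Section Entire.
Variable R : realType.
Implicit Types K : int -> int -> R[i].

(** Absolute summability of all the entries is stronger than the trace class property, and lets
    determinants be handled through column sums. *)
Definition summable2 K := exists M, forall a L, ssumC a L K <= M.

Lemma ssum_mono (A : comNzRingType) (nu : A -> R) (nu_ge0 : forall x, 0 <= nu x)
    (K : int -> int -> A) : wmono (fun a L => ssum nu a L K).
Proof.
move=> a p L q.
have h0 (b : int) (M : nat) m : 0 <= wsum b M (fun n => nu (K n m)) by exact: wsum_ge0.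
apply: le_trans (ler_wsum_sub _ _ _ _ _); last by move=> m; exact: h0.
by apply: ler_wsum => m _ _; exact: ler_wsum_sub.
Qed.

Lemma ssum_ge0 K a L : 0 <= ssumC a L K.
Proof. by do 2![apply: wsum_ge0 => ?]; exact: normc_ge0. Qed.

Definition wdet K (a : int) (L : nat) : R[i] := \det (1%:M + sec a L K).

Lemma normc_wdet K a L : normc (wdet K a L) <= expR (ssumC a L K).
Proof.
apply: (@nu_det_sec R _ (@normc R) (@normc_ge0 R) (@normc0 R) (@normc1 R) (@normcN R)
  (@le_normcD R)); by move=> x y; rewrite normcM.
Qed.

(** Following the real part loses nothing for [H(k)] and real [mu]: the matrix is Hermitian, so its
    sections have real determinants. *)
Lemma wdet_wdom K : wdom (fun a L => complex.Re (wdet K a L)) (fun a L => expR (ssumC a L K)).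
Proof.
move=> a p L q.
apply: le_trans (nu_det_sec_diff (@normc_ge0 R) (@normc0 R) (@normc1 R) (@normcN R)
  (@le_normcD R) _ _ _ _ _ _); last by move=> x y; rewrite normcM.
rewrite -raddfB; exact: ler_Re_normc.
Qed.

Lemma wdet_wlim K : summable2 K -> exists l, wlim (fun a L => complex.Re (wdet K a L)) l.
Proof.
move=> [M hM]; apply: (wdom_wlim (wdet_wdom K) (M := expR M)) => a L.
by rewrite expR_ge0 ler_expR hM.
Qed.

Lemma summable2Z c K K' : (forall n m, normc (K' n m) <= c * normc (K n m)) ->
  summable2 K -> summable2 K'.
Proof.
move=> h [M hM]; exists (`|c| * M) => a L.
apply: (@le_trans _ _ (`|c| * ssumC a L K)); last by rewrite ler_wpM2l.
rewrite /ssumC /ssum -wsumZ; apply: ler_wsum => m _ _; rewrite -wsumZ.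
apply: ler_wsum => n _ _; apply: le_trans (h n m) _.
by rewrite ler_wpM2r ?normc_ge0 // ler_norm.
Qed.

(* [pnorm rho] is the l1 norm with weights [rho ^+ j]. *)
Definition absp (p : {poly R[i]}) : {poly R} := \poly_(j < size p) normc p`_j.
Definition pnorm (rho : R) (p : {poly R[i]}) : R := (absp p).[rho].

Lemma coef_absp p j : (absp p)`_j = normc p`_j.
Proof.
rewrite coef_poly; case: ltnP => // h.
by rewrite nth_default // normc0.
Qed.

Lemma horner_coef_ub (p : {poly R}) n x : (size p <= n)%N ->
  p.[x] = \sum_(j < n) p`_j * x ^+ j.
Proof. by move=> h; rewrite -horner_poly; congr (_.[_]); apply/polyP => i;
  rewrite coef_poly; case: ltnP => // h'; rewrite nth_default // (leq_trans h). Qed.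

Lemma horner_mono (p q : {poly R}) rho : 0 <= rho ->
  (forall j, p`_j <= q`_j) -> p.[rho] <= q.[rho].
Proof.
move=> r0 h; rewrite (@horner_coef_ub p (maxn (size p) (size q))) ?leq_maxl //.
rewrite (@horner_coef_ub q (maxn (size p) (size q))) ?leq_maxr //.
by apply: ler_sum => j _; rewrite ler_wpM2r // exprn_ge0.
Qed.

Section Pnorm.
Variables (rho : R) (rho0 : 0 <= rho).

Lemma pnorm_ge0 p : 0 <= pnorm rho p.
Proof.
rewrite /pnorm -(horner0 rho); apply: horner_mono => // j.
by rewrite coef0 coef_absp normc_ge0.
Qed.

Lemma pnorm0 : pnorm rho 0 = 0.
Proof. by rewrite /pnorm /absp size_poly0 poly_def big_ord0 horner0. Qed.

Lemma pnormC c : pnorm rho c%:P = normc c.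
Proof.
rewrite /pnorm (_ : absp c%:P = (normc c)%:P) ?hornerC //.
by apply/polyP => j; rewrite coef_absp !coefC; case: (j == 0%N); rewrite ?normc0.
Qed.

Lemma pnorm1 : pnorm rho 1 = 1.
Proof. by rewrite -[1]/(1%:P) pnormC normc1. Qed.

Lemma pnormX : pnorm rho 'X = rho.
Proof.
rewrite /pnorm (_ : absp 'X = 'X) ?hornerX //.
by apply/polyP => j; rewrite coef_absp !coefX; case: (j == 1%N); rewrite ?normc0 ?normc1.
Qed.

Lemma pnormN p : pnorm rho (- p) = pnorm rho p.
Proof.
rewrite /pnorm; congr (_.[_]); apply/polyP => j.
by rewrite !coef_absp coefN normcN.
Qed.

Lemma pnormD p q : pnorm rho (p + q) <= pnorm rho p + pnorm rho q.
Proof.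
rewrite /pnorm -hornerD; apply: horner_mono => // j.
by rewrite coefD !coef_absp coefD le_normcD.
Qed.

Lemma pnormM p q : pnorm rho (p * q) <= pnorm rho p * pnorm rho q.
Proof.
rewrite /pnorm -hornerM; apply: horner_mono => // j.
rewrite coefM coef_absp coefM.
apply: le_trans (nu_sum (@normc0 R) (@le_normcD R) _ _ _) _.
by apply: ler_sum => i _; rewrite !coef_absp normcM.
Qed.

(** The truncation length [n] is arbitrary: one bound then controls both the value of a window
    polynomial and the partial sums of the limiting series. *)
Lemma pnorm_coefs (p : {poly R[i]}) n (h : R) : `|h| <= rho ->
  `|\sum_(j < n) complex.Re p`_j * h ^+ j| <= pnorm rho p.
Proof.
move=> hr; apply: le_trans (ler_norm_sum _ _ _) _.
rewrite /pnorm (@horner_coef_ub (absp p) (maxn (size (absp p)) n)) ?leq_maxl //.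
rewrite -(big_mkord xpredT (fun j => `|complex.Re p`_j * h ^+ j|)).
rewrite -(big_mkord xpredT (fun j => (absp p)`_j * rho ^+ j)).
rewrite [leRHS](big_cat_nat (n := n)) ?leq_maxr //= -[leLHS]addr0 lerD //.
  apply: ler_sum => j _; rewrite normrM normrX coef_absp.
  by apply: ler_pM => //; [exact: ler_Re_normc | apply: lerXn2r; rewrite ?nnegrE].
by apply: sumr_ge0 => j _; rewrite coef_absp mulr_ge0 ?normc_ge0 ?exprn_ge0.
Qed.

End Pnorm.

Lemma Re_horner_real (p : {poly R[i]}) (h : R) n : (size p <= n)%N ->
  complex.Re p.[h%:C%C] = \sum_(j < n) complex.Re p`_j * h ^+ j.
Proof.
move=> sp; have -> : p.[h%:C%C] = \sum_(j < n) p`_j * h%:C%C ^+ j.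
  rewrite -horner_poly; congr (_.[_]); apply/polyP => i.
  by rewrite coef_poly; case: ltnP => // h'; rewrite nth_default // (leq_trans sp).
rewrite raddf_sum; apply: eq_bigr => j _.
rewrite -rmorphXn; case: (p`_j) => x y; rewrite /= mulr0 subr0 //.
Qed.

Lemma wlim_sum n (u : nat -> int -> nat -> R) (l : nat -> R) :
  (forall j, wlim (u j) (l j)) -> wlim (fun a L => \sum_(j < n) u j a L) (\sum_(j < n) l j).
Proof.
move=> h; elim: n => [|n IH].
  rewrite big_ord0 (_ : (fun a L => _) = (fun _ _ => 0)); first exact: wlim_cst.
  by apply/boolp.funext => a; apply/boolp.funext => L; rewrite big_ord0.
rewrite big_ord_recr /= (_ : (fun a L => _) = (fun a L => \sum_(j < n) u j a L + u n a L)).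
  exact: wlimD.
by apply/boolp.funext => a; apply/boolp.funext => L; rewrite big_ord_recr.
Qed.

(* [det (1 - (mu0 + h) K)] on windows is a polynomial in [h], Cauchy for every weighted l1 norm *)
Theorem wdet_power_series K (F : R -> R) (mu0 : R) : summable2 K ->
  (forall mu, wlim (fun a L => complex.Re (wdet (fun n m => - mu%:C%C * K n m) a L)) (F mu)) ->
  exists c : nat -> R, forall h,
    (fun N => \sum_(j < N) c j * h ^+ j) @ \oo --> F (mu0 + h).
Proof.
move=> [M hM] hF.
(* The displacement [h] of the spectral parameter is kept formal, as ['X], so that one Cauchy
   estimate in [pnorm rho] governs all the coefficients together. *)
pose KP n m : {poly R[i]} := - (mu0%:C%C%:P + 'X) * (K n m)%:P.
pose P a L : {poly R[i]} := \det (1%:M + sec a L KP).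
have sumKP rho a L : 0 <= rho ->
    ssum (pnorm rho) a L KP <= (`|mu0| + rho) * ssumC a L K.
  move=> r0; rewrite /ssumC /ssum -wsumZ; apply: ler_wsum => m _ _; rewrite -wsumZ.
  apply: ler_wsum => n _ _; rewrite /KP; apply: le_trans (pnormM r0 _ _) _.
  rewrite pnormC ler_wpM2r ?normc_ge0 // pnormN; apply: le_trans (pnormD r0 _ _) _.
  by rewrite pnormC pnormX normc_real.
have Pdiff rho a p L q : 0 <= rho -> pnorm rho (P a (p + L + q)%N - P (a + p%:Z) L) <=
    expR (ssum (pnorm rho) a (p + L + q)%N KP) - expR (ssum (pnorm rho) (a + p%:Z) L KP).
  move=> r0; apply: nu_det_sec_diff.
  - exact: pnorm_ge0.
  - exact: pnorm0.
  - exact: pnorm1.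
  - exact: pnormN.
  - exact: pnormD.
  - exact: pnormM.
have Pbnd rho a L : 0 <= rho -> 0 <= expR (ssum (pnorm rho) a L KP) <= expR ((`|mu0| + rho) * M).
  move=> r0; rewrite expR_ge0 ler_expR /=; apply: le_trans (sumKP rho a L r0) _.
  by rewrite ler_wpM2l // addr_ge0.
have coefP j a p L q : `|complex.Re (P a (p + L + q)%N - P (a + p%:Z) L)`_j|
    <= pnorm 1 (P a (p + L + q)%N - P (a + p%:Z) L).
  have := @pnorm_coefs 1 ler01 (P a (p + L + q)%N - P (a + p%:Z) L) j.+1 1.
  have := @pnorm_coefs 1 ler01 (P a (p + L + q)%N - P (a + p%:Z) L) j 1.
  set D := (P _ _ - _); rewrite normr1 lexx => /(_ isT) _ _.
  apply: (@le_trans _ _ ((absp D)`_j * 1 ^+ j)).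
    by rewrite expr1n mulr1 coef_absp ler_Re_normc.
  rewrite /pnorm (@horner_coef_ub (absp D) (maxn (size (absp D)) j.+1)) ?leq_maxl //.
  have hj : (j < maxn (size (absp D)) j.+1)%N by rewrite leq_maxr.
  rewrite (bigD1 (Ordinal hj)) //= lerDl; apply: sumr_ge0 => i _.
  by rewrite coef_absp mulr_ge0 ?normc_ge0 ?exprn_ge0.
(* Weight 1 suffices for each coefficient separately; the sum at a given [h] is controlled
   afterwards with weight [|h|]. *)
have coef_lim j : exists l, wlim (fun a L => complex.Re (P a L)`_j) l.
  apply: (@wdom_wlim R _ (fun a L => expR (ssum (pnorm 1) a L KP)) (expR ((`|mu0| + 1) * M))).
    move=> a p L q; rewrite -raddfB -coefB.
    exact: le_trans (coefP _ _ _ _ _) (Pdiff _ _ _ _ _ ler01).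
  by move=> a L; exact: Pbnd.
have [c hc] := boolp.choice coef_lim.
have Phorner a L h : complex.Re (P a L).[h%:C%C]
    = complex.Re (wdet (fun n m => - (mu0 + h)%:C%C * K n m) a L).
  congr complex.Re; rewrite /P -[LHS]/(horner_eval _ _) -det_map_mx; congr (\det _).
  apply/matrixP => i j; rewrite !mxE /= /horner_eval /KP.
  rewrite hornerD !hornerE.
  by case: (i == j); rewrite ?hornerC !rmorphD /=.
exists c => h; apply/cvgrPdist_lt => e e0.
have r0 : 0 <= `|h| by [].
have [ls [hls lsub]] := @wlim_mono R (fun a L => expR (ssum (pnorm `|h|) a L KP)) _
  ltac:(by move=> a p L q; rewrite ler_expR; exact: (ssum_mono (pnorm_ge0 r0)))
  (fun a L => proj2 (andP (Pbnd `|h| a L r0))).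
have e3 : 0 < e / 3 by lra.
(* One window polynomial [P0] is good to within [e / 3] in [pnorm |h|]; the value of [F] and every
   long enough partial sum are both compared with [P0.[h]]. *)
have [N0 hN0] := hls _ e3.
pose P0 := P (- N0%:Z) (2 * N0).+1.
have near a L : a <= - N0%:Z -> N0%:Z < a + L%:Z -> pnorm `|h| (P a L - P0) <= e / 3.
  move=> h1 h2.
  have [p [q [-> bE]]] := @subwindow a (- N0%:Z) L (2 * N0).+1 ltac:(lia) ltac:(lia).
  rewrite (_ : P0 = P (a + p%:Z) (2 * N0).+1); last by rewrite -bE.
  apply: le_trans (Pdiff _ _ _ _ _ r0) _.
  have := lsub a (p + (2 * N0).+1 + q)%N; rewrite -bE.
  have := hN0 (- N0%:Z) (2 * N0).+1 ltac:(lia) ltac:(lia).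
  by rewrite ltr_distl; lra.
have F3 : `|F (mu0 + h) - complex.Re P0.[h%:C%C]| <= e / 3.
  have hw := wlim_norm (wlimB (hF (mu0 + h)) (wlim_cst (complex.Re P0.[h%:C%C]))).
  apply: (wlim_le hw); exists N0 => a L h1 h2.
  rewrite -Phorner.
  have -> : forall p q : {poly R[i]}, complex.Re p.[h%:C%C] - complex.Re q.[h%:C%C]
    = complex.Re (p - q).[h%:C%C] by move=> p q; rewrite hornerD hornerN raddfB.
  rewrite (@Re_horner_real _ h _ (leqnn _)).
  apply: le_trans (pnorm_coefs r0 _ _ (lexx _)) _.
  exact: near.
near=> n.
have nP : (size P0 <= n)%N by near: n; exists (size P0).
have c3 : `|\sum_(j < n) c j * h ^+ j - complex.Re P0.[h%:C%C]| <= e / 3.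
  have hs : wlim (fun a L => \sum_(j < n) complex.Re (P a L)`_j * h ^+ j)
      (\sum_(j < n) c j * h ^+ j).
    apply: (@wlim_sum n (fun j a L => complex.Re (P a L)`_j * h ^+ j)
      (fun j => c j * h ^+ j)) => j.
    rewrite [_ * _]mulrC (_ : (fun a L => _) = (fun a L => h ^+ j * complex.Re (P a L)`_j)).
      exact: wlimZ.
    by apply/boolp.funext => a; apply/boolp.funext => L; rewrite mulrC.
  have hw := wlim_norm (wlimB hs (wlim_cst (complex.Re P0.[h%:C%C]))).
  apply: (wlim_le hw); exists N0 => a L h1 h2.
  rewrite (@Re_horner_real P0 h n nP) -sumrB.
  rewrite (eq_bigr (fun j : 'I_n => complex.Re (P a L - P0)`_j * h ^+ j)); last first.
    by move=> j _; rewrite coefB raddfB mulrBl.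
  apply: le_trans (pnorm_coefs r0 _ _ (lexx _)) _.
  exact: near.
move: F3 c3; set x := F _; set y := complex.Re _; set z := \sum_(j < n) _ => F3 c3.
have -> : x - z = (x - y) - (z - y) by ring.
by apply: le_lt_trans (ler_normB _ _) _; lra.
Unshelve. all: by end_near. Qed.

End Entire.

(** * Eigenvalues are zeros of the determinant *)

Section Cramer.
Variable A : comNzRingType.

Definition repl L (M : 'M[A]_L) (n : 'I_L) (w : 'cV[A]_L) : 'M[A]_L :=
  \matrix_(i, j) if j == n then w i 0 else M i j.

(** Cramer's rule without division, through the adjugate: it bounds [\det M] when [M *m v] is small
    although [v n] is not. *)
Lemma det_repl_mul L (M : 'M[A]_L) (n : 'I_L) (v : 'cV[A]_L) :
  \det (repl M n (M *m v)) = \det M * v n 0.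
Proof.
rewrite (expand_det_col _ n).
have -> : \det M * v n 0 = (\adj M *m (M *m v)) n 0.
  by rewrite mulmxA mul_adj_mx mul_scalar_mx mxE.
rewrite [RHS]mxE; apply: eq_bigr => i _; rewrite mulrC !mxE eqxx; congr (_ * _).
rewrite /cofactor; congr (_ * \det _); apply/matrixP => a b; rewrite !mxE.
by rewrite eq_sym (negbTE (neq_lift _ _)).
Qed.

End Cramer.

Lemma cvg_sumr (R : realType) (J : Type) (r : seq J) (f : J -> nat -> R) (l : J -> R) :
  (forall j, f j @ \oo --> l j) ->
  (fun N => \sum_(j <- r) f j N) @ \oo --> \sum_(j <- r) l j.
Proof.
move=> h; elim: r => [|j r IH].
  by rewrite big_nil; under boolp.eq_fun do rewrite big_nil; exact: cvg_cst.
by rewrite big_cons; under boolp.eq_fun do rewrite big_cons; exact: cvgD.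
Qed.

(** Eigenvalue equations are limits over symmetric windows, so the estimates derived from them are
    available there only. *)
Lemma wlim_sym_le (R : realType) (u : int -> nat -> R) l c : wlim u l ->
  (exists N0, forall N : nat, (N0 <= N)%N -> u (- N%:Z) (2 * N).+1 <= c) -> l <= c.
Proof.
move=> hu [N' hN']; rewrite leNgt; apply/negP => cl.
have [N hN] := hu (l - c) ltac:(lra).
pose M := (maxn N N').
have := hN (- M%:Z) (2 * M).+1 ltac:(lia) ltac:(lia).
have := hN' M ltac:(lia).
by rewrite ltr_distl; lra.
Qed.

Section Eigen.
Variables (R : realType) (K : int -> int -> R[i]).
Hypothesis sumK : summable2 K.

Lemma l2_bounded (x : int -> R[i]) : l2 x -> exists X, forall n, normc (x n) <= X.
Proof.
move=> [M hM]; exists (1 + M) => n.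
pose s n := complex.Re (x n) ^+ 2 + complex.Im (x n) ^+ 2.
have s0 m : 0 <= s m by rewrite addr_ge0 ?sqr_ge0.
have h := hM (absz n).
have hn : s n <= M.
  apply: le_trans h; rewrite /reC /imC.
  have hj : (absz (n + (absz n)%:Z)%R < (2 * absz n).+1)%N by lia.
  rewrite (bigD1 (Ordinal hj)) //= (_ : (absz (n + (absz n)%:Z)%R)%:Z - (absz n)%:Z = n); last by lia.
  by rewrite lerDl; apply: sumr_ge0 => j _; rewrite -/(s _).
have -> : normc (x n) = Num.sqrt (s n) by rewrite /s; case: (x n).
rewrite -[leRHS]ger0_norm; last by have := s0 n; lra.
rewrite -sqrtr_sqr; apply: ler_wsqrtr; have := s0 n; nra.
Qed.

Lemma Re_matvec (x : int -> R[i]) n N : reC (matvec_partial K x n N)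
  = wsum (- N%:Z) (2 * N).+1 (fun m => complex.Re (K n m * x m)).
Proof.
by rewrite /matvec_partial /reC raddf_sum; apply: eq_bigr => j _; rewrite addrC.
Qed.

Lemma Im_matvec (x : int -> R[i]) n N : imC (matvec_partial K x n N)
  = wsum (- N%:Z) (2 * N).+1 (fun m => complex.Im (K n m * x m)).
Proof.
by rewrite /matvec_partial /imC raddf_sum; apply: eq_bigr => j _; rewrite addrC.
Qed.

Lemma wsum_incr_le (s t : int -> R) C (N N' : nat) : (N <= N')%N ->
  (forall n, `|s n| <= C * t n) ->
  `|wsum (- N'%:Z) (2 * N').+1 s - wsum (- N%:Z) (2 * N).+1 s| <=
    C * (wsum (- N'%:Z) (2 * N').+1 t - wsum (- N%:Z) (2 * N).+1 t).
Proof.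
move=> hN h.
have [p [q [-> ->]]] := @subwindow (- N'%:Z) (- N%:Z) (2 * N').+1 (2 * N).+1 ltac:(lia) ltac:(lia).
apply: le_trans (wsum_wdom s _ _ _ _) _; rewrite !wsumD.
have i1 a L : wsum a L (fun n => `|s n|) <= C * wsum a L t.
  by rewrite -wsumZ; apply: ler_wsum.
have := i1 (- N'%:Z) p; have := i1 (- N'%:Z + (p + (2 * N).+1)%N%:Z) q; lra.
Qed.

(** A truncated eigenvector is nearly in the kernel of the section at [mu = l^-1]: the truncation
    error vanishes as the window grows, and moving [mu] by [e] costs [O(|e|)] in l1 norm. *)
Lemma eig_resid (x : int -> R[i]) (l : R) : l != 0 -> l2 x -> eigen_eq K l%:C%C x ->
  exists2 C, 0 <= C & forall d, 0 < d -> exists N0, forall N, (N0 <= N)%N -> forall e : R,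
   \sum_(i < (2 * N).+1)
      normc (((1%:M + sec (- N%:Z) (2 * N).+1 (fun n m => - (l^-1 + e)%:C%C * K n m))
       *m (\col_(j < (2 * N).+1) x (- N%:Z + (j : nat)%:Z))) i 0) <= C * `|e| + d.
Proof.
move=> l0 hl2 heig; have [X hX] := l2_bounded hl2.
have X0 : 0 <= X := le_trans (normc_ge0 _) (hX 0).
have [M hM] := sumK.
have M0 : 0 <= M := le_trans (ssum_ge0 K 0 0) (hM 0 0%N).
have [S [hS lub]] := wlim_mono (ssum_mono (@normc_ge0 R) K) hM.
pose W N (s : int -> R) := wsum (- N%:Z) (2 * N).+1 s.
pose mv n N := matvec_partial K x n N.
pose tl N := S - ssumC (- N%:Z) (2 * N).+1 K.
have ReM n m : `|complex.Re (K n m * x m)| <= X * normc (K n m).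
  apply: le_trans (ler_Re_normc _) _.
  by rewrite normcM mulrC ler_wpM2r ?normc_ge0.
have ImM n m : `|complex.Im (K n m * x m)| <= X * normc (K n m).
  apply: le_trans (ler_Im_normc _) _.
  by rewrite normcM mulrC ler_wpM2r ?normc_ge0.
have mvS N : W N (fun n => normc (mv n N)) <= X * M.
  apply: (@le_trans _ _ (X * ssumC (- N%:Z) (2 * N).+1 K)); last by rewrite ler_wpM2l.
  rewrite /ssumC /ssum exchange_wsum -wsumZ; apply: ler_wsum => n _ _.
  rewrite /mv /matvec_partial.
  apply: le_trans (nu_sum (@normc0 R) (@le_normcD R) _ _ _) _.
  rewrite -wsumZ; apply: ler_sum => j _; rewrite normcM mulrC addrC.
  by rewrite ler_wpM2r ?normc_ge0.
(* By the eigenvalue equation the difference is the part of the row sums with [m] outside the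
   window, bounded by [X] times the tail of the entry sum. The factor 2 comes from treating real and
   imaginary parts separately. *)
have resid N : W N (fun n => normc (l%:C%C * x n - mv n N)) <= 2 * X * tl N.
  pose u N' := W N (fun n => `|complex.Re (l%:C%C * x n) - reC (mv n N')|
                           + `|complex.Im (l%:C%C * x n) - imC (mv n N')|).
  have u0 : u @ \oo --> 0.
    rewrite /u /W /wsum.
    rewrite [X in _ --> X](_ : 0 = \sum_(j < (2 * N).+1) (0 : R)); last by rewrite big1.
    refine (@cvg_sumr R _ _ (fun (j : 'I_(2 * N).+1) N' =>
      let n := - N%:Z + (j : nat)%:Z in `|complex.Re (l%:C%C * x n) - reC (mv n N')|
                           + `|complex.Im (l%:C%C * x n) - imC (mv n N')|) (fun=> 0) _) => j.
    rewrite -[0]addr0.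
    have [h1 h2] := heig (- N%:Z + (j : nat)%:Z).
    apply: cvgD; rewrite -(@normr0 _ R); apply: cvg_norm.
      rewrite -[0](subrr (complex.Re (l%:C%C * x (- N%:Z + (j : nat)%:Z)))).
      by apply: cvgB; [exact: cvg_cst | exact: h1].
    rewrite -[0](subrr (complex.Im (l%:C%C * x (- N%:Z + (j : nat)%:Z)))).
    by apply: cvgB; [exact: cvg_cst | exact: h2].
  rewrite leNgt; apply/negP => hlt.
  rewrite -subr_gt0 in hlt; move/cvgrPdist_lt : u0 => /(_ _ hlt)[N1 _ hN1].
  have := hN1 (maxn N N1) (leq_maxr _ _); rewrite sub0r normrN.
  apply/negP; rewrite -leNgt; apply: le_trans _ (ler_norm _).
  rewrite lerBlDr; set N' := maxn N N1.
  apply: (@le_trans _ _ (u N' + W N (fun n => `|reC (mv n N') - reC (mv n N)|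
                                       + `|imC (mv n N') - imC (mv n N)|))).
    rewrite -wsum_add; apply: ler_wsum => n _ _.
    apply: le_trans (normc_le_ReIm _) _; rewrite !raddfB /=.
    rewrite /reC /imC.
    move: (complex.Re _) (complex.Re (mv n N)) (complex.Re (mv n N'))
      (complex.Im (_ * _)) (complex.Im (mv n N)) (complex.Im (mv n N')) => a b c a' b' c'.
    have := ler_normD (a - c) (c - b); have := ler_normD (a' - c') (c' - b').
    have -> : a - c + (c - b) = a - b by ring.
    have -> : a' - c' + (c' - b') = a' - b' by ring.
    lra.
  rewrite lerD2l.
  have NN' : (N <= N')%N by rewrite leq_maxl.
  apply: (@le_trans _ _ (W N (fun n => 2 * X * (W N' (fun m => normc (K n m))
       - W N (fun m => normc (K n m)))))).
    apply: ler_wsum => n _ _; rewrite !Re_matvec !Im_matvec.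
    have := wsum_incr_le NN' (ReM n); have := wsum_incr_le NN' (ImM n); rewrite -/(W _ _).
    by rewrite /W; lra.
  rewrite /W wsumZ wsumB ler_wpM2l //; first lra.
  rewrite /tl lerB //; last by rewrite /ssumC /ssum exchange_wsum.
  apply: le_trans (lub (- N'%:Z) (2 * N').+1); rewrite /ssum [leRHS]exchange_wsum.
  have [p [q [-> ->]]] := @subwindow (- N'%:Z) (- N%:Z) (2 * N').+1 (2 * N).+1 ltac:(lia) ltac:(lia).
  apply: ler_wsum_sub => n; apply: wsum_ge0 => m; exact: normc_ge0.
have li0 : 0 <= `|l^-1| by [].
exists (X * M); first exact: mulr_ge0.
move=> d d0.
have c0 : 0 < `|l^-1| * (2 * X) + 1 by have := mulr_ge0 li0 X0; nra.
have [N0 hN0] := hS _ (divr_gt0 d0 c0).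
exists N0 => N hN e.
apply: (@le_trans _ _ (W N (fun n => `|l^-1| * normc (l%:C%C * x n - mv n N)
    + `|e| * normc (mv n N)))).
  apply: ler_sum => i _; rewrite mulmxDl mul1mx !mxE.
  set n := - N%:Z + (i : nat)%:Z.
  have -> : \sum_j (sec (- N%:Z) (2 * N).+1 (fun n m => - (l^-1 + e)%:C%C * K n m)) i j
     * (\col_(j < (2 * N).+1) x (- N%:Z + (j : nat)%:Z)) j 0 = - (l^-1 + e)%:C%C * mv n N.
    rewrite /mv /matvec_partial mulr_sumr; apply: eq_bigr => j _.
    by rewrite !mxE mulrA [(j : nat)%:Z - _]addrC.
  have lc0 : l%:C%C != 0 :> R[i] by rewrite (inj_eq (@complexI R)).
  (* The residual splits into the truncation error of the eigenvalue equation and the effect of the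
     displacement [e]. *)
  have -> : x n + - (l^-1 + e)%:C%C * mv n N
     = (l^-1)%:C%C * (l%:C%C * x n - mv n N) + (- e%:C%C * mv n N).
    by rewrite rmorphD fmorphV; field.
  apply: le_trans (le_normcD _ _) _; rewrite !normcM normcN !normc_real.
  exact: lexx.
rewrite /W wsum_add !wsumZ -/(W _ _) -/(W _ _) addrC; apply: lerD.
  by rewrite mulrC ler_wpM2r.
apply: (@le_trans _ _ (`|l^-1| * (2 * X * tl N))); first by rewrite ler_wpM2l.
have h1 : tl N < d / (`|l^-1| * (2 * X) + 1).
  have := hN0 (- N%:Z) (2 * N).+1 ltac:(lia) ltac:(lia).
  by rewrite /tl /ssumC ltr_distl; lra.
have tl0 : 0 <= tl N by rewrite /tl subr_ge0; exact: lub.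
move: h1; rewrite ltr_pdivlMr //; have := mulr_ge0 li0 X0; nra.
Qed.

Variable F : R -> R.
Hypothesis hF : forall mu,
  wlim (fun a L => complex.Re (wdet (fun n m => - mu%:C%C * K n m) a L)) (F mu).

(** The columns in [s], which will hold residuals, contribute their l1 norms [w]; the remaining ones
    cost at most a constant independent of the window. *)
Lemma repl_colprod a L (K' : int -> int -> R[i]) (M : R) (s : pred 'I_L) (w : 'I_L -> R)
   (N : 'M[R[i]]_L) :
  ssumC a L K' <= M ->
  (forall j, s j -> \sum_i normc (N i j) = w j) ->
  (forall j, ~~ s j -> forall i, N i j = (1%:M + sec a L K') i j) ->
  normc (\det N) <= (\prod_(j | s j) w j) * expR M.
Proof.
move=> hM hs hns.
apply: le_trans (nu_det (@normc_ge0 R) (@normc0 R) (@normc1 R) (@normcN R)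
  (@le_normcD R) _ _) _; first by move=> x y; rewrite normcM.
rewrite (bigID s) /=; apply: ler_pM.
- by apply: prodr_ge0 => j _; apply: sumr_ge0 => i _; exact: normc_ge0.
- by apply: prodr_ge0 => j _; apply: sumr_ge0 => i _; exact: normc_ge0.
- by rewrite (eq_bigr w).
pose x (j : 'I_L) := wsum a L (fun n => normc (K' n (a + (j : nat)%:Z))).
have x0 j : 0 <= x j by apply: wsum_ge0 => ?; exact: normc_ge0.
apply: (@le_trans _ _ (\prod_j (1 + x j))); last first.
  apply: le_trans (prod1D_le_exp _ x0) _; rewrite ler_expR; exact: hM.
rewrite [leRHS](bigID s) /= -[leLHS]mul1r; apply: ler_pM => //.
- by apply: prodr_ge0 => j _; apply: sumr_ge0 => i _; exact: normc_ge0.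
- by apply: (big_ind (fun y => 1 <= y)) => // [y z|j _]; [exact: mulr_ege1 | rewrite lerDl].
apply: ler_prod => j hj; apply/andP; split.
  by apply: sumr_ge0 => i _; exact: normc_ge0.
rewrite /x -sec_colsum; apply: ler_sum => i _; rewrite hns //.
exact: (nu_1sec (@normc0 R) (@normc1 R) (@le_normcD R)).
Qed.

Lemma ssumC_scale M0 (mu : R) a L : (forall a L, ssumC a L K <= M0) ->
  ssumC a L (fun n m => - mu%:C%C * K n m) <= `|mu| * M0.
Proof.
move=> hM; apply: (@le_trans _ _ (`|mu| * ssumC a L K)); last by rewrite ler_wpM2l.
rewrite /ssumC /ssum -wsumZ; apply: ler_wsum => m _ _; rewrite -wsumZ.
by apply: ler_wsum => n _ _; rewrite normcM normcN normc_real.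
Qed.

Lemma ord_of_window (n : int) N : (absz n <= N)%N ->
  exists i : 'I_(2 * N).+1, - N%:Z + (i : nat)%:Z = n.
Proof.
move=> h; have hi : (absz (n + N%:Z)%R < (2 * N).+1)%N by lia.
by exists (Ordinal hi) => /=; lia.
Qed.

Lemma normc_gt0 (z : R[i]) : z != 0 -> 0 < normc z.
Proof.
move=> z0; rewrite lt_neqAle normc_ge0 andbT eq_sym; apply: contra z0 => /eqP h.
by apply/eqP; exact: eq0_normc.
Qed.

(** Cramer's rule at the fixed index [n1]: the determinant times [x n1] is a determinant with one
    column of size [O(|e|)]. *)
Lemma eig_order1 (x : int -> R[i]) (l : R) n1 : l != 0 -> l2 x ->
  eigen_eq K l%:C%C x -> x n1 != 0 ->
  exists C, forall e, `|e| <= 1 -> `|F (l^-1 + e)| <= C * `|e|.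
Proof.
move=> l0 hl2 heig x0; have [C C0 hC] := eig_resid l0 hl2 heig.
have [M hM] := sumK.
have M0 : 0 <= M := le_trans (ssum_ge0 K 0 0) (hM 0 0%N).
have nx := normc_gt0 x0.
pose E := expR ((`|l^-1| + 1) * M).
have E0 : 0 < E by exact: expR_gt0.
exists (C * E / normc (x n1)) => e e1.
apply/ler_addgt0Pr => d d0.
have d'0 : 0 < d * normc (x n1) / E by rewrite divr_gt0 ?mulr_gt0.
have [N0 hN0] := hC _ d'0.
apply: (wlim_sym_le (wlim_norm (@hF (l^-1 + e)))).
exists (maxn N0 (absz n1)) => N; rewrite geq_max => /andP[h1 h2].
have [i iE] := ord_of_window h2.
set K' := (fun n m => _ * K n m).
have := hN0 N h1 e; rewrite -/K'.
set Mx := (1%:M + sec _ _ K'); set v := (\col_j _) => hMx.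
apply: le_trans (ler_Re_normc _) _; rewrite /wdet -/Mx.
have hd := @det_repl_mul _ _ Mx i v.
have h3 : normc (\det (repl Mx i (Mx *m v))) <= (C * `|e| + d * normc (x n1) / E) * E.
  apply: le_trans (@repl_colprod (- N%:Z) (2 * N).+1 K' ((`|l^-1| + 1) * M) (pred1 i)
     (fun=> \sum_j normc ((Mx *m v) j 0)) _ _ _ _) _.
  - apply: le_trans (ssumC_scale _ _ _ hM) _; rewrite ler_wpM2r //.
    by apply: le_trans (ler_normD _ _) _; rewrite lerD2l.
  - by move=> j /eqP ->; apply: eq_bigr => k _; rewrite mxE eqxx.
  - by move=> j /= /negbTE hj k; rewrite mxE hj.
  by rewrite big_pred1_eq ler_wpM2r // ltW.
move: h3; rewrite hd normcM mxE iE.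
rewrite -ler_pdivlMr // => /le_trans; apply.
rewrite le_eqVlt; apply/orP; left; apply/eqP; field.
by rewrite !gt_eqF.
Qed.

(** Cramer's rule used twice: independence of the eigenvectors allows two columns to be replaced by
    residuals, each of size [O(|e|)]. *)
Lemma eig_order2 (x y : int -> R[i]) (l : R) n1 n2 : l != 0 ->
  l2 x -> eigen_eq K l%:C%C x -> l2 y -> eigen_eq K l%:C%C y ->
  x n1 * y n2 != x n2 * y n1 ->
  exists C, forall e, `|e| <= 1 -> `|F (l^-1 + e)| <= C * e ^+ 2.
Proof.
move=> l0 hx ex hy ey.
wlog x0 : n1 n2 / x n1 != 0 => [wl hne|hne].
  have [x1|x1] := eqVneq (x n1) 0; last exact: (wl n1 n2).
  have [x2|x2] := eqVneq (x n2) 0; first by move: hne; rewrite x1 x2 !mul0r eqxx.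
  by apply: (wl n2 n1) => //; rewrite eq_sym.
pose b := y n1 / x n1.
(* This combination vanishes at [n1], hence does not see the column already replaced: the second use
   of Cramer's rule finds the same residual. *)
pose z n := y n - b * x n.
have z1 : z n1 = 0 by rewrite /z /b divfK ?subrr.
have z2 : z n2 != 0.
  apply: contra hne; rewrite /z subr_eq0 => /eqP->; rewrite /b; apply/eqP; field.
  exact: x0.
clearbody b.
have [C C0 hC] := eig_resid l0 hx ex.
have [D D0 hD] := eig_resid l0 hy ey.
have [M hM] := sumK.
have M0 : 0 <= M := le_trans (ssum_ge0 K 0 0) (hM 0 0%N).
have nx := normc_gt0 x0; have nz := normc_gt0 z2.
pose E := expR ((`|l^-1| + 1) * M).
have E0 : 0 < E by exact: expR_gt0.
pose D' := D + normc b * C.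
have D'0 : 0 <= D' by rewrite addr_ge0 // mulr_ge0 ?normc_ge0.
pose B := E / (normc (x n1) * normc (z n2)).
have B0 : 0 < B by rewrite divr_gt0 ?mulr_gt0.
exists (C * D' * B) => e e1.
have ee0 : 0 <= `|e| by [].
apply/ler_addgt0Pr => d d0.
(* [G] collects every term of the product of the two residual bounds that contains [t], using
   [|e| <= 1] and [t <= 1]; then [t * G <= d]. *)
pose G := (C + D' + 1 + normc b) * (1 + normc b) * B.
have nb := normc_ge0 b.
have G0 : 0 < G by rewrite mulr_gt0 // mulr_gt0 //; lra.
pose t := Num.min 1 (d / G).
have t0 : 0 < t by rewrite lt_min ltr01 divr_gt0.
have [N0 hN0] := hC _ t0; have [N1 hN1] := hD _ t0.
apply: (wlim_sym_le (wlim_norm (@hF (l^-1 + e)))).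
exists (maxn (maxn N0 N1) (maxn (absz n1) (absz n2))) => N.
rewrite !geq_max => /andP[/andP[h1 h1'] /andP[h2 h2']].
have [i iE] := ord_of_window h2; have [j jE] := ord_of_window h2'.
have ij : j != i.
  by apply: contraNneq z2 => ji; rewrite -jE ji iE z1.
set K' := (fun n m => _ * K n m).
have := hN0 N h1 e; have := hN1 N h1' e; rewrite -/K'.
set Mx := (1%:M + sec _ _ K'); set v := (\col_j x _); set w := (\col_j y _) => hw hv.
pose u : 'cV[R[i]]_(2 * N).+1 := \col_j z (- N%:Z + (j : nat)%:Z).
have uE : u = w - b *: v by apply/matrixP => k1 k2; rewrite !mxE.
have hu : \sum_k normc ((Mx *m u) k 0) <= D' * `|e| + (1 + normc b) * t.
  apply: (@le_trans _ _ (\sum_k (normc ((Mx *m w) k 0) + normc b * normc ((Mx *m v) k 0)))).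
    apply: ler_sum => k _; rewrite uE mulmxBr -scalemxAr !mxE.
    by apply: le_trans (le_normcD _ _) _; rewrite normcN normcM.
  rewrite big_split /= -mulr_sumr /D'; nra.
apply: le_trans (ler_Re_normc _) _; rewrite /wdet -/Mx.
pose M1 := repl Mx i (Mx *m v).
have M1u : M1 *m u = Mx *m u.
  apply/matrixP => k1 k2; rewrite !mxE; apply: eq_bigr => k _; rewrite !mxE.
  by case: eqP => // ->; rewrite iE z1 !mulr0.
have hd : \det (repl M1 j (Mx *m u)) = \det Mx * (x n1 * z n2).
  by rewrite -M1u det_repl_mul det_repl_mul !mxE iE jE mulrA.
have h3 : normc (\det (repl M1 j (Mx *m u))) <=
    ((C * `|e| + t) * (D' * `|e| + (1 + normc b) * t)) * E.
  apply: le_trans (@repl_colprod (- N%:Z) (2 * N).+1 K' ((`|l^-1| + 1) * M)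
     (fun k => (k == i) || (k == j))
     (fun k => if k == j then \sum_j normc ((Mx *m u) j 0)
        else \sum_j normc ((Mx *m v) j 0)) _ _ _ _) _.
  - apply: le_trans (ssumC_scale _ _ _ hM) _; rewrite ler_wpM2r //.
    by apply: le_trans (ler_normD _ _) _; rewrite lerD2l.
  - move=> k hk; case: (eqVneq k j) hk => [-> _|kj].
      by apply: eq_bigr => k' _; rewrite mxE eqxx.
    rewrite orbF => /eqP ki; apply: eq_bigr => k' _.
    by rewrite mxE (negbTE kj) mxE ki eqxx.
  - by move=> k; rewrite negb_or => /andP[/negbTE ki /negbTE kj] k'; rewrite !mxE kj ki.
  rewrite ler_wpM2r ?(ltW E0) //.
  have su0 : 0 <= \sum_k normc ((Mx *m u) k 0).
    by apply: sumr_ge0 => k _; exact: normc_ge0.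
  have sv0 : 0 <= \sum_k normc ((Mx *m v) k 0).
    by apply: sumr_ge0 => k _; exact: normc_ge0.
  move: hu hv su0 sv0; set su := \sum_k _; set sv := \sum_k _ => hu hv su0 sv0.
  rewrite (bigD1 i) ?eqxx //= (bigD1 j) ?eqxx ?orbT //= big1 ?mulr1; last first.
    by move=> k; case: (k == i); case: (k == j).
  by rewrite eq_sym (negbTE ij); apply: ler_pM.
move: h3; rewrite hd !normcM -ler_pdivlMr ?mulr_gt0 //; move/le_trans; apply.
rewrite [X in X <= _](_ : _ = (C * `|e| + t) * (D' * `|e| + (1 + normc b) * t) * B);
  last by rewrite /B; ring.
rewrite -[e ^+ 2]real_normK ?num_real //.
have t1 : t <= 1 by rewrite ge_min lexx.
have tG : t * G <= d.
  by rewrite -ler_pdivlMr // ge_min lexx orbT.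
apply: (@le_trans _ _ (C * D' * B * `|e| ^+ 2 + t * G)); last by rewrite lerD2l.
have -> : C * D' * B * `|e| ^+ 2 + t * G =
  (C * D' * `|e| ^+ 2 + t * ((C + D' + 1 + normc b) * (1 + normc b))) * B.
  by rewrite /G; ring.
rewrite ler_pM2r //.
have bt0 : 0 <= (1 + normc b) * t by apply: mulr_ge0 (ltW _) => //; apply: addr_ge0 => //; exact: normc_ge0.
have i1 : C * `|e| * ((1 + normc b) * t) <= C * ((1 + normc b) * t).
  by apply: (ler_wpM2r bt0); exact: ler_piMr.
have i2 : t * (D' * `|e|) <= t * D' by rewrite ler_pM2l // ler_piMr.
have i3 : t * ((1 + normc b) * t) <= (1 + normc b) * t.
  by apply: ler_piMl.
have i4 : 0 <= t * (normc b * (D' + normc b)) 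
  by apply: mulr_ge0; [exact: ltW | apply: mulr_ge0 => //; exact: addr_ge0].
nra.
Qed.

Lemma eig_mult1 (l : R) : l != 0 -> eig_mult_ge K l%:C%C 1 -> F l^-1 = 0.
Proof.
move=> l0 [v [ind hv]]; have [h1 h2] := hv ord0.
have [n1 hn] : exists n, v ord0 n != 0.
  apply: boolp.contrapT => hn; suff H n : \sum_(j < 1) 1 * v j n = 0.
    by have /eqP := ind (fun=> 1) H ord0; rewrite oner_eq0.
  rewrite big_ord_recl big_ord0 addr0 mul1r.
  by apply/eqP; apply: boolp.contrapT => /negP hne; apply: hn; exists n.
have [C hC] := eig_order1 l0 h1 h2 hn.
have := hC 0; rewrite normr0 ler01 mulr0 addr0 => /(_ isT).
by rewrite normr_le0 => /eqP.
Qed.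

Lemma eig_mult2 (l : R) : l != 0 -> eig_mult_ge K l%:C%C 2 ->
  exists C, forall e, `|e| <= 1 -> `|F (l^-1 + e)| <= C * e ^+ 2.
Proof.
move=> l0 [v [ind hv]]; have [h1 h2] := hv ord0; have [h3 h4] := hv ord_max.
have [n1 hn1] : exists n, v ord0 n != 0.
  apply: boolp.contrapT => hn.
  suff H n : \sum_(j < 2) (j == ord0)%:R * v j n = 0.
    by have /eqP := ind (fun j => (j == ord0)%:R) H ord0; rewrite oner_eq0.
  rewrite !big_ord_recl big_ord0 mul0r !addr0 mul1r.
  by apply/eqP; apply: boolp.contrapT => /negP hne; apply: hn; exists n.
suff [n2 hn2] : exists n2, v ord0 n1 * v ord_max n2 != v ord0 n2 * v ord_max n1.
  exact: eig_order2 l0 h1 h2 h3 h4 hn2.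
apply: boolp.contrapT => hn.
have := ind (fun j => if j == ord0 then - v ord_max n1 else v ord0 n1) _ ord_max.
rewrite /= => hh; move: hn1; rewrite hh ?eqxx // => n.
rewrite !big_ord_recl big_ord0 /= addr0.
rewrite (_ : lift ord0 ord0 = ord_max); last exact: val_inj.
have : v ord0 n1 * v ord_max n = v ord0 n * v ord_max n1.
  by apply/eqP; apply: boolp.contrapT => /negP hne; apply: hn; exists n.
by move=> ->; ring.
Qed.

End Eigen.

(** * A partial fraction expansion of determinants *)

Section Lagrange.
Variables (F : fieldType) (im : F) (L : nat) (r : 'I_L -> F) (Q : 'M[F]_L).
Hypothesis im2 : im * im = - 1.
Hypothesis two0 : 2 != 0 :> F.
Hypothesis r0 : forall n, r n != 0.
Hypothesis r_inj : forall n m, n != m -> r n ^+ 2 != r m ^+ 2.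

Lemma size_det_leq (d : nat) (M : 'M[{poly F}]_L) :
  (forall i j, (size (M i j) <= d.+1)%N) -> (size (\det M) <= (d * L).+1)%N.
Proof.
move=> h; rewrite /determinant; apply: (leq_trans (size_sum _ _ _)).
apply/bigmax_leqP => s _; rewrite -signr_odd.
have hs : (size (\prod_i M i (s i))%R <= (d * L).+1)%N.
  apply: (leq_trans (size_prod_leq _ _)); rewrite card_ord.
  have : (\sum_(i < L) size (M i (s i)) <= \sum_(i < L) d.+1)%N by apply: leq_sum.
  rewrite sum_nat_const card_ord mulnS [(L * d)%N]mulnC.
  by set S := (\sum_(_ < _) _)%N; lia.
by case: (odd s); rewrite ?expr1 ?expr0 ?mulN1r ?mul1r ?size_polyN.
Qed.

(** Residue matrix at the pole [z = s / r n], where [s ^+ 2 = -1]: column n carries the polar part,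
    and in the others [2 r_m z / (r_m^2 z^2 + 1)] takes its value at the pole,
    [- s * 2 r_m r_n / (r_m^2 - r_n^2)]. *)
Definition lagr_mx (s : F) (n : 'I_L) : 'M[F]_L :=
  \matrix_(l, m) if m == n then Q l n
    else (l == m)%:R + s * (2 * r m * r n / (r m ^+ 2 - r n ^+ 2)) * Q l m.

(** Denominators cleared columnwise: [\det PM] is the wanted determinant times [base], and [T] is
    the partial fraction identity multiplied out. *)
Let PM : 'M[{poly F}]_L := \matrix_(l, m)
  (((r m ^+ 2) *: 'X^2 + 1) *+ (l == m) - (2 * r m * Q l m) *: 'X).
Let quad (m : 'I_L) : {poly F} := (r m ^+ 2) *: 'X^2 + 1.
Let base : {poly F} := \prod_m quad m.
(** The factors vanish at 0, at the opposite node [- s / r n] and at the nodes of all other indices,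
    so at [s / r n] only this term survives. *)
Let term (s : F) (n : 'I_L) : {poly F} :=
  (s * \det (lagr_mx s n)) *: ((r n *: 'X) * (r n *: 'X + s%:P) * \prod_(m | m != n) quad m).
Let T : {poly F} := \det PM - base - \sum_n (term im n + term (- im) n).

Lemma size_quad m : (size (quad m) <= 3)%N.
Proof.
rewrite /quad; apply: (leq_trans (size_polyD _ _)); rewrite size_poly1 geq_max andbT.
by apply: (leq_trans (size_scale_leq _ _)); rewrite size_polyXn.
Qed.

Lemma size_lagr_poly : (size T <= (2 * L).+1)%N.
Proof.
have hsum (p q : {poly F}) k : (size p <= k)%N -> (size q <= k)%N -> (size (p + q)%R <= k)%N.
  by move=> h1 h2; apply: (leq_trans (size_polyD _ _)); rewrite geq_max h1.
have hterm s n : (size (term s n) <= (2 * L).+1)%N.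
  rewrite /term; apply: (leq_trans (size_scale_leq _ _)).
  apply: (leq_trans (size_polyMleq _ _)).
  have h1 : (size ((r n *: 'X) * (r n *: 'X + s%:P) : {poly F})%R <= 3)%N.
    apply: (leq_trans (size_polyMleq _ _)).
    have h2 : (size (r n *: 'X : {poly F}) <= 2)%N.
      by apply: (leq_trans (size_scale_leq _ _)); rewrite size_polyX.
    have h3 : (size (r n *: 'X + s%:P : {poly F})%R <= 2)%N.
      by apply: (hsum) => //; apply: (leq_trans (size_polyC_leq1 _)).
    by move: h2 h3; lia.
  have h4 : (size (\prod_(m | m != n) quad m)%R <= (2 * L.-1).+1)%N.
    apply: (leq_trans (size_prod_leq _ _)).
    have : (\sum_(m | m != n) size (quad m) <= \sum_(m | m != n) 3)%N.
      by apply: leq_sum => m _; exact: size_quad.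
    rewrite sum_nat_const cardC1 card_ord.
    by set S := (\sum_(_ | _) _)%N; lia.
  move: h1 h4; have := ltn_ord n; lia.
rewrite /T; apply: (hsum); last first.
  rewrite size_polyN; apply: (leq_trans (size_sum _ _ _)).
  by apply/bigmax_leqP => n _; apply: (hsum); exact: hterm.
apply: (hsum).
  apply: size_det_leq => i j; rewrite mxE; apply: (hsum).
    by case: (i == j); rewrite ?mulr0n ?size_poly0 // mulr1n size_quad.
  by rewrite size_polyN; apply: (leq_trans (size_scale_leq _ _)); rewrite size_polyX.
rewrite size_polyN; apply: (leq_trans (size_prod_leq _ _)).
have : (\sum_m size (quad m) <= \sum_(m < L) 3)%N by apply: leq_sum => m _; exact: size_quad.
rewrite sum_nat_const card_ord.
by set S := (\sum_(_ < _) _)%N; lia.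
Qed.

Lemma horner_quad m z : (quad m).[z] = r m ^+ 2 * z ^+ 2 + 1.
Proof. by rewrite /quad !hornerE. Qed.

Lemma horner_PM z : (\det PM).[z] =
  \det (\matrix_(l, m) ((r m ^+ 2 * z ^+ 2 + 1) *+ (l == m) - 2 * r m * Q l m * z)).
Proof.
rewrite -[LHS]/(horner_eval _ _) -det_map_mx; congr (\det _); apply/matrixP => i j.
rewrite !mxE /= /horner_eval hornerD hornerN hornerMn.
by rewrite !hornerE.
Qed.

Lemma horner_term s n z : (term s n).[z] =
  s * \det (lagr_mx s n) * (r n * z * (r n * z + s)) * \prod_(m | m != n) (r m ^+ 2 * z ^+ 2 + 1).
Proof.
rewrite /term hornerZ hornerM horner_prod.
rewrite (_ : (r n *: 'X * (r n *: 'X + s%:P)).[z] = r n * z * (r n * z + s)); last first.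
  by rewrite !hornerE.
by under eq_bigr do rewrite horner_quad; rewrite !mulrA.
Qed.

Lemma PM_node s n : s * s = - 1 -> (\det PM).[s / r n] =
  - 2 * s * \det (lagr_mx s n) * \prod_(m | m != n) (r m ^+ 2 * (s / r n) ^+ 2 + 1).
Proof.
move=> s2; rewrite horner_PM.
have sr : (s / r n) ^+ 2 = - (r n ^- 2).
  by rewrite expr_div_n expr2 s2 mulN1r.
pose d : 'rV[F]_L := \row_m if m == n then - 2 * s else r m ^+ 2 * (s / r n) ^+ 2 + 1.
have -> : \matrix_(l, m) ((r m ^+ 2 * (s / r n) ^+ 2 + 1) *+ (l == m) - 2 * r m * Q l m * (s / r n))
   = lagr_mx s n *m diag_mx d.
  apply/matrixP => l m; rewrite mul_mx_diag !mxE.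
  have rn := r0 n.
  have [->|mn] := eqVneq m n.
    rewrite sr mulrN mulfV ?expf_eq0 //= addNr mul0rn sub0r; field.
    exact: rn.
  have h : r m ^+ 2 - r n ^+ 2 != 0 by rewrite subr_eq0 r_inj.
  rewrite sr -mulr_natr; field.
  by rewrite h rn.
rewrite det_mulmx det_diag (bigD1 n) //= mxE eqxx mulrA [_ * (- 2 * s)]mulrC.
by congr (_ * _); apply: eq_bigr => m /negbTE hm; rewrite mxE hm.
Qed.

Lemma T_node s n : s = im \/ s = - im -> T.[s / r n] = 0.
Proof.
move=> hs; have s2 : s * s = - 1 by case: hs => ->; rewrite ?mulrNN.
have sr : r n ^+ 2 * (s / r n) ^+ 2 + 1 = 0.
  have -> : r n ^+ 2 * (s / r n) ^+ 2 = s * s by field.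
  by rewrite s2 addNr.
rewrite /T !hornerD !hornerN PM_node //.
have -> : base.[s / r n] = 0.
  by rewrite /base horner_prod (bigD1 n) //= horner_quad sr mul0r.
rewrite horner_sum [\sum_(_ < _) _](bigD1 n) //= [\sum_(_ < _ | _) _]big1 => [|m mn]; last first.
  have nm : n != m by rewrite eq_sym.
  by rewrite hornerD !horner_term (bigD1 n) //= sr !mul0r !mulr0 addr0.
rewrite hornerD !horner_term.
have -> : r n * (s / r n) = s by rewrite mulrCA mulfV ?mulr1.
rewrite subr0 addr0; case: hs => hs; rewrite hs.
  set D := \det _; set D' := \det _; set P := \prod_(_ < _ | _) _.
  transitivity (- 2 * im * D * P * (1 + im * im)); first by ring.
  by rewrite im2; ring.
set D := \det _; set D' := \det (lagr_mx im n); set P := \prod_(_ < _ | _) _.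
transitivity (2 * im * D * P * (1 + im * im)); first by ring.
by rewrite im2; ring.
Qed.

(** The degree is at most [2 * L], while 0 and the [2 * L] nodes [im / r n], [- im / r n] are
    distinct roots. *)
Lemma T_eq0 : T = 0.
Proof.
have im0 : im != 0.
  by apply: contraTneq (oner_neq0 F) => h; move: im2; rewrite h mul0r => /eqP; rewrite eq_sym oppr_eq0 => ->.
pose nodes s := [seq s / r n | n <- enum 'I_L].
have inj s : s != 0 -> injective (fun n => s / r n).
  move=> s0 n m /(mulfI s0) /invr_inj h; apply/eqP; apply: contraT => /r_inj.
  by rewrite h eqxx.
apply: (@roots_geq_poly_eq0 _ _ (0 :: nodes im ++ nodes (- im))).
- rewrite /= all_cat; apply/and3P; split.
  + rewrite rootE /T !hornerD !hornerN horner_PM horner_sum big1; last first.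
      by move=> n _; rewrite hornerD !horner_term !mulr0 !mul0r !mulr0 !mul0r addr0.
    rewrite /base horner_prod big1; last by move=> m _; rewrite horner_quad expr0n mulr0 add0r.
    rewrite (_ : \matrix_(l, m) _ = 1%:M) ?det1 ?subrr ?subr0 //.
    by apply/matrixP => i j; rewrite !mxE expr0n !mulr0 subr0 add0r.
  + by apply/allP => _ /mapP[n _ ->]; rewrite rootE T_node //; left.
  + by apply/allP => _ /mapP[n _ ->]; rewrite rootE T_node //; right.
- rewrite /= cat_uniq; apply/and4P; split.
  + rewrite mem_cat negb_or; apply/andP; split; apply/negP => /mapP[n _ /eqP].
      by rewrite eq_sym mulf_eq0 (negbTE im0) invr_eq0 (negbTE (r0 n)).
    by rewrite eq_sym mulf_eq0 oppr_eq0 (negbTE im0) invr_eq0 (negbTE (r0 n)).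
  + by rewrite map_inj_uniq ?enum_uniq //; exact: inj.
  + apply/hasPn => _ /mapP[n _ ->]; apply/negP => /mapP[m _ h].
    have hsq : (- im / r n) ^+ 2 = (im / r m) ^+ 2 by rewrite h.
    have [nm|/r_inj] := eqVneq n m; last first.
      move/negP; apply; move: hsq; rewrite !expr_div_n sqrrN => /mulfI; rewrite expf_eq0 im0.
      by move=> /(_ isT)/invr_inj ->.
    move: h; rewrite nm => /(mulIf (invr_neq0 (r0 m)))/eqP.
    rewrite eq_sym -subr_eq0 opprK -mulr2n -mulr_natl mulf_eq0 (negbTE im0) orbF.
    by rewrite (negbTE two0).
  + by rewrite map_inj_uniq ?enum_uniq //; apply: inj; rewrite oppr_eq0.
rewrite /= size_cat !size_map -enumT size_enum_ord.
by apply: (leq_trans size_lagr_poly); lia.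
Qed.

(* Partial fractions in [z], whose poles are [im / r n] and [- im / r n] *)
Lemma det_partial_fractions z : (forall n, r n ^+ 2 * z ^+ 2 + 1 != 0) ->
  \det (1%:M - \matrix_(l, m) (Q l m * (2 * r m * z / (r m ^+ 2 * z ^+ 2 + 1)))) =
  1 + \sum_n (im * (\det (lagr_mx im n) - \det (lagr_mx (- im) n))
                * (r n ^+ 2 * z ^+ 2 / (r n ^+ 2 * z ^+ 2 + 1))
              - (\det (lagr_mx im n) + \det (lagr_mx (- im) n))
                * (r n * z / (r n ^+ 2 * z ^+ 2 + 1))).
Proof.
move=> z0; set B := \prod_n (r n ^+ 2 * z ^+ 2 + 1).
have B0 : B != 0 by apply/prodf_neq0 => n _; exact: z0.
have hP : (\det PM).[z] = \det (1%:M - \matrix_(l, m)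
    (Q l m * (2 * r m * z / (r m ^+ 2 * z ^+ 2 + 1)))) * B.
  pose d : 'rV[F]_L := \row_m (r m ^+ 2 * z ^+ 2 + 1).
  have -> : B = \det (diag_mx d) by rewrite det_diag; apply: eq_bigr => m _; rewrite mxE.
  rewrite horner_PM -det_mulmx; congr (\det _); apply/matrixP => l m.
  rewrite mul_mx_diag !mxE -mulr_natr; have := z0 m.
  by move: (_ + 1) => D D0; field.
apply: (mulIf B0); rewrite -hP mulrDl mul1r mulr_suml.
have : T.[z] = 0 by rewrite T_eq0 horner0.
rewrite /T !hornerD !hornerN => /eqP; rewrite subr_eq0 subr_eq => /eqP ->.
rewrite addrC; congr (_ + _).
  by rewrite /base horner_prod; apply: eq_bigr => m _; exact: horner_quad.
rewrite horner_sum; apply: eq_bigr => n _; rewrite hornerD !horner_term.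
have -> : B = (r n ^+ 2 * z ^+ 2 + 1) * \prod_(m | m != n) (r m ^+ 2 * z ^+ 2 + 1).
  by rewrite /B (bigD1 n).
set C := \prod_(_ < _ | _) _.
set b1 := \det _; set b2 := \det _.
have zn := z0 n; set D := _ + 1 in zn *.
apply: (mulfI zn); rewrite [RHS]mulrC.
have -> : (im * (b1 - b2) * (r n ^+ 2 * z ^+ 2 / D) - (b1 + b2) * (r n * z / D)) * (D * C) * D
  = (im * (b1 - b2) * (r n ^+ 2 * z ^+ 2) + (im * im) * (b1 + b2) * (r n * z)) * C * D.
  by rewrite im2; field.
by ring.
Qed.

End Lagrange.

(** * Toeplitz matrices weighted by the hyperbolic secant *)

Section Sech.
Variable R : realType.
Implicit Types x u v b : R.

(** [1 / cosh u], written so that [sech (x + u)] is the rational function [2 r z / (r^2 z^2 + 1)] of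
    [z = expR x], with [r = expR u]. *)
Definition sech u : R := 2 * expR u / (expR u ^+ 2 + 1).
(* [logi2 u] is [(1 + tanh u) / 2] *)
Definition logi2 u : R := expR u ^+ 2 / (expR u ^+ 2 + 1).

Lemma expR2D1_gt0 u : 0 < expR u ^+ 2 + 1.
Proof. by have := sqr_ge0 (expR u); lra. Qed.

Lemma sech_gt0 u : 0 < sech u.
Proof. by rewrite divr_gt0 ?mulr_gt0 ?expR_gt0 ?expR2D1_gt0. Qed.

Lemma sechN u : sech (- u) = sech u.
Proof.
rewrite /sech expRN; have := expR2D1_gt0 u; have := expR_gt0 u.
set E := expR u => E0 E1; field.
by rewrite !gt_eqF // addrC.
Qed.

Lemma sech0 : sech 0 = 1.
Proof. by rewrite /sech expR0 expr1n mulr1 divff. Qed.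

Lemma wsum_telescope a L (g : int -> R) : wsum a L (fun n => g (n + 1) - g n) = g (a + L%:Z) - g a.
Proof.
elim: L => [|L IH]; first by rewrite /wsum big_ord0 addr0 subrr.
by rewrite wsumS_r IH (_ : a + L%:Z + 1 = a + L.+1%:Z); [ring | lia].
Qed.

(** Each term is at most a constant times the increment of the logistic function [lg] over a step
    [b]; these increments telescope inside [[0, 1]]. The bound is uniform in [x] and in the
    window. *)
Lemma wsum_sech b : 0 < b ->
  exists M, forall x a L, wsum a L (fun n => sech (x + b * n%:~R)) <= M.
Proof.
move=> b0; have B1 : 1 < expR b by rewrite expR_gt1.
pose B := expR b; pose lg u : R := expR u / (expR u + 1).
have lg01 u : 0 <= lg u <= 1.
  have := expR_gt0 u => E0.
  by rewrite /lg divr_ge0 ?ler_pdivrMr ?mul1r; lra.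
exists (4 * B / (B - 1)) => x a L.
apply: (@le_trans _ _ (wsum a L (fun n => 4 * B / (B - 1) *
    (lg (x + b * (n + 1)%:~R) - lg (x + b * n%:~R))))).
  apply: ler_wsum => n _ _.
  have -> : x + b * (n + 1)%:~R = (x + b * n%:~R) + b by rewrite intrD; ring.
  set u := x + _; rewrite /sech /lg expRD -/B.
  have := expR_gt0 u; set E := expR u => E0.
  have B1' : 1 < B by []. have EB : 0 < E * B by rewrite mulr_gt0 // /B expR_gt0.
  have -> : 4 * B / (B - 1) * (E * B / (E * B + 1) - E / (E + 1))
      = 4 * B * E / ((E * B + 1) * (E + 1)).
    by field; rewrite !gt_eqF //; lra.
  rewrite ler_pdivrMr; last by have := sqr_ge0 E; lra.
  rewrite mulrAC ler_pdivlMr; last by rewrite mulr_gt0; lra.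
  have h1 : (E * B + 1) * (E + 1) <= 2 * B * (E ^+ 2 + 1).
    by have := sqr_ge0 (E - 1); nra.
  by apply: le_trans (ler_wpM2l _ h1) _; [lra | rewrite le_eqVlt; apply/orP; left; apply/eqP; ring].
rewrite wsumZ wsum_telescope ler_piMr //.
  by rewrite divr_ge0 ?mulr_ge0 // ?expR_ge0 // subr_ge0 ltW.
have := lg01 (x + b * (a + L%:Z)%:~R); have := lg01 (x + b * a%:~R); lra.
Qed.

Lemma wsummable_sech b x : 0 < b -> wsummable (fun n => sech (x + b * n%:~R)).
Proof.
move=> b0; have [M hM] := wsum_sech b0; exists M => a L.
by rewrite (eq_wsum (s' := fun n => sech (x + b * n%:~R))) // => n _ _; rewrite gtr0_norm ?sech_gt0.
Qed.

(** [logi2] itself is not summable over the lattice; its differences are, being dominated by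
    [sech]. *)
Lemma logi2_diff u v : `|logi2 u - logi2 v| <= `|1 - expR (2 * (v - u))| * expR (u - v) * sech u.
Proof.
have -> : expR (2 * (v - u)) = (expR v / expR u) ^+ 2.
  by rewrite -expRB -expRM_natl mulr_natl; congr expR; rewrite mulr_natl.
rewrite expRB /logi2 /sech.
have := expR_gt0 u; have := expR_gt0 v; set p := expR u; set q := expR v => q0 p0.
have p1 : 0 < p ^+ 2 + 1 by have := sqr_ge0 p; lra.
have q1 : 0 < q ^+ 2 + 1 by have := sqr_ge0 q; lra.
have -> : p ^+ 2 / (p ^+ 2 + 1) - q ^+ 2 / (q ^+ 2 + 1)
  = (1 - (q / p) ^+ 2) * (p ^+ 2 / ((p ^+ 2 + 1) * (q ^+ 2 + 1))).
  by field; rewrite !gt_eqF.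
rewrite normrM -mulrA ler_wpM2l // ger0_norm; last first.
  by rewrite divr_ge0 ?sqr_ge0 // mulr_ge0 ?ltW.
rewrite ler_pdivrMr ?mulr_gt0 //.
have -> : p / q * (2 * p / (p ^+ 2 + 1)) * ((p ^+ 2 + 1) * (q ^+ 2 + 1))
  = p ^+ 2 * (2 * (q ^+ 2 + 1) / q) by field; rewrite !gt_eqF.
rewrite ler_peMr ?sqr_ge0 // ler_pdivlMr // mul1r.
by have := sqr_ge0 (q - 1); nra.
Qed.

Lemma logi2_mono u v : u < v -> logi2 u < logi2 v.
Proof.
move=> uv; rewrite /logi2.
have : expR u < expR v by rewrite ltr_expR.
have := expR_gt0 u; set p := expR u; set q := expR v => p0 pq.
have p1 : 0 < p ^+ 2 + 1 by have := sqr_ge0 p; lra.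
have q1 : 0 < q ^+ 2 + 1 by have := sqr_ge0 q; lra.
by rewrite ltr_pdivrMr // mulrAC ltr_pdivlMr //; nra.
Qed.

End Sech.

Section WdetAlgebra.
Variable R : realType.
Implicit Types K : int -> int -> R[i].

Lemma wdet_conj K (D : int -> R[i]) a L : (forall n, D n != 0) ->
  wdet (fun n m => D n * K n m / D m) a L = wdet K a L.
Proof.
move=> D0.
pose d : 'rV[R[i]]_L := \row_j D (a + (j : nat)%:Z).
have dd : \det (diag_mx d) != 0.
  by rewrite det_diag; apply/prodf_neq0 => j _; rewrite mxE.
apply: (mulIf dd); rewrite /wdet [RHS]mulrC -!det_mulmx; congr (\det _).
apply/matrixP => i j; rewrite mul_mx_diag mul_diag_mx !mxE.
rewrite mulrDl mulrDr divfK //; congr (_ + _).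
by case: eqP => [->|_]; rewrite ?mulr1 ?mul1r // mulr0 mul0r.
Qed.

Lemma eq_wdet K K' a L : (forall n m, K n m = K' n m) -> wdet K a L = wdet K' a L.
Proof. by move=> h; rewrite /wdet; congr (\det (_ + _)); apply/matrixP => i j; rewrite !mxE h. Qed.

Lemma wdet_shift K (d : int) a L : wdet (fun n m => K (n + d) (m + d)) a L = wdet K (a + d) L.
Proof.
rewrite /wdet; congr (\det (_ + _)); apply/matrixP => i j; rewrite !mxE.
by congr K; lia.
Qed.

Lemma wdet_wdom_Im K : wdom (fun a L => complex.Im (wdet K a L)) (fun a L => expR (ssumC a L K)).
Proof.
move=> a p L q.
apply: le_trans (nu_det_sec_diff (@normc_ge0 R) (@normc0 R) (@normc1 R) (@normcN R)
  (@le_normcD R) _ _ _ _ _ _); last by move=> x y; rewrite normcM.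
rewrite -raddfB; exact: ler_Im_normc.
Qed.

Lemma wdet_wlim_Im K : summable2 K -> exists l, wlim (fun a L => complex.Im (wdet K a L)) l.
Proof.
move=> [M hM]; apply: (wdom_wlim (wdet_wdom_Im K) (M := expR M)) => a L.
by rewrite expR_ge0 ler_expR hM.
Qed.

End WdetAlgebra.

Section Toeplitz.
Variables (R : realType) (b : R) (q : int -> R[i]).
Hypothesis b0 : 0 < b.

Definition toepK (x : R) (n m : int) : R[i] :=
  (Num.sqrt (sech (x + b * n%:~R)))%:C%C * q (n - m) * (Num.sqrt (sech (x + b * m%:~R)))%:C%C.

Let sg (n : int) : R[i] := (Num.sqrt (sech (b * n%:~R)))%:C%C.
Let csch (n : int) : R := 2 * expR (b * n%:~R) / (expR (b * n%:~R) ^+ 2 - 1).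
(** The residue matrix with the index of its pole moved to 0. Subtracting the identity in column 0
    makes that column of [1 + A0] equal to [q l], as required; [csch], which is [1 / sinh], is only
    used off its pole. *)
Let A0 (s : R[i]) (l m : int) : R[i] :=
  if m == 0 then q l - (l == 0)%:R else s * (csch m)%:C%C * q (l - m).
(** In [A0] only the column index carries a decaying weight. Conjugation by [sg] shares this decay
    between rows and columns, which makes the entries summable without changing determinants. *)
Let K0 (s : R[i]) (l m : int) : R[i] := sg l * A0 s l m / sg m.

Lemma sqrt_sech_neq0 x : (Num.sqrt (sech x))%:C%C != 0 :> R[i].
Proof. by rewrite (inj_eq (@complexI R)) gt_eqF // sqrtr_gt0 sech_gt0. Qed.

(** For [m != 0] the exponential [expR (b m)] stays away from 1 by at least the factor [expR b], in
    one direction or the other. *)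
Lemma csch_le : exists C, forall m, m != 0 -> `|csch m| <= C * sech (b * m%:~R).
Proof.
have B1 : 1 < expR b by rewrite expR_gt1.
set B := expR b in B1; have B2 : 1 < B ^+ 2 by rewrite expr_gt1 //; lra.
exists ((B ^+ 2 + 1) / (B ^+ 2 - 1)) => m m0; rewrite /csch /sech.
have := expR_gt0 (b * m%:~R).
have : B <= expR (b * m%:~R) \/ expR (b * m%:~R) * B <= 1.
  have [h|h] := leP 1 m.
    left; rewrite /B ler_expR ler_peMr //; first exact: ltW.
    by rewrite -[1]/(1%:~R) ler_int.
  have hm : m%:~R <= -1 :> R by rewrite -[-1]/((-1)%:~R) ler_int; lia.
  right; rewrite /B -expRD -[leRHS]expR0 ler_expR.
  by move: hm; move: (m%:~R : R) => y hm; have := b0; nra.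
set E := expR (b * m%:~R) => hE E0.
have E1 : 0 < E ^+ 2 + 1 by have := sqr_ge0 E; lra.
have hE2 : B ^+ 2 <= E ^+ 2 \/ E ^+ 2 * B ^+ 2 <= 1.
  case: hE => h; [left | right].
    by rewrite lerXn2r // nnegrE; lra.
  by rewrite -exprMn exprn_ile1 // mulr_ge0; lra.
rewrite normrM normfV ger0_norm; last lra.
have -> : (B ^+ 2 + 1) / (B ^+ 2 - 1) * (2 * E / (E ^+ 2 + 1))
  = 2 * E * ((B ^+ 2 + 1) / ((B ^+ 2 - 1) * (E ^+ 2 + 1))).
  by field; rewrite !gt_eqF //; lra.
rewrite ler_pM2l; last lra.
have B3 : 0 < B ^+ 2 - 1 by lra.
have N0 : 0 < `|E ^+ 2 - 1|.
  by rewrite normr_gt0 subr_eq0; apply/eqP => h; case: hE2; rewrite h; lra.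
rewrite -[leLHS]mul1r ler_pdivrMr // mulrAC ler_pdivlMr ?mulr_gt0 // mul1r.
move: B2 B3 hE2 E1; move: (B ^+ 2) (E ^+ 2) (sqr_ge0 E) => B' E' E'0 B2 B3 hE2 E1.
case: hE2 => h.
  by rewrite ger0_norm; nra.
by rewrite ler0_norm; nra.
Qed.

(** After replacing [csch] by [sech] the entries compare with those of [toepK 0]; the subtracted
    identity in column 0 adds a single 1. *)
Lemma summable2_K0 s : summable2 (toepK 0) -> normc s = 1 -> summable2 (K0 s).
Proof.
move=> [M hM] s1; have [C hC] := csch_le.
have bound l m : normc (K0 s l m) <= (`|C| + 1) * normc (toepK 0 l m)
   + ((l == 0) && (m == 0))%:R.
  rewrite /K0 /A0 /toepK !add0r -/(sg l) -/(sg m).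
  have sgN n : normc (sg n) = Num.sqrt (sech (b * n%:~R)).
    by rewrite normc_real ger0_norm ?sqrtr_ge0.
  have sg0 n : 0 < Num.sqrt (sech (b * n%:~R)) by rewrite sqrtr_gt0 sech_gt0.
  case: (eqVneq m 0) => [->|m0].
    have -> : sg 0 = 1 by rewrite /sg mulr0 sech0 sqrtr1.
    rewrite divr1 mulr1 andbT subr0 mulrBr; apply: le_trans (le_normcD _ _) _.
    rewrite normcN; apply: lerD; first by rewrite mulrDl mul1r lerDr mulr_ge0 ?normc_ge0.
    case: eqP => [->|_]; last by rewrite mulr0 normc0.
    by rewrite mulr1 sgN mulr0 sech0 sqrtr1.
  rewrite andbF addr0 !normcM normcV s1 mul1r normc_real !sgN.
  have h1 := hC m m0; have h2 := sg0 m; have h3 := sg0 l; have h4 := normc_ge0 (q (l - m)).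
  have h5 : sech (b * m%:~R) = Num.sqrt (sech (b * m%:~R)) ^+ 2.
    by rewrite sqr_sqrtr // ltW // sech_gt0.
  rewrite h5 in h1; move: h1 h2 h3 h4.
  move: (Num.sqrt (sech (b * m%:~R))) (Num.sqrt (sech (b * l%:~R))) (normc (q (l - m)))
    `|csch m| => S T Q c h1 h2 h3 h4.
  rewrite ler_pdivrMr // -subr_ge0.
  have -> : (`|C| + 1) * (T * Q * S) * S - T * (c * Q) = T * Q * ((`|C| + 1) * S ^+ 2 - c) by ring.
  rewrite !mulr_ge0 ?(ltW h3) //; have := ler_norm C; have := sqr_ge0 S; nra.
exists ((`|C| + 1) * M + 1) => a L.
apply: (@le_trans _ _ (wsum a L (fun m => wsum a L (fun n => (`|C| + 1) * normc (toepK 0 n m)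
   + ((n == 0) && (m == 0))%:R)))).
  by apply: ler_wsum => m _ _; apply: ler_wsum => n _ _; exact: bound.
rewrite (_ : wsum _ _ _ = (`|C| + 1) * ssumC a L (toepK 0) +
  wsum a L (fun m => wsum a L (fun n => ((n == 0) && (m == 0))%:R))); last first.
  rewrite /ssumC /ssum -wsumZ -wsum_add; apply: eq_wsum => m _ _.
  by rewrite wsum_add wsumZ.
apply: lerD; first by rewrite ler_wpM2l // addr_ge0.
have ind (g : int -> R) (G : R) : (forall n, n != 0 -> g n = 0) -> 0 <= g 0 <= G -> wsum a L g <= G.
  move=> h1 /andP[h2 h3].
  have [/andP[a0 aL]|out] := boolP ((a <= 0) && (0 < a + L%:Z)); last first.
    rewrite wsum0; first exact: le_trans h3.
    move=> n n1 n2; apply: h1; apply: contraNneq out => n0; rewrite n0 in n1 n2.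
    by rewrite n1 n2.
  have [p [r [-> aE]]] := @subwindow a 0 L 1 ltac:(lia) ltac:(lia).
  rewrite wsum_supp; first by rewrite -aE /wsum big_ord_recl big_ord0 !addr0.
  by move=> n hn; apply: h1; move: hn; rewrite -aE; lia.
apply: (ind) => [m /negbTE m0|].
  by apply: wsum0 => n _ _; rewrite m0 andbF.
rewrite wsum_ge0 //=.
apply: (ind) => [n /negbTE n0|]; first by rewrite n0.
by rewrite eqxx ler01 lexx.
Qed.

(** For [r n = expR (b n)] the quotient [2 r_m r_n / (r_m^2 - r_n^2)] depends on [m - n] only.
    Together with the Toeplitz form of [q], all residues become sections of one kernel over shifted
    windows, with a common limit. *)
Lemma wdet_lagr s a L (n : 'I_L) :
  \det (lagr_mx (fun m : 'I_L => (expR (b * (a + (m : nat)%:Z)%:~R))%:C%C)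
     (\matrix_(l, m) q ((l : nat)%:Z - (m : nat)%:Z)) s n)
  = wdet (K0 s) (a - (a + (n : nat)%:Z)) L.
Proof.
rewrite /K0 wdet_conj; last by move=> m; exact: sqrt_sech_neq0.
rewrite /wdet; congr (\det _); apply/matrixP => l m; rewrite !mxE /A0.
have hE (j : 'I_L) : a - (a + (n : nat)%:Z) + (j : nat)%:Z = (j : nat)%:Z - (n : nat)%:Z by lia.
rewrite !hE !subr_eq0 !eqz_nat -!val_eqE /=.
case: (eqVneq (m : nat) (n : nat)) => [mn|mn].
  by rewrite mn addrC subrK.
congr (_ + _); rewrite (_ : (l : nat)%:Z - (n : nat)%:Z - ((m : nat)%:Z - (n : nat)%:Z)
  = (l : nat)%:Z - (m : nat)%:Z); last by lia.
congr (_ * _ * _); rewrite /csch.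
have -> : b * ((m : nat)%:Z - (n : nat)%:Z)%:~R
   = b * (a + (m : nat)%:Z)%:~R - b * (a + (n : nat)%:Z)%:~R.
  by rewrite !intrD mulrNz; ring.
rewrite expRB.
have : expR (b * (a + (m : nat)%:Z)%:~R) != expR (b * (a + (n : nat)%:Z)%:~R).
  rewrite (inj_eq (@expR_inj R)) (inj_eq (mulfI (lt0r_neq0 b0))) eqr_int.
  by rewrite (inj_eq (addrI a)) eqz_nat.
have := expR_gt0 (b * (a + (m : nat)%:Z)%:~R); have := expR_gt0 (b * (a + (n : nat)%:Z)%:~R).
move: (expR _) (expR _) => u v u0 v0 uv.
rewrite -!rmorphXn -rmorphB -[2]/(2%:R) -(rmorph_nat (real_complex R)) -!rmorphM -fmorphV -rmorphM.
congr (_%:C%C).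
have h : u ^+ 2 - v ^+ 2 != 0.
  by rewrite subr_sqr mulf_neq0 // ?subr_eq0 // gt_eqF // addr_gt0.
field.
by rewrite mulN1r h gt_eqF.
Qed.

Lemma sech_complex x u : (sech (x + u))%:C%C =
  2 * (expR u)%:C%C * (expR x)%:C%C / (expR (x + u) ^+ 2 + 1)%:C%C :> R[i].
Proof.
rewrite /sech rmorphM fmorphV [X in X / _](_ : _ = 2 * (expR u)%:C%C * (expR x)%:C%C) //.
by rewrite expRD !rmorphM rmorph_nat; ring.
Qed.

Lemma logi2_complex x u : (logi2 (x + u))%:C%C =
  (expR u)%:C%C ^+ 2 * (expR x)%:C%C ^+ 2 / (expR (x + u) ^+ 2 + 1)%:C%C :> R[i].
Proof.
rewrite /logi2 rmorphM fmorphV [X in X / _](_ : _ = (expR u)%:C%C ^+ 2 * (expR x)%:C%C ^+ 2) //.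
by rewrite expRD !rmorphXn rmorphM; ring.
Qed.

(** Conjugation puts the whole weight [sech] on the columns, which is the form required by the
    partial fractions in [z = expR x]; the two elementary fractions are then [logi2] and
    [sech / 2]. *)
Lemma wdet_toepK x a L : wdet (fun n m => - toepK x n m) a L =
  1 + \sum_(n < L)
   ('i%C * (wdet (K0 'i%C) (a - (a + (n : nat)%:Z)) L - wdet (K0 (- 'i%C)) (a - (a + (n : nat)%:Z)) L)
       * (logi2 (x + b * (a + (n : nat)%:Z)%:~R))%:C%C
    - (wdet (K0 'i%C) (a - (a + (n : nat)%:Z)) L + wdet (K0 (- 'i%C)) (a - (a + (n : nat)%:Z)) L)
       * (sech (x + b * (a + (n : nat)%:Z)%:~R) / 2)%:C%C).
Proof.
pose r (m : 'I_L) : R[i] := (expR (b * (a + (m : nat)%:Z)%:~R))%:C%C.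
pose Q : 'M[R[i]]_L := \matrix_(l, m) q ((l : nat)%:Z - (m : nat)%:Z).
have r0 n : r n != 0 by rewrite (inj_eq (@complexI R)) gt_eqF ?expR_gt0.
have r_inj n m : n != m -> r n ^+ 2 != r m ^+ 2.
  rewrite -!rmorphXn (inj_eq (@complexI R)) eqrXn2 ?expR_ge0 //.
  rewrite (inj_eq (@expR_inj R)) (inj_eq (mulfI (lt0r_neq0 b0))) eqr_int.
  by rewrite (inj_eq (addrI a)) eqz_nat.
have two0 : 2 != 0 :> R[i] by rewrite pnatr_eq0.
have im2 : 'i%C * 'i%C = -1 :> R[i] by rewrite -expr2 sqr_i.
pose z : R[i] := (expR x)%:C%C.
have rz n : r n ^+ 2 * z ^+ 2 + 1 = (expR (x + b * (a + (n : nat)%:Z)%:~R) ^+ 2 + 1)%:C%C.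
  by rewrite rmorphD rmorphXn expRD rmorphM exprMn mulrC rmorph1.
have z0 n : r n ^+ 2 * z ^+ 2 + 1 != 0.
  by rewrite rz (inj_eq (@complexI R)) gt_eqF // expR2D1_gt0.
have := det_partial_fractions Q im2 two0 r0 r_inj z0.
have -> : \det (1%:M - \matrix_(l, m) (Q l m * (2 * r m * z / (r m ^+ 2 * z ^+ 2 + 1))))
   = wdet (fun n m => - toepK x n m) a L.
  pose D n : R[i] := (Num.sqrt (sech (x + b * n%:~R)))%:C%C.
  have DD n : D n * D n = (sech (x + b * n%:~R))%:C%C.
    by rewrite -rmorphM -expr2 sqr_sqrtr // ltW // sech_gt0.
  have D0 n : D n != 0 by exact: sqrt_sech_neq0.
  rewrite -(wdet_conj (fun n m => - toepK x n m) a L (D := fun n => (D n)^-1)); last first.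
    by move=> n; rewrite invr_eq0.
  rewrite /wdet; congr (\det (_ + _)); apply/matrixP => l m; rewrite !mxE /toepK -/(D _) -/(D _).
  rewrite invrK rz mulrN mulNr; congr (- _).
  rewrite [RHS](_ : _ = q (a + (l : nat)%:Z - (a + (m : nat)%:Z)) * (D (a + (m : nat)%:Z) * D (a + (m : nat)%:Z))).
    by rewrite DD sech_complex; congr (q _ * _); lia.
  by field; exact: D0.
move=> ->; congr (_ + _); apply: eq_bigr => n _.
rewrite -!wdet_lagr -/r -/Q rz logi2_complex.
congr (_ - _ * _).
rewrite (_ : (sech _ / 2)%:C%C = (sech (x + b * (a + (n : nat)%:Z)%:~R))%:C%C / 2); last first.
  by rewrite rmorphM fmorphV rmorph_nat.
rewrite sech_complex -/z -/(r n); field.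
by have := z0 n; rewrite rz rmorphD rmorphXn rmorph1.
Qed.

Lemma toepK_shift x n m : toepK (x + b) n m = toepK x (n + 1) (m + 1).
Proof.
rewrite /toepK; have h (k : int) : x + b + b * k%:~R = x + b * (k + 1)%:~R.
  by rewrite intrD; ring.
by rewrite !h; congr (_ * q _ * _); lia.
Qed.

(** In the difference of two partial fraction expansions the sums converge and the residues tend to
    constants, so Tannery's theorem leaves a combination of a tanh sum and a sech sum. Periodicity
    shows that the tanh coefficient is zero. *)
Theorem toeplitz_wdet_affine (G f : R -> R) :
  (forall x, summable2 (toepK x)) ->
  (forall x, wlim (fun a L => complex.Re (wdet (fun n m => - toepK x n m) a L)) (G x)) ->
  (forall x, wlim (fun a L => wsum a L (fun n => sech (x + b * n%:~R))) (f x)) ->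
  exists B, forall x y, G x - G y = B * (f x - f y).
Proof.
move=> sumK hG hf.
have ni : normc ('i%C : R[i]) = 1 by rewrite /normc /= expr0n add0r expr1n sqrtr1.
have s1 := summable2_K0 (sumK 0) ni.
have s2 : summable2 (K0 (- 'i%C)) by apply: summable2_K0 => //; rewrite normcN.
have [M1 hM1] := s1; have [M2 hM2] := s2.
have [r1 hr1] := wdet_wlim s1; have [r2 hr2] := wdet_wlim s2.
have [i1 hi1] := wdet_wlim_Im s1; have [i2 hi2] := wdet_wlim_Im s2.
(* The real coefficients of [logi2] and of [sech]; they depend on the pole [n] only through the
   window start [a - n]. *)
pose A a L := - complex.Im (wdet (K0 'i%C) a L) + complex.Im (wdet (K0 (- 'i%C)) a L).
pose B a L := - (2^-1 * (complex.Re (wdet (K0 'i%C) a L) + complex.Re (wdet (K0 (- 'i%C)) a L))).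
have hA : wlim A (- i1 + i2).
  rewrite /A; apply: wlimD => //.
  rewrite -mulN1r (_ : (fun a L => _) = (fun a L => -1 * complex.Im (wdet (K0 'i%C) a L))); first exact: wlimZ.
  by apply/boolp.funext => a; apply/boolp.funext => L; rewrite mulN1r.
have hB : wlim B (- (2^-1 * (r1 + r2))).
  rewrite -mulNr (_ : B = (fun a L => - 2^-1 * (complex.Re (wdet (K0 'i%C) a L)
     + complex.Re (wdet (K0 (- 'i%C)) a L)))).
    by apply: wlimZ; exact: wlimD.
  by apply/boolp.funext => a; apply/boolp.funext => L; rewrite /B mulNr.
have n1 a L : normc (wdet (K0 'i%C) a L) <= expR M1.
  by apply: le_trans (normc_wdet _ _ _) _; rewrite ler_expR.
have n2 a L : normc (wdet (K0 (- 'i%C)) a L) <= expR M2.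
  by apply: le_trans (normc_wdet _ _ _) _; rewrite ler_expR.
have bA a L : `|A a L| <= expR M1 + expR M2.
  apply: le_trans (ler_normD _ _) _; rewrite normrN; apply: lerD.
    exact: le_trans (ler_Im_normc _) (n1 a L).
  exact: le_trans (ler_Im_normc _) (n2 a L).
have bB a L : `|B a L| <= expR M1 + expR M2.
  rewrite /B normrN normrM ger0_norm ?invr_ge0 //.
  have := ler_normD (complex.Re (wdet (K0 'i%C) a L)) (complex.Re (wdet (K0 (- 'i%C)) a L)).
  have := le_trans (ler_Re_normc _) (n1 a L); have := le_trans (ler_Re_normc _) (n2 a L).
  have := normr_ge0 (complex.Re (wdet (K0 'i%C) a L)).
  have := normr_ge0 (complex.Re (wdet (K0 (- 'i%C)) a L)).
  by lra.
have sumL x y : wsummable (fun n => logi2 (x + b * n%:~R) - logi2 (y + b * n%:~R)).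
  apply: (wsummable_le (C := `|1 - expR (2 * (y - x))| * expR (x - y))) (wsummable_sech x b0) => n.
  apply: le_trans (logi2_diff _ _) _; rewrite [X in _ <= _ * X]gtr0_norm ?sech_gt0 //.
  by rewrite !(_ : forall u v w : R, u + w - (v + w) = u - v) // => u v w; ring.
have sumS x y : wsummable (fun n => sech (x + b * n%:~R) - sech (y + b * n%:~R)).
  have h := wsummable_le (s := fun n => - sech (y + b * n%:~R)) (C := 1) _ (wsummable_sech y b0).
  by apply: (wsummableD (wsummable_sech x b0) (h _)) => n; rewrite mul1r normrN.
have main x y S : wlim (fun a L => wsum a L (fun n => logi2 (x + b * n%:~R) - logi2 (y + b * n%:~R))) S ->
   G x - G y = (- i1 + i2) * S + - (2^-1 * (r1 + r2)) * (f x - f y).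
  move=> hS; apply: wlim_unique (wlimB (hG x) (hG y)) _.
  have hfd : wlim (fun a L => wsum a L (fun n => sech (x + b * n%:~R) - sech (y + b * n%:~R))) (f x - f y).
    have := wlimB (hf x) (hf y); congr (wlim _ _).
    by apply/boolp.funext => a; apply/boolp.funext => L; rewrite wsumB.
  have := wlimD (wlim_tannery (sumL x y) hA bA hS) (wlim_tannery (sumS x y) hB bB hfd).
  congr (wlim _ _); apply/boolp.funext => a; apply/boolp.funext => L.
  rewrite -raddfB !wdet_toepK opprD addrACA subrr add0r -sumrB raddf_sum -wsum_add.
  apply: eq_bigr => n _; rewrite /A /B.
  case: (wdet (K0 'i%C) _ _) => u u'; case: (wdet (K0 (- 'i%C)) _ _) => v v' /=.
  by ring.
have [S hS] := wsummable_wlim (sumL b 0).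
(* Moving [x] by [b] shifts the indices by one, which window limits do not see; the same holds for
   [f]. *)
have Gper : G b = G 0.
  have e a L : complex.Re (wdet (fun n m => - toepK b n m) a L)
      = complex.Re (wdet (fun n m => - toepK 0 n m) (a + 1) L).
    rewrite -(wdet_shift (fun n m => - toepK 0 n m)); congr complex.Re.
    by apply: eq_wdet => n m; rewrite -toepK_shift add0r.
  apply: wlim_unique (hG b) _ => d d0.
  have [N hN] := wlim_shift 1 (hG 0) d0; exists N => a L h1 h2; rewrite e; exact: hN.
have fper : f b = f 0.
  have e a L : wsum a L (fun n => sech (b + b * n%:~R))
      = wsum (a + 1) L (fun n => sech (0 + b * n%:~R)).
    rewrite -wsum_shift; apply: eq_wsum => n _ _; congr sech; rewrite intrD; ring.
  apply: wlim_unique (hf b) _ => d d0.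
  have [N hN] := wlim_shift 1 (hf 0) d0; exists N => a L h1 h2; rewrite e; exact: hN.
(* [logi2] is strictly increasing, so every term is positive and the term at 0 is a lower bound.
   Hence the tanh sum is not periodic. *)
have S0 : 0 < S.
  pose g n := logi2 (b + b * n%:~R) - logi2 (0 + b * n%:~R).
  have g0 n : 0 < g n by rewrite subr_gt0 logi2_mono // ltrD2r.
  apply: lt_le_trans (g0 0) _; rewrite -lerN2.
  have hS' := wlimZ (-1) hS; rewrite mulN1r in hS'; apply: (wlim_le hS').
  exists 0%N => a L h1 h2; rewrite mulN1r lerN2.
  have [p [r [-> aE]]] := @subwindow a 0 L 1 ltac:(lia) ltac:(lia).
  apply: le_trans (ler_wsum_sub a p 1 r (fun n => ltW (g0 n))).
  by rewrite -aE /wsum big_ord_recl big_ord0 !addr0.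
have i12 : - i1 + i2 = 0.
  have := main b 0 S hS; rewrite Gper fper !subrr mulr0 addr0 => /esym/eqP.
  by rewrite mulf_eq0 (gt_eqF S0) orbF => /eqP.
exists (- (2^-1 * (r1 + r2))) => x y.
have [S' hS'] := wsummable_wlim (sumL x y).
by rewrite (main x y S' hS') i12 mul0r add0r.
Qed.

End Toeplitz.

(** * The periodised hyperbolic secant near its critical points *)

Section SechProduct.
Variables (R : realType) (b : R).
Hypothesis b0 : 0 < b.

Definition wprod (a : int) (L : nat) (g : int -> R) := \prod_(j < L) g (a + (j : nat)%:Z).

Lemma wprodS_l a L g : wprod a L.+1 g = g a * wprod (a + 1) L g.
Proof.
rewrite /wprod big_ord_recl addr0; congr (_ * _); apply: eq_bigr => j _.
by congr g; rewrite lift0; lia.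
Qed.

Lemma wprodD a L1 L2 g : wprod a (L1 + L2) g = wprod a L1 g * wprod (a + L1%:Z) L2 g.
Proof.
elim: L1 a => [|L1 IH] a; first by rewrite add0n {2}/wprod big_ord0 mul1r addr0.
rewrite addSn !wprodS_l IH mulrA (_ : a + L1.+1%:Z = a + 1 + L1%:Z) //; lia.
Qed.

Lemma expR_sub1_bounds (t : R) : `|t| <= 2^-1 -> `|t| / 2 <= `|expR t - 1| <= 2 * `|t|.
Proof.
rewrite ler_norml => /andP[h1 h2].
have e1 := expR_ge1Dx t; have e2 := expR_ge1Dx (- t).
have E0 := expR_gt0 t.
have e3 : (1 - t) * expR t <= 1.
  have : expR (- t) * expR t = 1 by rewrite -expRD addNr expR0.
  nra.
by case: (leP 0 t) => t0; [rewrite !ger0_norm | rewrite !ler0_norm]; nra.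
Qed.

Lemma sech_ratio (h u : R) : 1 - sech u / sech h =
  (expR (u - h) - 1) * (expR h ^+ 2 * expR (u - h) - 1) / (expR u ^+ 2 + 1).
Proof.
rewrite /sech expRB; have := expR2D1_gt0 u; have := expR2D1_gt0 h.
have := expR_gt0 h; have := expR_gt0 u.
set p := expR h; set E := expR u => E0 p0 p1 E1; field.
by rewrite !gt_eqF //= addrC.
Qed.

Lemma sech_lt (h u : R) : 0 <= h -> h < `|u| -> sech u < sech h.
Proof.
move=> h0; wlog u0 : u / 0 <= u => [wl hu|].
  case: (leP 0 u) => u0; first exact: wl.
  by rewrite -sechN; apply: wl; rewrite ?normrN // oppr_ge0 ltW.
rewrite ger0_norm // => hu.
rewrite -subr_gt0 -(pmulr_rgt0 _ (_ : 0 < (sech h)^-1)) ?invr_gt0 ?sech_gt0 //.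
rewrite mulrBr mulVf ?gt_eqF ?sech_gt0 // mulrC sech_ratio.
have e1 : 1 < expR (u - h) by rewrite expR_gt1 subr_gt0.
have e2 : 1 <= expR h by rewrite -expR0 ler_expR.
have e3 : 1 <= expR h ^+ 2 by rewrite expr_ge1 // expR_ge0.
by rewrite divr_gt0 ?expR2D1_gt0 // mulr_gt0 //; nra.
Qed.

Lemma sech_le (h u : R) : 0 <= h -> h <= `|u| -> sech u <= sech h.
Proof.
move=> h0; rewrite le_eqVlt => /orP[/eqP ->|hu]; last exact/ltW/sech_lt.
by case: (leP 0 u) => u0; [rewrite ger0_norm | rewrite ltr0_norm ?sechN].
Qed.

(* both factors of [sech_ratio] are comparable to [u - h] when [h = 0], the first one only otherwise *)
Lemma sech_ratio0_bounds (u : R) : `|u| <= 2^-1 ->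
  40^-1 * u ^+ 2 <= `|1 - sech u / sech 0| <= 4 * u ^+ 2.
Proof.
move=> hu; have := expR_sub1_bounds hu; rewrite sech_ratio subr0 expR0 expr1n mul1r => /andP[h1 h2].
rewrite -expr2 normrM normrX normfV (ger0_norm (ltW (expR2D1_gt0 u))).
have E0 := expR_gt0 u.
have E3 : expR u <= 3.
  move: h2; rewrite ler_norml => /andP[_]; lra.
have E2 : expR u ^+ 2 <= 9 by nra.
have n0 := normr_ge0 u; rewrite -[u ^+ 2]real_normK ?num_real //.
have E4 := expR2D1_gt0 u; have E5 := sqr_ge0 (expR u).
move: h1 h2 hu n0; move: `|expR u - 1| `|u| => A U h1 h2 hu n0.
(* The constant 40 is [4 * 10]: [A >= U / 2] in the numerator and [expR u ^+ 2 + 1 <= 10] in the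
   denominator. *)
rewrite ler_pdivrMr // ler_pdivlMr //; apply/andP; split.
  have : U ^+ 2 / 4 <= A ^+ 2 by nra.
  have := sqr_ge0 U; nra.
have : A ^+ 2 <= 4 * U ^+ 2 by nra.
have := sqr_ge0 U; nra.
Qed.

Lemma sech_ratio_bounds (h : R) : 0 < h -> exists d c C, [/\ 0 < d, 0 < c, 0 < C &
  forall u, `|u - h| <= d -> c * `|u - h| <= `|1 - sech u / sech h| <= C * `|u - h|].
Proof.
move=> h0; have p1 : 1 < expR h by rewrite expR_gt1.
set p := expR h in p1.
have p2 : 1 < p ^+ 2 by rewrite expr_gt1 //; lra.
(* The second bound keeps the factor [p ^+ 2 * expR t - 1] above [(p ^+ 2 - 1) / 2], because
   [expR t >= 1 - 2 * d]. *)
pose d := Num.min (2^-1) ((p ^+ 2 - 1) / (4 * p ^+ 2)).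
have d0 : 0 < d by rewrite lt_min divr_gt0; lra.
have dle : d <= 2^-1 by rewrite ge_min lexx.
have dle2 : d * (4 * p ^+ 2) <= p ^+ 2 - 1.
  by rewrite -ler_pdivlMr ?ge_min ?lexx ?orbT //; lra.
have D0 : 0 < 4 * p ^+ 2 + 1 by lra.
exists d, ((p ^+ 2 - 1) / (4 * (4 * p ^+ 2 + 1))), (4 * p ^+ 2).
split => //; [by rewrite divr_gt0; lra | lra |] => u hu.
have hu2 := le_trans hu dle.
have := expR_sub1_bounds hu2; rewrite sech_ratio -/p => /andP[e1 e2].
rewrite normrM normrM normfV (ger0_norm (ltW (expR2D1_gt0 u))).
set t := u - h in hu hu2 e1 e2 *.
have Et0 := expR_gt0 t.
have Et2 : expR t <= 2 by move: e2; rewrite ler_norml => /andP[_]; lra.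
have Et : 1 - 2 * d <= expR t by move: e2; rewrite ler_norml => /andP[]; lra.
have Eu : expR u ^+ 2 = p ^+ 2 * expR t ^+ 2.
  by rewrite -exprMn -expRD /t; congr (expR _ ^+ 2); ring.
have Eu0 := expR2D1_gt0 u; have Eu1 : 1 <= expR u ^+ 2 + 1 by rewrite lerDr sqr_ge0.
have Et4 : expR t ^+ 2 <= 4 by nra.
have Eu2 : expR u ^+ 2 + 1 <= 4 * p ^+ 2 + 1 by rewrite Eu lerD2r [leRHS]mulrC ler_wpM2l // sqr_ge0.
have F1 : (p ^+ 2 - 1) / 2 <= p ^+ 2 * expR t - 1 by nra.
have F2 : p ^+ 2 * expR t - 1 <= 2 * p ^+ 2 by nra.
rewrite (@ger0_norm _ (p ^+ 2 * expR t - 1)); last by lra.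
have n0 := normr_ge0 t.
move: e1 e2 n0 F1 F2 Eu0 Eu1 Eu2; clear -p2 D0.
move: `|expR t - 1| `|t| (_ * expR t - 1) (expR u ^+ 2 + 1) => A U Fq E e1 e2 n0 F1 F2 E0 E1 E2.
rewrite ler_pdivrMr // ler_pdivlMr //; apply/andP; split.
  apply: (@le_trans _ _ (U / 2 * ((p ^+ 2 - 1) / 2))); last by apply: ler_pM; lra.
  have -> : (p ^+ 2 - 1) / (4 * (4 * p ^+ 2 + 1)) * U * E
    = U / 2 * ((p ^+ 2 - 1) / 2) * (E / (4 * p ^+ 2 + 1)).
    by field; rewrite gt_eqF //; lra.
  by apply: ler_piMr; [apply: mulr_ge0; lra | rewrite ler_pdivrMr; lra].
have : A * Fq <= 2 * U * (2 * p ^+ 2) by apply: ler_pM; lra.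
have : 0 <= 4 * p ^+ 2 * U by rewrite mulr_ge0; lra.
nra.
Qed.

(** For [0 <= s <= th < 1] one has [(1 - s) (1 + s / (1 - th)) >= 1], hence
    [1 - s >= exp (- s / (1 - th))]. The factors away from the critical ones thus have a product
    bounded below on every window. *)
Lemma wprod_ge_exp (s : int -> R) th a L : th < 1 -> (forall n, a <= n -> n < a + L%:Z -> 0 <= s n <= th) ->
  expR (- (wsum a L s / (1 - th))) <= wprod a L (fun n => 1 - s n) <= 1.
Proof.
move=> th1; elim: L a => [|L IH] a h.
  by rewrite /wprod /wsum !big_ord0 mul0r oppr0 expR0 lexx.
have /andP[i1 i2] := IH (a + 1) ltac:(by move=> n h1 h2; apply: h; lia).
have /andP[j1 j2] := h a ltac:(lia) ltac:(lia).
rewrite wprodS_l wsumS_l mulrDl opprD expRD; apply/andP; split.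
  apply: ler_pM; rewrite ?expR_ge0 // expRN.
  have := expR_ge1Dx (s a / (1 - th)); set E := expR _ => hE.
  have k0 : 0 <= s a / (1 - th) by rewrite divr_ge0; lra.
  have E0 : 0 < E by lra.
  rewrite -[leLHS]mul1r ler_pdivrMr //.
  apply: (@le_trans _ _ ((1 - s a) * (1 + s a / (1 - th)))); last by rewrite ler_wpM2l; lra.
  rewrite -subr_ge0.
  have -> : (1 - s a) * (1 + s a / (1 - th)) - 1 = s a * (th - s a) / (1 - th).
    by field; rewrite gt_eqF; lra.
  by rewrite divr_ge0 ?mulr_ge0; lra.
have p0 : 0 <= wprod (a + 1) L (fun n => 1 - s n) by apply: le_trans i1; exact: expR_ge0.
by rewrite mulr_ile1 //; lra.
Qed.

Let qd (mu : R) (l : int) : R[i] := mu%:C%C *+ (l == 0).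

Lemma toepK_diag mu x n m : toepK b (qd mu) x n m = (mu * sech (x + b * n%:~R))%:C%C *+ (n == m).
Proof.
rewrite /toepK /qd subr_eq0; case: eqP => [->|_]; last by rewrite !mulr0n mulr0 mul0r.
rewrite !mulr1n mulrAC -rmorphM -rmorphM; congr (_%:C%C).
by rewrite -expr2 sqr_sqrtr ?(ltW (sech_gt0 _)) // mulrC.
Qed.

Lemma wdet_toepK_diag mu x a L : complex.Re (wdet (fun n m => - toepK b (qd mu) x n m) a L)
  = wprod a L (fun n => 1 - mu * sech (x + b * n%:~R)).
Proof.
pose d : 'rV[R[i]]_L := \row_j (1 - mu * sech (x + b * (a + (j : nat)%:Z)%:~R))%:C%C.
have -> : wdet (fun n m => - toepK b (qd mu) x n m) a L = \det (diag_mx d).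
  rewrite /wdet; congr (\det _); apply/matrixP => i j; rewrite !mxE toepK_diag.
  have -> : (a + (i : nat)%:Z == a + (j : nat)%:Z) = (i == j).
    by rewrite (inj_eq (addrI a)) eqz_nat.
  by case: eqP => [->|_]; rewrite ?mulr0n ?mulr1n ?oppr0 ?addr0 // rmorphB rmorph1.
rewrite det_diag (_ : \prod_i d 0 i = (wprod a L (fun n => 1 - mu * sech (x + b * n%:~R)))%:C%C) //.
by rewrite rmorph_prod; apply: eq_bigr => j _; rewrite mxE.
Qed.

Lemma summable2_toepK_diag mu x : summable2 (toepK b (qd mu) x).
Proof.
have [M hM] := wsum_sech b0; exists (`|mu| * M) => a L.
apply: (@le_trans _ _ (wsum a L (fun m => `|mu| * sech (x + b * m%:~R)))); last first.
  by rewrite wsumZ ler_wpM2l.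
rewrite /ssumC /ssum; apply: ler_sum => j _; set m := a + _.
rewrite /wsum (bigD1 j) //= big1 ?addr0 => [|i /negbTE ij].
  rewrite toepK_diag eqxx mulr1n normc_real normrM (@ger0_norm _ (sech _)) //.
  exact/ltW/sech_gt0.
have e : (a + (i : nat)%:Z == m) = (i == j) by rewrite /m (inj_eq (addrI a)) eqz_nat.
by rewrite toepK_diag e ij normc0.
Qed.

Variable f : R -> R.
Hypothesis hf : forall x, wlim (fun a L => wsum a L (fun n => sech (x + b * n%:~R))) (f x).

Lemma sech_sum_period x : f (x + b) = f x.
Proof.
have e a L : wsum a L (fun n => sech (x + b + b * n%:~R))
    = wsum (a + 1) L (fun n => sech (x + b * n%:~R)).
  by rewrite -wsum_shift; apply: eq_wsum => n _ _; congr sech; rewrite intrD; ring.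
apply: wlim_unique (hf (x + b)) _ => d d0.
by have [N hN] := wlim_shift 1 (hf x) d0; exists N => a L h1 h2; rewrite e; exact: hN.
Qed.

Lemma sech_sum_even x : f (- x) = f x.
Proof.
have e a L : wsum a L (fun n => sech (- x + b * n%:~R))
    = wsum (- a - L%:Z + 1) L (fun n => sech (x + b * n%:~R)).
  rewrite /wsum (reindex_inj rev_ord_inj); apply: eq_bigr => j _ /=.
  rewrite -sechN; congr sech; rewrite opprD opprK -mulrN -mulrNz; congr (_ + _ * _%:~R).
  by have := ltn_ord j; lia.
apply: wlim_unique (hf (- x)) _ => d d0.
have [N hN] := hf x d0; exists N.+1 => a L h1 h2; rewrite e; apply: hN; lia.
Qed.

(** The determinant [G] of the diagonal symbol is the product over a finite block times factors
    between two positive constants, so it inherits the quadratic bounds of the block. The affine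
    identity carries them over to [f]. *)
Lemma sech_sum_quadratic_aux (mu x0 th c C d : R) (s0 : int) (K : nat) :
  0 <= mu -> th < 1 -> 0 < d -> 0 < c -> 0 < C ->
  (forall x, `|x - x0| <= d ->
     c * (x - x0) ^+ 2 <= `|wprod s0 K (fun n => 1 - mu * sech (x + b * n%:~R))| <= C * (x - x0) ^+ 2) ->
  (forall x n, `|x - x0| <= d -> ~~ ((s0 <= n) && (n < s0 + K%:Z)) -> mu * sech (x + b * n%:~R) <= th) ->
  exists c' C', [/\ 0 < c', 0 < C' & forall x, `|x - x0| <= d ->
    c' * (x - x0) ^+ 2 <= `|f x - f x0| <= C' * (x - x0) ^+ 2].
Proof.
move=> mu0 th1 d0 c0 C0 hS hout.
have sumN x : summable2 (fun n m => - toepK b (qd mu) x n m).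
  by apply: (summable2Z (c := 1)) (summable2_toepK_diag mu x) => n m; rewrite normcN mul1r.
have [G hG] := boolp.choice (fun x => wdet_wlim (sumN x)).
have [B hB] := toeplitz_wdet_affine b0 (summable2_toepK_diag mu) hG hf.
have [M hM] := wsum_sech b0.
have M0 : 0 <= M.
  by apply: le_trans (hM 0 0 0%N); apply: wsum_ge0 => n; exact/ltW/sech_gt0.
pose E := expR (- (2 * (mu * M) / (1 - th))).
have E0 : 0 < E by exact: expR_gt0.
pose PS x := wprod s0 K (fun n => 1 - mu * sech (x + b * n%:~R)).
have GE x : `|x - x0| <= d -> E * `|PS x| <= `|G x| <= `|PS x|.
  move=> hx.
  have bnd a L : a <= - (absz s0 + K)%N%:Z -> (absz s0 + K)%N%:Z < a + L%:Z ->
    E * `|PS x| <= `|complex.Re (wdet (fun n m => - toepK b (qd mu) x n m) a L)| <= `|PS x|.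
    move=> h1 h2; rewrite wdet_toepK_diag.
    have [p [r [-> sE]]] := @subwindow a s0 L K ltac:(clear -h1 h2; lia) ltac:(clear -h1 h2; lia).
    pose s n := mu * sech (x + b * n%:~R).
    have s_ge0 n : 0 <= s n by rewrite mulr_ge0 // ltW // sech_gt0.
    rewrite !wprodD -sE -/(PS x) !normrM.
    have /andP[u1 u2] : expR (- (wsum a p s / (1 - th))) <= wprod a p (fun n => 1 - s n) <= 1.
      apply: wprod_ge_exp => // n n1 n2; rewrite s_ge0 /=; apply: hout => //; move: n1 n2 sE; clear; lia.
    have /andP[v1 v2] : expR (- (wsum (a + (p + K)%N%:Z) r s / (1 - th)))
        <= wprod (a + (p + K)%N%:Z) r (fun n => 1 - s n) <= 1.
      apply: wprod_ge_exp => // n n1 n2; rewrite s_ge0 /=; apply: hout => //; move: n1 n2 sE; clear; lia.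
    have w a' L' : wsum a' L' s <= mu * M by rewrite wsumZ ler_wpM2l.
    have i1 : expR (- (mu * M / (1 - th))) <= wprod a p (fun n => 1 - s n).
      by apply: le_trans u1; rewrite ler_expR lerN2 ler_pM2r ?invr_gt0; [exact: w | lra].
    have i2 : expR (- (mu * M / (1 - th))) <= wprod (a + (p + K)%N%:Z) r (fun n => 1 - s n).
      by apply: le_trans v1; rewrite ler_expR lerN2 ler_pM2r ?invr_gt0; [exact: w | lra].
    have EE : E = expR (- (mu * M / (1 - th))) * expR (- (mu * M / (1 - th))).
      by rewrite -expRD /E; congr expR; ring.
    have e0 := expR_gt0 (- (mu * M / (1 - th))).
    move: i1 i2 u2 v2 e0; rewrite EE -/s.
    move: (expR (- (mu * M / (1 - th)))) (wprod a p _) (wprod (a + _) r _) => e P1 P2 i1 i2 u2 v2 e0.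
    rewrite (@ger0_norm _ P1) ?(@ger0_norm _ P2); try lra.
    have n0 := normr_ge0 (PS x).
    have P12 : e * e <= P1 * P2 by apply: ler_pM => //; lra.
    have P12' : P1 * P2 <= 1 by rewrite mulr_ile1 //; lra.
    nra.
  have hw := wlim_norm (hG x); apply/andP; split.
    have hw' := wlimZ (-1) hw; rewrite -lerN2 -[leLHS]mulN1r.
    apply: (wlim_le hw'); exists (absz s0 + K)%N => a L h1 h2.
    by have /andP[] := bnd a L h1 h2; rewrite mulN1r lerN2.
  by apply: (wlim_le hw); exists (absz s0 + K)%N => a L h1 h2; have /andP[] := bnd a L h1 h2.
have G0 : G x0 = 0.
  have h : `|x0 - x0| <= d by rewrite subrr normr0 ltW.
  have /andP[_] := GE _ h; have /andP[_] := hS _ h.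
  rewrite subrr expr0n mulr0 => h1 h2; apply/eqP; rewrite -normr_le0.
  exact: le_trans h1.
(* Otherwise [G] would be constant, equal to [G x0 = 0], against its positive lower bound at
   [x0 + d]. *)
have B0 : B != 0.
  apply/eqP => B0; have h : `|x0 + d - x0| <= d by rewrite addrC addKr ger0_norm // ltW.
  have /andP[h1 _] := GE _ h; have /andP[h2 _] := hS _ h.
  have := hB (x0 + d) x0; rewrite B0 mul0r G0 subr0 => h3; move: h1; rewrite h3 normr0.
  rewrite addrC addKr in h2.
  apply/negP; rewrite -ltNge mulr_gt0 //; apply: lt_le_trans h2.
  by rewrite mulr_gt0 // exprn_gt0.
have nB : 0 < `|B| by rewrite normr_gt0.
exists (E * c / `|B|), (C / `|B|); split; [by rewrite divr_gt0 ?mulr_gt0 | by rewrite divr_gt0 |].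
move=> x hx; have /andP[h1 h2] := GE x hx; have /andP[h3 h4] := hS x hx.
have h5 : `|G x| = `|B| * `|f x - f x0|.
  by rewrite -normrM -hB G0 subr0.
rewrite h5 in h1 h2; apply/andP; split.
  rewrite mulrAC ler_pdivrMr // [leRHS]mulrC; apply: le_trans h1.
  by rewrite -mulrA ler_pM2l.
by rewrite mulrAC ler_pdivlMr // mulrC; apply: le_trans h2 h4.
Qed.

(* For the symbol [q l = mu * (l == 0)] the determinant in the affine identity is the product of the
   [1 - mu * sech (x + b n)]; [mu] is chosen so that one or two factors vanish at the critical point. *)
Theorem sech_sum_quadratic (z : int) : exists d c C, [/\ 0 < d, 0 < c, 0 < C &
  forall x, `|x - b / 2 * z%:~R| <= d ->
    c * (x - b / 2 * z%:~R) ^+ 2 <= `|f x - f (b / 2 * z%:~R)| <= C * (x - b / 2 * z%:~R) ^+ 2].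
Proof.
have perz (j : int) x : f (x + b * j%:~R) = f x.
  have pn (n : nat) y : f (y + b * n%:R) = f y.
    elim: n => [|n IH]; first by rewrite mulr0 addr0.
    by rewrite -natr1 mulrDr mulr1 addrA sech_sum_period.
  case: j => n; first by rewrite -pmulrn pn.
  by rewrite NegzE mulrNz mulrN -[in RHS](subrK (b * n.+1%:R) x) pn.
suff main e : (e == 0) || (e == 1) -> exists d c C, [/\ 0 < d, 0 < c, 0 < C &
  forall x, `|x - b / 2 * e| <= d ->
    c * (x - b / 2 * e) ^+ 2 <= `|f x - f (b / 2 * e)| <= C * (x - b / 2 * e) ^+ 2].
  have [j [e [he zE]]] : exists (j : int) (e : R), ((e == 0) || (e == 1)) /\ b / 2 * z%:~R = b / 2 * e + b * j%:~R.
    exists (z %/ 2)%Z, ((z %% 2)%Z)%:~R; split.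
      have : (0 <= z %% 2 < 2)%Z by rewrite modz_ge0 // ltz_pmod.
      by rewrite !(eqr_int R _ 0) ?(eqr_int R _ 1); case: ((z %% 2)%Z) => [[|[|n]]|n].
    by rewrite {1}(divz_eq z 2) intrD intrM; field.
  have [d [c [C [d0 c0 C0 h]]]] := main e he.
  exists d, c, C; split => // x hx; rewrite zE perz.
  have := h (x - b * j%:~R); rewrite zE in hx.
  have -> : x - b * j%:~R - b / 2 * e = x - (b / 2 * e + b * j%:~R) by ring.
  by move=> /(_ hx); rewrite -[in f (x - _)](perz j) subrK.
case/orP => /eqP ->.
  rewrite mulr0.
  have [d dP] : exists d, d = Num.min (2^-1) (b / 2) by exists (Num.min (2^-1) (b / 2)).
  have d0 : 0 < d by rewrite dP lt_min invr_gt0 ltr0n /= divr_gt0.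
  have d1 : d <= 2^-1 by rewrite dP ge_min lexx.
  have d2 : d <= b / 2 by rewrite dP ge_min lexx orbT.
  have := @sech_sum_quadratic_aux 1 0 (sech (b / 2)) 40^-1 4 d 0 1 ler01.
  case=> //.
  - by rewrite -[ltRHS](sech0 R) sech_lt // ger0_norm; lra.
  - move=> x; rewrite subr0 => hx; rewrite /wprod big_ord_recl big_ord0 !addr0 mulr1.
    rewrite mulr0 addr0 mul1r -[sech x]divr1 -[in X in sech x / X](sech0 R).
    by apply: sech_ratio0_bounds; lra.
  - move=> x n; rewrite subr0 => hx hn; rewrite mul1r; apply: sech_le; first lra.
    move: hx; rewrite ler_norml => /andP[x1 x2].
    have [n1|n1] := leP 1 n.
      have n1' : 1 <= n%:~R :> R by rewrite -[1]/(1%:~R) ler_int.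
      by apply: le_trans (ler_norm _); nra.
    have n1' : n%:~R <= -1 :> R by rewrite -[-1]/((-1)%:~R) ler_int; lia.
    by rewrite -normrN; apply: le_trans (ler_norm _); nra.
  by move=> c' [C' [h1 h2 h3]]; exists d, c', C'.
rewrite mulr1; set h := b / 2.
have h0 : 0 < h by rewrite /h divr_gt0.
have b0' := b0.
have [d [c [C [d0 c0 C0 hd]]]] := sech_ratio_bounds h0.
have [d' dP] : exists d', d' = Num.min d h by exists (Num.min d h).
have d'0 : 0 < d' by rewrite dP lt_min d0.
have d1 : d' <= d by rewrite dP ge_min lexx.
have d2 : d' <= h by rewrite dP ge_min lexx orbT.
(* At [x = b / 2] the indices -1 and 0 give opposite arguments. With [mu = 1 / sech (b / 2)] both
   factors vanish, each to first order, so that the product vanishes to second order. *)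
have := @sech_sum_quadratic_aux (sech h)^-1 h (sech b / sech h) (c * c) (C * C) d' (-1) 2.
case=> //.
- by rewrite invr_ge0 ltW // sech_gt0.
- by rewrite ltr_pdivrMr ?sech_gt0 // mul1r sech_lt ?(ltW h0) // ger0_norm /h; lra.
- exact: mulr_gt0.
- exact: mulr_gt0.
- move=> x hx; rewrite /wprod !big_ord_recl big_ord0 /= mulr1.
  have -> : sech (x + b * (-1 + 0)%:~R) = sech (2 * h - x).
    by rewrite -sechN; congr sech; rewrite /h /=; lra.
  have -> : sech (x + b * (-1 + 1)%:~R) = sech x by rewrite addNr mulr0 addr0.
  rewrite ![(sech h)^-1 * _]mulrC normrM.
  have /andP[u1 u2] := hd x (le_trans hx d1).
  have hx' : `|2 * h - x - h| = `|x - h| by rewrite -normrN; congr `|_|; ring.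
  have := hd (2 * h - x); rewrite hx' => /(_ (le_trans hx d1))/andP[v1 v2].
  rewrite -[(x - h) ^+ 2]real_normK ?num_real // expr2.
  have -> : c * c * (`|x - h| * `|x - h|) = (c * `|x - h|) * (c * `|x - h|) by ring.
  have -> : C * C * (`|x - h| * `|x - h|) = (C * `|x - h|) * (C * `|x - h|) by ring.
  have cn : 0 <= c * `|x - h| by rewrite mulr_ge0 // ltW.
  by rewrite !ler_pM.
- move=> x n hx hn; rewrite mulrC ler_pM2r ?invr_gt0 ?sech_gt0 //.
  apply: sech_le; first lra.
  have {}hx := le_trans hx d2; move: hx; rewrite ler_norml => /andP[x1 x2].
  have [n1|n1] := leP 1 n.
    have n1' : 1 <= n%:~R :> R by rewrite -[1]/(1%:~R) ler_int.
    by apply: le_trans (ler_norm _); nra.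
  have n1' : n%:~R <= -2 :> R by rewrite -[-2]/((-2)%:~R) ler_int; clear -n1 hn; lia.
  by rewrite -normrN; apply: le_trans (ler_norm _); rewrite /h in x1 x2; nra.
by move=> c' [C' [h1 h2 h3]]; exists d', c', C'.
Qed.

End SechProduct.

(** * Power series *)

Section PowerSeries.
Variable R : realType.
Implicit Types (c : nat -> R) (u v : R -> R) (rho : R).

Definition psum c (h : R) (N : nat) : R := \sum_(j < N) c j * h ^+ j.

Definition lip v (r L : R) := forall h h', `|h| < r -> `|h'| < r -> `|v h - v h'| <= L * `|h - h'|.

Lemma sum_half_pow N : \sum_(j < N) j%:R / 2 ^+ j <= 2 :> R.
Proof.
suff -> : \sum_(j < N) j%:R / 2 ^+ j = 2 - 2 * N.+1%:R / 2 ^+ N :> R.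
  by rewrite gerBl divr_ge0 ?exprn_ge0.
elim: N => [|N IH]; first by rewrite big_ord0 expr0; lra.
rewrite big_ord_recr /= IH exprS -!natr1.
have h : (2 : R) ^+ N != 0 by rewrite expf_neq0.
by field.
Qed.

Lemma ps_bounded c u rho : 0 < rho ->
  (forall h, `|h| < rho -> psum c h @ \oo --> u h) ->
  exists M, 0 <= M /\ forall j, `|c j| * (rho / 2) ^+ j <= M.
Proof.
move=> r0 H; have rh : `|rho / 2| < rho by rewrite gtr0_norm; lra.
have hc := H _ rh.
have hser : cvgn (series (fun j => c j * (rho / 2) ^+ j)).
  rewrite /series /=; under boolp.eq_fun do rewrite big_mkord.
  by apply/cvg_ex; exists (u (rho / 2)).
have := cvg_series_cvg_0 hser => h0.
have /cvg_seq_bounded [M0 [_ hM]] : cvgn (fun j => c j * (rho / 2) ^+ j).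
  by apply/cvg_ex; exists 0.
have hM1 := hM (`|M0| + 1) ltac:(by have := ler_norm M0; lra).
exists (`|M0| + 1); split; first by rewrite addr_ge0.
move=> j; have := hM1 j I; rewrite /= normrM normrX [`|rho / 2|]gtr0_norm //; lra.
Qed.

Lemma pow_lip r (h h' : R) j : `|h| <= r -> `|h'| <= r ->
  r * `|h ^+ j - h' ^+ j| <= j%:R * r ^+ j * `|h - h'|.
Proof.
move=> hr hr'; have r0 : 0 <= r := le_trans (normr_ge0 _) hr.
elim: j => [|j IH]; first by rewrite !expr0 subrr normr0 mulr0 mul0r mul0r.
have -> : h ^+ j.+1 - h' ^+ j.+1 = h * (h ^+ j - h' ^+ j) + (h - h') * h' ^+ j.
  by rewrite !exprS; ring.
apply: (@le_trans _ _ (r * (r * `|h ^+ j - h' ^+ j|) + r * (`|h - h'| * r ^+ j))).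
  rewrite -mulrDr ler_wpM2l //; apply: le_trans (ler_normD _ _) _; rewrite !normrM normrX.
  apply: lerD; first by rewrite ler_wpM2r.
  by rewrite ler_wpM2l // lerXn2r // ?nnegrE.
apply: (@le_trans _ _ (r * (j%:R * r ^+ j * `|h - h'|) + r * (`|h - h'| * r ^+ j))).
  by rewrite lerD2r ler_wpM2l.
by rewrite -natr1 exprS le_eqVlt; apply/orP; left; apply/eqP; ring.
Qed.

(** A Taylor remainder with a Lipschitz cofactor is the form in which analyticity of the determinant
    is used near a band value. *)
Lemma ps_factor c u rho m : 0 < rho ->
  (forall h, `|h| < rho -> psum c h @ \oo --> u h) ->
  exists v r L, [/\ 0 < r, r <= rho, v 0 = c m,
    (forall h, `|h| < r -> u h = psum c h m + h ^+ m * v h) & lip v r L].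
Proof.
move=> r0 H; have [M [M0 hM]] := ps_bounded r0 H.
pose v h := if h == 0 then c m else (u h - psum c h m) / h ^+ m.
pose V h N := psum (fun j => c (m + j)%N) h N.
have hV h : `|h| < rho -> V h @ \oo --> v h.
  move=> hh; rewrite /v; case: eqP => [->|/eqP hn0].
    apply/cvgrPdist_lt => e e0; near=> N.
    have N0 : (0 < N)%N by near: N; exists 1%N.
    rewrite /V /psum -(prednK N0) big_ord_recl addn0 expr0 mulr1 big1 ?addr0 ?subrr ?normr0 //.
    by move=> j _; rewrite lift0 expr0n mulr0.
  have -> : V h = (fun N => (psum c h (m + N)%N - psum c h m) / h ^+ m).
    apply/boolp.funext => N; rewrite /V /psum big_split_ord /= [X in X / _]addrC addKr mulr_suml.
    apply: eq_bigr => j _; rewrite exprD; field; exact: expf_neq0.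
  apply: cvgMl; apply: cvgB; last exact: cvg_cst.
  rewrite (_ : (fun N => psum c h (m + N)%N) = (fun N => psum c h (N + m)%N)).
    by rewrite (cvg_shiftn m (psum c h)); exact: H.
  by apply/boolp.funext => N; rewrite addnC.
(* The radius is halved twice: at [t] the terms of the series are bounded by [M], and at [t / 2] the
   Lipschitz constants are summed by the series of [j / 2 ^ j]. *)
have [t tE] : exists t, t = rho / 2 by exists (rho / 2).
have t0 : 0 < t by rewrite tE; lra.
pose r := t / 2; have r'0 : 0 < r by rewrite /r; lra.
have rrho : r <= rho by rewrite /r tE; lra.
exists v, r, (M / (t ^+ m) * (4 / t)); split => //; first by rewrite /v eqxx.
  move=> h hr; rewrite /v; case: eqP => [->|/eqP hn0]; last first.
    by rewrite mulrC divfK ?expf_neq0 // addrC subrK.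
  have h0 : `|0 : R| < rho by rewrite normr0.
  have u0 N : (0 < N)%N -> psum c 0 N = c 0%N.
    move=> N0; rewrite /psum -(prednK N0) big_ord_recl expr0 mulr1 big1 ?addr0 //.
    by move=> j _; rewrite lift0 expr0n mulr0.
  have -> : u 0 = c 0%N.
    apply: (cvg_unique _ (H 0 h0)) => //; apply/cvgrPdist_lt => e e0; near=> N.
    by rewrite u0 ?subrr ?normr0 //; near: N; exists 1%N.
  case: (m) => [|m']; first by rewrite /psum big_ord0 add0r expr0 mul1r.
  by rewrite u0 // expr0n mul0r addr0.
move=> h h' hr hr'.
have hV1 := hV h (lt_le_trans hr rrho); have hV2 := hV h' (lt_le_trans hr' rrho).
have hd : (fun N => `|V h N - V h' N|) @ \oo --> `|v h - v h'|.
  by apply: cvg_norm; exact: cvgB.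
apply: (cvgr_to_le hd).
near=> N; rewrite /V /psum -sumrB; apply: le_trans (ler_norm_sum _ _ _) _.
apply: (@le_trans _ _ (\sum_(j < N) M / t ^+ m * (2 / t) * `|h - h'| * (j%:R / 2 ^+ j))).
  apply: ler_sum => j _; rewrite -mulrBr normrM.
  have h1 := pow_lip j (ltW hr) (ltW hr').
  have h2 := hM (m + j)%N; rewrite -tE exprD in h2.
  have tm : 0 < t ^+ m by rewrite exprn_gt0.
  have tj : 0 < t ^+ j by rewrite exprn_gt0.
  have h3 : `|c (m + j)%N| <= M / (t ^+ m * t ^+ j).
    by rewrite ler_pdivlMr ?mulr_gt0.
  have h4 : `|h ^+ j - h' ^+ j| <= j%:R * (r ^+ j) * `|h - h'| / r.
    by rewrite ler_pdivlMr // mulrC.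
  apply: le_trans (ler_pM _ _ h3 h4) _ => //.
  have p2 : 0 < (2 : R) ^+ j by rewrite exprn_gt0.
  rewrite /r expr_div_n le_eqVlt; apply/orP; left; apply/eqP.
  move: t0 tm tj p2; clear; move: (t ^+ m) (t ^+ j) (2 ^+ j) `|h - h'| => a b d e t0 a0 b0 d0.
  by field; rewrite !gt_eqF.
rewrite -mulr_sumr.
have := sum_half_pow N; set S := \sum_(_ < _) _ => S2.
have K0 : 0 <= M / t ^+ m * (2 / t) * `|h - h'|.
  by rewrite !mulr_ge0 ?invr_ge0 ?exprn_ge0 // ltW.
have := ler_wpM2l K0 S2; move/le_trans; apply.
rewrite le_eqVlt; apply/orP; left; apply/eqP; field.
by rewrite !gt_eqF // exprn_gt0.
Unshelve. all: by end_near. Qed.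

Lemma ps_order c u rho : 0 < rho ->
  (forall h, `|h| < rho -> psum c h @ \oo --> u h) ->
  (forall h, `|h| < rho -> u h = 0) \/
  exists m v r L, [/\ 0 < r, v 0 != 0, (forall h, `|h| < r -> u h = h ^+ m * v h) & lip v r L].
Proof.
move=> r0 H.
have [[m0 cm0]|hc] := boolp.pselect (exists m, c m != 0); last first.
  left => h hr; apply: (cvg_unique _ (H h hr)) => //.
  rewrite (_ : psum c h = fun=> 0); first exact: cvg_cst.
  apply/boolp.funext => N; rewrite /psum big1 // => j _.
  have -> : c j = 0 by apply/eqP; apply: boolp.contrapT => /negP cj; apply: hc; exists j.
  by rewrite mul0r.
right; have ex : exists m, c m != 0 by exists m0.
have [m cm mmin] := ex_minnP ex.
have [v [r [L [h1 h2 h3 h4 h5]]]] := ps_factor m r0 H.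
exists m, v, r, L; split => //; first by rewrite h3.
move=> h hr; rewrite h4 // /psum big1 ?add0r // => j _.
have -> : c j = 0; last by rewrite mul0r.
apply/eqP; apply: boolp.contrapT => /negP cj.
by have := mmin j cj; rewrite leqNgt ltn_ord.
Qed.

Lemma quad_is_derive (g : R -> R) x D C : (\forall t \near (0 : R), `|g (x + t) - g x - D * t| <= C * t ^+ 2) ->
  is_derive x 1 g D.
Proof.
move=> h.
have lim : h^-1 *: (g (h *: 1 + x) - g x) @[h --> 0^'] --> D.
  apply/cvgrPdist_lt => e e0.
  have C0 : 0 < `|C| + 1 by have := normr_ge0 C; lra.
  have hte : \forall t \near (0 : R), `|t| < e / (`|C| + 1).
    by apply: nbhs0_lt; exact: divr_gt0.
  near=> t; have t0 : t != 0 by near: t; exact: nbhs_dnbhs_neq.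
  have ht : `|g (x + t) - g x - D * t| <= C * t ^+ 2.
    by near: t; apply: (nbhs_dnbhs h).
  have te : `|t| < e / (`|C| + 1).
    by near: t; apply: (nbhs_dnbhs hte).
  rewrite [_ *: 1]mulr1 [t + x]addrC.
  have -> : D - t^-1 *: (g (x + t) - g x) = - (g (x + t) - g x - D * t) / t.
    by rewrite /GRing.scale /=; field.
  have nt : 0 < `|t| by rewrite normr_gt0.
  rewrite normrM normrN normfV ltr_pdivrMr //; apply: le_lt_trans ht _.
  rewrite -real_normK ?num_real // expr2 mulrA ltr_pM2r //.
  rewrite ltr_pdivlMr // in te; have := ler_norm C; nra.
split; first by apply/cvg_ex; exists D.
exact: cvg_lim lim.
Unshelve. all: by end_near. Qed.

Lemma pseries_diffs_half c x : x != 0 -> cvgn (pseries c x) -> cvgn (pseries (pseries_diffs c) (x / 2)).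
Proof.
move=> x0 /cvg_series_cvg_0 h0.
have /cvg_seq_bounded [M0 [_ hM]] : cvgn (fun j => c j * x ^+ j).
  by apply/cvg_ex; exists 0.
have hM1 := hM (`|M0| + 1) ltac:(by have := ler_norm M0; lra).
pose M := `|M0| + 1; have M1 : 0 <= M by rewrite addr_ge0.
have nx : 0 < `|x| by rewrite normr_gt0.
apply: normed_cvg; apply: nondecreasing_is_cvgn.
  by apply: nondecreasing_series => n _ _; exact: normr_ge0.
exists (2 * M / `|x| * 2) => _ [N _ <-].
rewrite -[leLHS]/(series (fun i => `|pseries_diffs c i * (x / 2) ^+ i|) N) /series /= big_mkord.
apply: (@le_trans _ _ (\sum_(j < N) 2 * M / `|x| * (j.+1%:R / 2 ^+ j.+1))).
  apply: ler_sum => j _; rewrite /pseries_diffs !normrM normrX normrM normfV.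
  rewrite (@ger0_norm _ 2) // (@ger0_norm _ j.+1%:R) //.
  have := hM1 j.+1 I; rewrite /= normrM normrX -/M exprS => hj.
  have xj : 0 < `|x| ^+ j by rewrite exprn_gt0.
  have hc : `|c j.+1| <= M / (`|x| * `|x| ^+ j) by rewrite ler_pdivlMr ?mulr_gt0.
  apply: (@le_trans _ _ (j.+1%:R * (M / (`|x| * `|x| ^+ j)) * (`|x| / 2) ^+ j)).
    by rewrite ler_wpM2r ?exprn_ge0 ?divr_ge0 // ler_wpM2l.
  have h2 : (2 : R) ^+ j != 0 by rewrite expf_neq0.
  rewrite expr_div_n exprS le_eqVlt; apply/orP; left; apply/eqP; field.
  by rewrite h2 !gt_eqF.
rewrite -mulr_sumr ler_wpM2l ?divr_ge0 ?mulr_ge0 //.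
have := sum_half_pow N.+1; rewrite big_ord_recl mul0r add0r.
by under eq_bigr do rewrite lift0.
Qed.

(** Identifies the Taylor coefficients with the derivatives. The first derivative follows from the
    quadratic remainder; the second requires differentiability at nearby points, obtained from the
    differentiated series. *)
Lemma analytic_expansion (f : R -> R) x0 : real_analytic f ->
  exists e1 e2 r C, [/\ 0 < r, forall t, `|t| < r -> `|f (x0 + t) - f x0 - e1 * t - e2 * t ^+ 2| <= C * `|t| ^+ 3,
    is_derive x0 1 f e1, derive1 f x0 = e1 & derive1n 2 f x0 = 2 * e2].
Proof.
move=> an; have [rho [r0 [c hc]]] := an x0.
pose u h := f (x0 + h).
have H h : `|h| < rho -> psum c h @ \oo --> u h.
  by move=> hr; have := hc (x0 + h); rewrite [x0 + h - x0]addrC addKr => /(_ hr).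
have [v [r [L [h1 h2 h3 h4 h5]]]] := ps_factor 2 r0 H.
have [v3 [r3 [L3 [g1 g2 g3 g4 g5]]]] := ps_factor 3 r0 H.
have u0 : f x0 = c 0%N.
  have := h4 0; rewrite normr0 => /(_ h1); rewrite /u addr0 => ->.
  by rewrite /psum !big_ord_recl big_ord0 /= /bump /=; ring.
have expan t : `|t| < r3 -> f (x0 + t) - f x0 - c 1%N * t - c 2%N * t ^+ 2 = t ^+ 3 * v3 t.
  move=> tr; have := g4 t tr; rewrite /u /psum !big_ord_recl big_ord0 /= /bump /= u0 => ->; ring.
have v3b t : `|t| < r3 -> `|v3 t| <= `|v3 0| + `|L3| * r3.
  move=> tr; have := g5 t 0 tr; rewrite normr0 => /(_ g1); rewrite subr0 => hl.
  have : `|v3 t| <= `|v3 0| + `|v3 t - v3 0|.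
    by have := ler_normD (v3 0) (v3 t - v3 0); rewrite addrC subrK.
  have : L3 * `|t| <= `|L3| * r3.
    by apply: (@le_trans _ _ (`|L3| * `|t|)); [rewrite ler_wpM2r // ler_norm | rewrite ler_wpM2l // ltW].
  lra.
have d1 : is_derive x0 1 f (c 1%N).
  apply: (@quad_is_derive _ _ _ (`|c 2%N| + (`|v3 0| + `|L3| * r3))).
  have ht1 : \forall t \near (0 : R), `|t| < 1 by exact: nbhs0_lt.
  have hr3 : \forall t \near (0 : R), `|t| < r3 by exact: nbhs0_lt.
  near=> t; have tr : `|t| < r3. near: t; exact: hr3.
  have t1 : `|t| < 1 by near: t; exact: ht1.
  have -> : f (x0 + t) - f x0 - c 1%N * t = c 2%N * t ^+ 2 + t ^+ 3 * v3 t.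
    by rewrite -expan //; ring.
  apply: le_trans (ler_normD _ _) _; rewrite (normrM (c 2%N)) (normrM (t ^+ 3)) !normrX mulrDl.
  rewrite -[X in _ <= _ * X + _ * X](@real_normK _ t) ?num_real //; apply: lerD => //.
  rewrite mulrC; apply: ler_pM => //; first exact: v3b.
  by rewrite exprS ler_piMl ?exprn_ge0 // ltW.
exists (c 1%N), (c 2%N), r3, (`|v3 0| + `|L3| * r3); split => //.
- by move=> t tr; rewrite expan // normrM normrX mulrC ler_wpM2r ?exprn_ge0 // v3b.
- by rewrite derive1E; apply: derive_val.
(* One halving for convergence of the series, and one more for each of its first two formal
   derivatives: all three converge at [K]. *)
pose K := rho / 2 / 2 / 2.
have K0 : 0 < K by rewrite /K; lra.
have psE a x : pseries a x = psum a x.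
  by apply/boolp.funext => N; rewrite /pseries /series /= big_mkord.
have cK0 : cvgn (pseries c (rho / 2)).
  rewrite psE; apply/cvg_ex; exists (u (rho / 2)); apply: H; rewrite gtr0_norm; lra.
have c1 : cvgn (pseries (pseries_diffs c) (rho / 2 / 2)).
  by apply: pseries_diffs_half => //; rewrite gt_eqF //; lra.
have c2 : cvgn (pseries (pseries_diffs (pseries_diffs c)) K).
  by apply: pseries_diffs_half => //; rewrite gt_eqF //; lra.
have c1K : cvgn (pseries (pseries_diffs c) K).
  by apply: is_cvg_pseries_inside c1 _; rewrite !gtr0_norm // /K; lra.
have cK : cvgn (pseries c K).
  by apply: is_cvg_pseries_inside cK0 _; rewrite !gtr0_norm // /K; lra.
pose D t := limn (pseries (pseries_diffs c) t).
have dD t : `|t| < K -> is_derive (x0 + t) 1 f (D t).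
  move=> tK.
  have hd := @pseries_snd_diffs R c K t cK c1K c2 ltac:(by rewrite (gtr0_norm K0)).
  have hd' : is_derive t 1 u (D t).
    apply: near_eq_is_derive hd; near=> s.
    have sK : `|s| < K.
      near: s; have /cvgr_lt : (fun s : R => `|s|) s @[s --> t] --> `|t|.
        by apply: cvg_norm; exact: cvg_id.
      by apply.
    apply: cvg_lim => //; rewrite psE; apply: H; apply: lt_trans sK _; rewrite /K; lra.
  have -> : f = u \o (fun y => y - x0).
    by apply/boolp.funext => y; rewrite /u /= addrC subrK.
  rewrite -[D t]mulr1; apply: is_derive1_comp; last first.
    exact: (is_derive_shift _ _ (- x0)).
  by rewrite [x0 + t]addrC addrK.
have cv1 h : `|h| < rho / 2 / 2 -> psum (pseries_diffs c) h @ \oo --> D h.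
  move=> hr; rewrite -psE; apply: is_cvg_pseries_inside c1 _.
  by rewrite [`|rho / 2 / 2|]gtr0_norm //; lra.
have r4 : 0 < rho / 2 / 2 by lra.
have [w [r' [L' [w1 w2 w3 w4 w5]]]] := ps_factor 1 r4 cv1.
have D0 : D 0 = c 1%N.
  have := w4 0; rewrite normr0 => /(_ w1) ->.
  by rewrite /psum big_ord_recl big_ord0 /= /pseries_diffs; ring.
have dD0 : is_derive (0 : R) 1 D (2 * c 2%N).
  have hr' : \forall t \near (0 : R), `|t| < r' by exact: nbhs0_lt.
  apply: (@quad_is_derive _ _ _ L'); near=> t.
  have tr : `|t| < r' by near: t; exact: hr'.
  rewrite add0r D0 w4 // /psum big_ord_recl big_ord0 /= expr0 expr1 mulr1 addr0.
  rewrite {1}/pseries_diffs mul1r.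
  have -> : c 1%N + t * w t - c 1%N - 2 * c 2%N * t = t * (w t - w 0).
    by rewrite w3 /pseries_diffs; ring.
  have := w5 t 0 tr; rewrite normr0 subr0 => /(_ w1) hw.
  rewrite normrM -(@real_normK _ t) ?num_real // expr2 mulrC mulrA.
  by rewrite ler_wpM2r.
rewrite /derive1n /= derive1E.
have -> : 'D_1 (derive1 f) x0 = 'D_1 (fun y => D (y - x0)) x0.
  apply: near_eq_derive; near=> y.
  have yK : `|y - x0| < K.
    by near: y; have := @nbhsx_ballx _ _ x0 K K0; apply: filterS => z /=; rewrite /ball /= distrC.
  have := dD _ yK; rewrite addrC subrK => hy.
  by rewrite derive1E; apply: derive_val.
have hcomp : is_derive x0 1 (D \o (fun y => y - x0)) (2 * c 2%N * 1).
  apply: is_derive1_comp; first by rewrite subrr.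
  exact: (is_derive_shift _ _ (- x0)).
by rewrite mulr1 in hcomp; apply: derive_val.
Unshelve. all: by end_near. Qed.

End PowerSeries.

(** * Real analytic functions *)

Section Analytic.
Variable R : realType.
Implicit Types (f g : R -> R).

Lemma analyticB f g : real_analytic f -> real_analytic g -> real_analytic (fun x => f x - g x).
Proof.
move=> hf hg x0; have [r1 [r10 [a ha]]] := hf x0; have [r2 [r20 [b hb]]] := hg x0.
exists (Num.min r1 r2); split; first by rewrite lt_min r10.
exists (fun j => a j - b j) => x; rewrite lt_min => /andP[h1 h2].
under boolp.eq_fun do (under eq_bigr do rewrite mulrBl; rewrite sumrB).
by apply: cvgB; [exact: ha | exact: hb].
Qed.

Lemma analytic_cst (c : R) : real_analytic (fun=> c).
Proof.
move=> x0; exists 1; split => //; exists (fun j => if j == 0%N then c else 0) => x _.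
apply/cvgrPdist_lt => e e0; near=> N.
have N0 : (0 < N)%N by near: N; exists 1%N.
rewrite -(prednK N0) big_ord_recl expr0 mulr1 big1 ?addr0 ?subrr ?normr0 //.
by move=> j _; rewrite /= mul0r.
Unshelve. all: by end_near. Qed.

Lemma analytic_refl f (k : R) : real_analytic f -> real_analytic (fun x => f (2 * k - x)).
Proof.
move=> hf x0; have [r [r0 [a ha]]] := hf (2 * k - x0).
exists r; split => //; exists (fun j => (-1) ^+ j * a j) => x hx.
have e : 2 * k - x - (2 * k - x0) = - (x - x0) by ring.
have := ha (2 * k - x); rewrite e normrN => /(_ hx).
rewrite (_ : (fun N : nat => _) = (fun N : nat => \sum_(j < N) (-1) ^+ j * a j * (x - x0) ^+ j)) //.
apply/boolp.funext => N; apply: eq_bigr => j _.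
by rewrite [(- (_ - _)) ^+ _]exprNn; ring.
Qed.

Lemma near_radius (P : R -> Prop) r : 0 < r -> (forall t, `|t| < r -> P t) -> \forall t \near (0 : R), P t.
Proof. by move=> r0 h; have := @nbhs0_lt _ R _ r0; apply: filterS => t; exact: h. Qed.

Lemma near_radiusE (P : R -> Prop) : (\forall t \near (0 : R), P t) ->
  exists r, 0 < r /\ forall t, `|t| < r -> P t.
Proof.
move=> /nbhs_ballP[r r0 h]; exists r; split => // t tr; apply: h.
by rewrite /ball /= sub0r normrN.
Qed.

Lemma lip_near (v : R -> R) r L : 0 < r -> lip v r L -> v 0 != 0 ->
  \forall h \near (0 : R), `|v 0| / 2 <= `|v h| <= 2 * `|v 0|.
Proof.
move=> r0 hv v0; have nv : 0 < `|v 0| by rewrite normr_gt0.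
have L0 : 0 < `|L| + 1 by have := normr_ge0 L; lra.
apply: (@near_radius _ (Num.min r (`|v 0| / 2 / (`|L| + 1)))).
  by rewrite lt_min r0 !divr_gt0.
move=> h; rewrite lt_min ltr_pdivlMr // => /andP[h1 h2].
have := hv h 0 h1; rewrite normr0 subr0 => /(_ r0) h3.
have h4 : `|v h - v 0| <= `|v 0| / 2.
  by apply: le_trans h3 _; have := ler_norm L; have := normr_ge0 h; nra.
have := ler_normD (v 0) (v h - v 0); rewrite subrKC.
have := ler_normD (v h) (v 0 - v h); rewrite subrKC distrC.
by move=> h5 h6; apply/andP; split; lra.
Qed.

Lemma analytic_order f x0 : real_analytic f ->
  (\forall t \near (0 : R), f (x0 + t) = 0) \/ (\forall t \near (0 : R), t != 0 -> f (x0 + t) != 0).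
Proof.
move=> hf; have [r [r0 [a ha]]] := hf x0.
have H h : `|h| < r -> psum a h @ \oo --> f (x0 + h).
  by move=> hr; have := ha (x0 + h); rewrite [x0 + h - x0]addrC addKr => /(_ hr).
case: (ps_order r0 H) => [h|[m [v [r' [L [h1 h2 h3 h4]]]]]].
  by left; exact: near_radius h.
right; have hv := lip_near h1 h4 h2.
have hr : \forall t \near (0 : R), `|t| < r' by exact: nbhs0_lt.
near=> t => t0.
have tr : `|t| < r' by near: t.
rewrite h3 // mulf_neq0 ?expf_neq0 // -normr_gt0.
have /andP[h5 _] : `|v 0| / 2 <= `|v t| <= 2 * `|v 0| by near: t.
by apply: lt_le_trans h5; rewrite divr_gt0 // normr_gt0.
Unshelve. all: by end_near. Qed.

(** The points near which [f] vanishes form an open set, closed because other zeros are isolated;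
    the line is connected. *)
Lemma analytic_identity f x0 : real_analytic f ->
  (\forall t \near (0 : R), f (x0 + t) = 0) -> forall x, f x = 0.
Proof.
move=> hf h0.
pose Z := [set x | \forall t \near (0 : R), f (x + t) = 0].
have Zopen : open Z.
  rewrite openE => x /near_radiusE[r [r0 hr]].
  apply/nbhs_ballP; exists (r / 2) => /=; first lra.
  move=> y; rewrite /ball /= => xy.
  apply: (@near_radius _ (r / 2)); first lra.
  move=> t tr; have := hr (y - x + t); have -> : x + (y - x + t) = y + t by ring.
  apply; rewrite distrC in xy; apply: le_lt_trans (ler_normD _ _) _; lra.
have Zclosed : closed Z.
  rewrite -openC openE => x nZ.
  case: (analytic_order x hf) => [//|/near_radiusE[r [r0 hr]]].
  apply/nbhs_ballP; exists r => //= y; rewrite /ball /= => xy Zy.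
  have [yx|yx] := eqVneq y x; first by apply: nZ; rewrite -yx.
  have := nbhs_singleton Zy; rewrite addr0 => fy.
  have := hr (y - x); rewrite distrC subr_eq0 => /(_ xy yx).
  by rewrite subrKC fy eqxx.
have conn : connected [set: R] by apply/connected_intervalP => x y _ _ z _.
have ZT : Z = [set: R].
  apply: conn.
  - by exists x0.
  - by exists Z => //; rewrite setTI.
  - by exists Z => //; rewrite setTI.
move=> x; have : Z x by rewrite ZT.
by move=> /nbhs_singleton; rewrite addr0.
Qed.

Lemma analytic_isolated f x0 : real_analytic f -> (exists x, f x <> 0) ->
  \forall t \near (0 : R), t != 0 -> f (x0 + t) != 0.
Proof.
move=> hf [x fx]; case: (analytic_order x0 hf) => // h.
by case: fx; exact: (analytic_identity hf h).
Qed.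

Lemma analytic_finite_zeros f : real_analytic f -> (exists x, f x <> 0) ->
  finite_set ([set x | f x = 0] `&` `[0, 1]%classic).
Proof.
move=> hf hx; apply: boolp.contrapT => hinf.
have hb : bounded_set ([set x | f x = 0] `&` `[0, 1]%classic).
  exists 1; split; first exact: num_real.
  move=> M M1 x [_ /=]; rewrite in_itv /= => /andP[x0 x1].
  by rewrite ger0_norm //; lra.
have [l hl] := infinite_bounded_limit_point_nonempty hinf hb.
have /near_radiusE[r [r0 hr]] := analytic_isolated l hf hx.
have [y [yl [fy _] yb]] := hl _ (nbhsx_ballx l r r0).
have := hr (y - l); rewrite subr_eq0 yl subrKC fy eqxx.
by move: yb; rewrite /ball /= distrC => yb /(_ yb isT).
Qed.

(** If none of the functions vanished identically, their zeros in [[0, 1]] would be countably many,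
    while they cover an interval of measure 1. This turns a choice of band made for each k into one
    valid for all k. *)
Lemma analytic_countable_cover (I : countType) (d : I -> R -> R) :
  (forall i, real_analytic (d i)) -> (forall x, exists i, d i x = 0) ->
  exists i, forall x, d i x = 0.
Proof.
move=> hd hc; apply: boolp.contrapT => hn.
have fin i : finite_set ([set x | d i x = 0] `&` `[0, 1]%classic).
  apply: analytic_finite_zeros => //; apply: boolp.contrapT => hi.
  by apply: hn; exists i => x; apply: boolp.contrapT => hx; apply: hi; exists x.
have cov : `[0, 1]%classic `<=` \bigcup_i ([set x | d i x = 0] `&` `[0, 1]%classic).
  by move=> x hx; have [i hi] := hc x; exists i.
have cnt : countable (\bigcup_i ([set x | d i x = 0] `&` `[0, 1]%classic)).
  by apply: bigcup_countable => // i _; exact: finite_set_countable.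
have cnt01 : countable (`[0, 1]%classic : set R).
  exact: sub_countable (subset_card_le cov) cnt.
have := countable_lebesgue_measure0 cnt01.
rewrite lebesgue_measure_itv /= lte_fin ltr01 oppr0 adde0 => /eqP.
by rewrite eqe oner_eq0.
Qed.

Lemma lip_div (a b : R -> R) r r' L L' : 0 < r -> 0 < r' -> lip a r L -> lip b r' L' -> b 0 != 0 ->
  exists eta M, [/\ 0 < eta, lip (fun h => a h / b h) eta M & forall h, `|h| < eta -> b h != 0].
Proof.
move=> r0 r0' ha hb b0; have nb : 0 < `|b 0| by rewrite normr_gt0.
have /near_radiusE[s [s0 hs]] := lip_near r0' hb b0.
pose eta := Num.min s (Num.min r r').
have eta0 : 0 < eta by rewrite !lt_min s0 r0.
have e1 : eta <= s by rewrite ge_min lexx.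
have e2 : eta <= r by rewrite !ge_min lexx orbT.
have e3 : eta <= r' by rewrite !ge_min lexx !orbT.
pose A := `|a 0| + `|L| * eta.
have hA h : `|h| < eta -> `|a h| <= A.
  move=> he; have := ha h 0 (lt_le_trans he e2); rewrite normr0 subr0 => /(_ r0) h1.
  have h2 : L * `|h| <= `|L| * eta.
    apply: (@le_trans _ _ (`|L| * `|h|)); first by rewrite ler_wpM2r // ler_norm.
    by rewrite ler_wpM2l // ltW.
  have := ler_normD (a 0) (a h - a 0); rewrite subrKC /A; lra.
have bn h : `|h| < eta -> b h != 0.
  move=> he; rewrite -normr_gt0; have /andP[h1 _] := hs h (lt_le_trans he e1).
  by apply: lt_le_trans h1; lra.
exists eta, ((`|L| * (2 * `|b 0|) + A * `|L'|) / (`|b 0| / 2) ^+ 2); split => // h h' he he'.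
have /andP[b1 b2] := hs h (lt_le_trans he e1); have /andP[b1' b2'] := hs h' (lt_le_trans he' e1).
have -> : a h / b h - a h' / b h' = ((a h - a h') * b h' + a h' * (b h' - b h)) / (b h * b h').
  by field; rewrite !bn.
rewrite normrM normfV normrM.
have nbb : 0 < `|b h| * `|b h'| by rewrite mulr_gt0 // normr_gt0 bn.
have beta0 : 0 < (`|b 0| / 2) ^+ 2 by rewrite exprn_gt0; lra.
have bb : (`|b 0| / 2) ^+ 2 <= `|b h| * `|b h'| by rewrite expr2 ler_pM //; lra.
have n0 := normr_ge0 (h - h').
have num : `|(a h - a h') * b h' + a h' * (b h' - b h)| <= (`|L| * (2 * `|b 0|) + A * `|L'|) * `|h - h'|.
  apply: le_trans (ler_normD _ _) _; rewrite !normrM mulrDl; apply: lerD.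
    rewrite mulrAC; apply: ler_pM => //; apply: le_trans (ha _ _ (lt_le_trans he e2) (lt_le_trans he' e2)) _.
    by rewrite ler_wpM2r // ler_norm.
  rewrite -mulrA; apply: ler_pM => //; first exact: hA.
  rewrite distrC; apply: le_trans (hb _ _ (lt_le_trans he e3) (lt_le_trans he' e3)) _.
  by rewrite ler_wpM2r // ler_norm.
rewrite ler_pdivrMr //; apply: le_trans num _.
set K := _ + _.
have A0 : 0 <= A by rewrite addr_ge0 ?mulr_ge0 // ltW.
have K0 : 0 <= K by rewrite addr_ge0 ?mulr_ge0 // ltW.
have -> : K / (`|b 0| / 2) ^+ 2 * `|h - h'| * (`|b h| * `|b h'|) =
  K * `|h - h'| * (`|b h| * `|b h'| / (`|b 0| / 2) ^+ 2) by ring.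
by rewrite ler_peMr ?mulr_ge0 // ler_pdivlMr // mul1r.
Qed.

Lemma near_comp (g : R -> R) K (P : R -> Prop) :
  (\forall t \near (0 : R), `|g t| <= K * `|t|) -> (\forall h \near (0 : R), P h) ->
  \forall t \near (0 : R), P (g t).
Proof.
move=> /near_radiusE[r [r0 hg]] /near_radiusE[s [s0 hP]].
have K0 : 0 < `|K| + 1 by have := normr_ge0 K; lra.
apply: (@near_radius _ (Num.min r (s / (`|K| + 1)))); first by rewrite lt_min r0 divr_gt0.
move=> t; rewrite lt_min ltr_pdivlMr // => /andP[t1 t2]; apply: hP.
apply: le_lt_trans (hg t t1) _; have := ler_norm K; have := normr_ge0 t; nra.
Qed.

Lemma near_opp (P : R -> Prop) : (\forall t \near (0 : R), P t) -> \forall t \near (0 : R), P (- t).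
Proof.
by move=> /near_radiusE[r [r0 h]]; apply: (near_radius r0) => t tr; apply: h; rewrite normrN.
Qed.

Lemma inv_expansion f x0 : real_analytic f -> (forall x, f x != 0) ->
  exists C, \forall t \near (0 : R),
    `|(f (x0 + t))^-1 - (f x0)^-1 + derive1 f x0 / f x0 ^+ 2 * t| <= C * t ^+ 2.
Proof.
move=> hf fn; have [e1 [e2 [r [C [r0 h1 h2 h3 h4]]]]] := analytic_expansion x0 hf.
have n0 : 0 < `|f x0| by rewrite normr_gt0.
pose B := `|e2| + `|C|.
have B0 : 0 <= B by rewrite addr_ge0.
have A0 : 0 < `|e1| + B + 1 by have := normr_ge0 e1; lra.
exists ((`|f x0| * B + `|e1| * (`|e1| + B)) * 2 / `|f x0| ^+ 3).
apply: (@near_radius _ (Num.min r (Num.min 1 (`|f x0| / 2 / (`|e1| + B + 1))))).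
  by rewrite !lt_min r0 ltr01 !divr_gt0.
move=> t; rewrite !lt_min ltr_pdivlMr // => /and3P[t1 t2 t3].
have tn := normr_ge0 t.
have := h1 t t1; set E := f (x0 + t); set e0 := f x0 in n0 t3 * => hE.
have t20 : 0 <= t ^+ 2 by exact: sqr_ge0.
have tt : t ^+ 2 = `|t| ^+ 2 by rewrite real_normK ?num_real.
have rem : `|E - e0 - e1 * t| <= B * t ^+ 2.
  have -> : E - e0 - e1 * t = (E - e0 - e1 * t - e2 * t ^+ 2) + e2 * t ^+ 2 by ring.
  apply: le_trans (ler_normD _ _) _; rewrite [X in _ + X]normrM (ger0_norm t20) /B mulrDl addrC lerD2l.
  apply: le_trans hE _; apply: (@le_trans _ _ (`|C| * `|t| ^+ 3)).
    by rewrite ler_wpM2r ?exprn_ge0 // ler_norm.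
  by rewrite ler_wpM2l // tt exprS ler_piMl ?exprn_ge0 // ltW.
have dif : `|E - e0| <= (`|e1| + B) * `|t|.
  have -> : E - e0 = (E - e0 - e1 * t) + e1 * t by ring.
  apply: le_trans (ler_normD _ _) _; rewrite normrM mulrDl addrC lerD2l.
  by apply: le_trans rem _; rewrite ler_wpM2l // tt expr2 ler_piMl // ltW.
have En : `|e0| / 2 <= `|E|.
  have := ler_normD E (e0 - E); rewrite subrKC distrC; nra.
have E0 : E != 0 by exact: fn. have e00 : e0 != 0 by exact: fn.
rewrite h3.
have -> : E^-1 - e0^-1 + e1 / e0 ^+ 2 * t = (- e0 * (E - e0 - e1 * t) + e1 * t * (E - e0)) / (E * e0 ^+ 2).
  by field; rewrite E0 e00.
rewrite normrM normfV (normrM E) normrX.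
have den : 0 < `|E| * `|e0| ^+ 2 by rewrite mulr_gt0 ?exprn_gt0 // normr_gt0.
rewrite ler_pdivrMr //.
apply: (@le_trans _ _ ((`|e0| * B + `|e1| * (`|e1| + B)) * t ^+ 2)).
  apply: le_trans (ler_normD _ _) _; rewrite !normrM normrN mulrDl; apply: lerD.
    by rewrite -mulrA ler_wpM2l.
  by rewrite tt expr2 -!mulrA ler_wpM2l // mulrCA ler_wpM2l.
set K := _ + _.
have K0 : 0 <= K by rewrite addr_ge0 ?mulr_ge0 // addr_ge0.
have -> : K * 2 / `|e0| ^+ 3 * t ^+ 2 * (`|E| * `|e0| ^+ 2) = K * t ^+ 2 * (2 * `|E| / `|e0|).
  by field; rewrite gt_eqF.
apply: ler_peMr; first exact: mulr_ge0.
by rewrite ler_pdivlMr // mul1r; lra.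
Qed.

End Analytic.

(** * Bands cut out by an affine family of determinants *)

Lemma normr_half_lt (R : realFieldType) (r : R) : 0 < r -> `|r / 2| < r.
Proof. by move=> r0; rewrite gtr0_norm ?divr_gt0 //; lra. Qed.

Section BandCore.
Variables (R : realType) (I : countType) (E : I -> R -> R) (f : R -> R) (F : R -> R -> R) (k0 : R).
Variables (c C : R).
Hypothesis c0 : 0 < c.
Hypothesis f_even : forall x, f (2 * k0 - x) = f x.
Hypothesis f_quad : \forall t \near (0 : R),
  c * t ^+ 2 <= `|f (k0 + t) - f k0| <= C * t ^+ 2.
Hypothesis F0 : forall k, F 0 k = 1.
Hypothesis F_affine : forall mu, exists B, forall k k', F mu k - F mu k' = B * (f k - f k').
Hypothesis F_ps : forall mu0 k, exists a, forall h, psum a h @ \oo --> F (mu0 + h) k.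
Hypothesis E_an : forall i, real_analytic (E i).
Hypothesis E_neq0 : forall i k, E i k != 0.
Hypothesis F_eig : forall i k, F (E i k)^-1 k = 0.
Hypothesis F_eig2 : forall i j k, i != j -> E i k = E j k ->
  exists C, forall e, `|e| <= 1 -> `|F ((E i k)^-1 + e) k| <= C * e ^+ 2.
Hypothesis E_sym : forall i k, exists j, E j (2 * k0 - k) = E i k.

Let ff t := f (k0 + t) - f k0.
(** Bands are followed through [1 / E], because the zeros of [F] in [mu] are inverse eigenvalues;
    [DD] is the derivative of [1 / E] at [k0]. *)
Let hh i t := (E i (k0 + t))^-1 - (E i k0)^-1.
Let DD i := - (derive1 (E i) k0 / E i k0 ^+ 2).

Lemma ff_even t : ff (- t) = ff t.
Proof. by rewrite /ff -(f_even (k0 + t)); congr (f _ - _); ring. Qed.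

Lemma ff_neq0 : \forall t \near (0 : R), t != 0 -> ff t != 0.
Proof.
have := f_quad; apply: filterS => t /andP[h _] t0.
rewrite -normr_gt0; apply: lt_le_trans h; rewrite mulr_gt0 //.
by rewrite lt_neqAle sqr_ge0 andbT eq_sym expf_neq0.
Qed.

Lemma flatP g : ~ flat g -> forall x0 : R, exists x, g x - g x0 <> 0.
Proof.
move=> hg x0; apply: boolp.contrapT => hn; apply: hg; exists (g x0) => k.
apply/eqP; rewrite -subr_eq0; apply/eqP; apply: boolp.contrapT => hk.
by apply: hn; exists k.
Qed.

Lemma hh_expansion i : exists K, \forall t \near (0 : R), `|hh i t - DD i * t| <= K * t ^+ 2.
Proof.
have [K hK] := inv_expansion k0 (E_an i) (E_neq0 i).
by exists K; move: hK; apply: filterS => t; rewrite /hh /DD mulNr opprK.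
Qed.

Lemma hh_lip i : exists K, \forall t \near (0 : R), `|hh i t| <= K * `|t|.
Proof.
have [K hK] := hh_expansion i; exists (`|DD i| + `|K|).
have h1 : \forall t \near (0 : R), `|t| < 1 by exact: nbhs0_lt.
near=> t; have ht : `|hh i t - DD i * t| <= K * t ^+ 2 by near: t.
have t1 : `|t| < 1 by near: t.
have := ler_normD (DD i * t) (hh i t - DD i * t); rewrite subrKC normrM mulrDl.
move/le_trans; apply; rewrite lerD2l; apply: le_trans ht _.
apply: (@le_trans _ _ (`|K| * t ^+ 2)); first by rewrite ler_wpM2r ?sqr_ge0 // ler_norm.
rewrite ler_wpM2l // -real_normK ?num_real // expr2 ler_piMl //; exact: ltW.
Unshelve. all: by end_near. Qed.

Lemma hh_neq0 i : ~ flat (E i) -> \forall t \near (0 : R), t != 0 -> hh i t != 0.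
Proof.
move=> /flatP/(_ k0) hi.
have := analytic_isolated k0 (analyticB (E_an i) (analytic_cst (E i k0))) hi.
apply: filterS => t h t0; rewrite /hh subr_eq0 (inj_eq invr_inj) -subr_eq0; exact: h.
Qed.

(** Evaluating the affine identity at [k0] and at one [k1] with [f k1 != f k0] expresses [b] through
    two values of [F], so it has power series in [mu]. *)
Lemma F_coef : exists b, (forall mu k k', F mu k - F mu k' = b mu * (f k - f k')) /\
  forall mu0, exists a, forall h, psum a h @ \oo --> b (mu0 + h).
Proof.
have [b hb] := boolp.choice F_affine; exists b; split => // mu0.
have /near_radiusE[r [r0 hr]] := ff_neq0.
have hk1 := hr (r / 2) ltac:(rewrite gtr0_norm; lra) ltac:(rewrite gt_eqF //; lra).
pose k1 := k0 + r / 2.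
have d0 : f k1 - f k0 != 0 by exact: hk1.
have [a1 h1] := F_ps mu0 k1; have [a0 h0] := F_ps mu0 k0.
exists (fun j => (a1 j - a0 j) / (f k1 - f k0)) => h.
have -> : b (mu0 + h) = (F (mu0 + h) k1 - F (mu0 + h) k0) / (f k1 - f k0).
  by rewrite hb mulfK.
rewrite (_ : psum _ h = fun N => (psum a1 h N - psum a0 h N) / (f k1 - f k0)).
  by apply: cvgMl; apply: cvgB.
apply/boolp.funext => N; rewrite /psum -sumrB mulr_suml; apply: eq_bigr => j _.
by ring.
Qed.

Lemma F_order i : exists m psi rp L, [/\ 0 < rp, psi 0 != 0, lip psi rp L &
  forall h, `|h| < rp -> F ((E i k0)^-1 + h) k0 = h ^+ m * psi h].
Proof.
set mu0 := (E i k0)^-1; have [a ha] := F_ps mu0 k0.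
(* This radius reaches [mu = 0], where [F] equals 1: the expansion at [mu0] cannot vanish
   identically. *)
have r1 : 0 < `|mu0| + 1 by have := normr_ge0 mu0; lra.
case: (ps_order r1 (fun h _ => ha h)) => [hz|[m [psi [rp [L [h1 h2 h3 h4]]]]]].
  have := hz (- mu0); rewrite normrN subrr F0 => hz'.
  by have /eqP := hz' ltac:(lra); rewrite oner_eq0.
by exists m, psi, rp, L.
Qed.

(** If [b] vanished near [mu0], then [F] would not depend on k there, and the values [1 / E i k] of
    a non-flat band would be zeros of [F] at [k0] accumulating at [mu0], against its finite
    order. *)
Lemma coef_order b i : (forall mu k k', F mu k - F mu k' = b mu * (f k - f k')) ->
  (forall mu0, exists a, forall h, psum a h @ \oo --> b (mu0 + h)) -> ~ flat (E i) ->
  exists m bb rb L, [/\ 0 < rb, bb 0 != 0, lip bb rb L &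
  forall h, `|h| < rb -> b ((E i k0)^-1 + h) = h ^+ m * bb h].
Proof.
move=> hb bps hi; have [m' [psi [rp [Lp [rp0 psi0 lpsi hpsi]]]]] := F_order i.
set mu0 := (E i k0)^-1; have [a' ha'] := bps mu0.
have npsi0 : 0 < `|psi 0| by rewrite normr_gt0.
case: (ps_order ltr01 (fun h _ => ha' h)) => [hz|[m [bb [rb [L [h1 h2 h3 h4]]]]]]; last first.
  by exists m, bb, rb, L.
exfalso; have [K hK] := hh_lip i.
have h1 := near_comp hK (@nbhs0_lt _ R _ ltr01).
have h2 := near_comp hK (lip_near rp0 lpsi psi0).
have h3 := near_comp hK (@nbhs0_lt _ R _ rp0).
have h4 := hh_neq0 hi.
have : \forall t \near (0 : R), t != 0 -> False.
  near=> t => t0.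
  have t1 : `|hh i t| < 1 by near: t.
  have t3 : `|hh i t| < rp by near: t.
  have := hpsi _ t3; have := hb (mu0 + hh i t) k0 (k0 + t).
  rewrite hz // mul0r -/mu0 {2}/hh subrKC F_eig subr0 => ->.
  move/esym/eqP; rewrite mulf_eq0 expf_eq0.
  have t4 : t != 0 -> hh i t != 0 by near: t.
  rewrite (negbTE (t4 t0)) andbF /= => /eqP psi_t.
  have /andP[t2 _] : `|psi 0| / 2 <= `|psi (hh i t)| <= 2 * `|psi 0| by near: t.
  by move: t2; rewrite psi_t normr0; lra.
move=> /near_radiusE[r [r0 hr]]; apply: (hr (r / 2)); first exact: normr_half_lt.
by rewrite gt_eqF // divr_gt0.
Unshelve. all: by end_near. Qed.

(* [r] and [rho] are the same for all the bands through [E i k0]. *)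
Lemma band_relation i : ~ flat (E i) -> exists r rho eta L,
  [/\ (0 < r <= 2)%N, 0 < eta, rho 0 != 0, lip rho eta L &
   forall j, ~ flat (E j) -> E j k0 = E i k0 ->
     \forall t \near (0 : R), hh j t ^+ r * rho (hh j t) = - ff t].
Proof.
move=> hi; have [b [hb bps]] := F_coef.
pose mu0 := (E i k0)^-1.
have [m' [psi [rp [Lp [rp0 psi0 lpsi hpsi]]]]] := F_order i.
have [m [bb [rb [Lb [rb0 bb0 lbb hbb]]]]] := coef_order hb bps hi.
have npsi0 : 0 < `|psi 0| by rewrite normr_gt0.
(* The band is a zero of [F] at [k0 + t]; the affine identity transports the equation to [k0], where
   [F] is an analytic function of [mu] alone. *)
have rel j : E j k0 = E i k0 -> forall t, F (mu0 + hh j t) k0 = - (b (mu0 + hh j t) * ff t).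
  move=> ej t; rewrite /hh ej subrKC /ff -hb F_eig sub0r opprK //.
have hrp : \forall h \near (0 : R), `|h| < rp by exact: nbhs0_lt.
have psin := lip_near rp0 lpsi psi0.
have [K hK] := hh_lip i.
have bbn := lip_near rb0 lbb bb0.
have hrb : \forall h \near (0 : R), `|h| < rb by exact: nbhs0_lt.
have nbb0 : 0 < `|bb 0| by rewrite normr_gt0.
(* Otherwise division by [hh ^+ m'] would express [psi] as a bounded multiple of [ff], which tends
   to 0, while [psi 0 != 0]. *)
have mm' : (m < m')%N.
  rewrite ltnNge; apply/negP => mm.
  have h1 := near_comp hK (@nbhs0_lt _ R _ ltr01).
  have h2 := near_comp hK psin; have h3 := near_comp hK hrp.
  have h2' := near_comp hK bbn; have h3' := near_comp hK hrb.
  have h4 := hh_neq0 hi.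
  have C0 : 0 < `|C| + 1 by have := normr_ge0 C; lra.
  have h5 : \forall t \near (0 : R), `|t| < Num.min 1 (`|psi 0| / 2 / (2 * `|bb 0|) / (`|C| + 1)).
    by apply: nbhs0_lt; rewrite lt_min ltr01 !divr_gt0 // mulr_gt0.
  have : \forall t \near (0 : R), t != 0 -> False.
    near=> t => t0.
    have := rel i erefl t.
    have t1 : `|hh i t| < 1 by near: t.
    have t3 : `|hh i t| < rp by near: t.
    have t3' : `|hh i t| < rb by near: t.
    rewrite hpsi // hbb //.
    have /(_ t0) t4 : t != 0 -> hh i t != 0 by near: t.
    have /andP[t2 _] : `|psi 0| / 2 <= `|psi (hh i t)| <= 2 * `|psi 0| by near: t.
    have /andP[_ t2'] : `|bb 0| / 2 <= `|bb (hh i t)| <= 2 * `|bb 0| by near: t.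
    have /andP[_ t6] : c * t ^+ 2 <= `|ff t| <= C * t ^+ 2 by near: t; exact: f_quad.
    have : `|t| < Num.min 1 (`|psi 0| / 2 / (2 * `|bb 0|) / (`|C| + 1)) by near: t.
    rewrite lt_min => /andP[t7 t8].
    rewrite -(subnK mm) exprD mulrAC -mulrA -mulrN => eq.
    have : hh i t ^+ m' * psi (hh i t) = hh i t ^+ m' * (- (hh i t ^+ (m - m') * bb (hh i t) * ff t)).
      by rewrite eq; ring.
    move/(mulfI (expf_neq0 _ t4)) => eq2.
    move: t2; rewrite eq2 normrN !normrM normrX.
    have p1 : `|hh i t| ^+ (m - m') <= 1 by rewrite exprn_ile1 // ltW.
    have t9 : `|ff t| < `|psi 0| / 2 / (2 * `|bb 0|).
      apply: le_lt_trans t6 _; move: t8; rewrite ltr_pdivlMr // => t8.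
      apply: le_lt_trans t8.
      rewrite -real_normK ?num_real //.
      have tn := normr_ge0 t; have i2 : `|t| ^+ 2 <= `|t| by nra.
      have i1 : C * `|t| ^+ 2 <= `|C| * `|t| ^+ 2 by rewrite ler_wpM2r ?exprn_ge0 // ler_norm.
      have i3 : `|C| * `|t| ^+ 2 <= `|C| * `|t| by rewrite ler_wpM2l.
      lra.
    apply/negP; rewrite -ltNge.
    move: t9; rewrite ltr_pdivlMr ?mulr_gt0 // => t9.
    apply: le_lt_trans t9; rewrite mulrC ler_wpM2l //.
    by rewrite -[leRHS]mul1r; apply: ler_pM.
  move=> /near_radiusE[r [r0 hr]]; apply: (hr (r / 2)); first exact: normr_half_lt.
  by rewrite gt_eqF // divr_gt0.
have [eta [M [eta0 lrho bneq]]] := lip_div rp0 rb0 lpsi lbb bb0.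
pose r := (m' - m)%N; pose rho h := psi h / bb h.
have rho0 : rho 0 != 0 by rewrite mulf_neq0 // invr_neq0.
have r0 : (0 < r)%N by rewrite /r subn_gt0.
have main j : ~ flat (E j) -> E j k0 = E i k0 ->
    \forall t \near (0 : R), hh j t ^+ r * rho (hh j t) = - ff t.
  move=> hj ej; have [Kj hKj] := hh_lip j.
  have h3 := near_comp hKj hrp; have h3' := near_comp hKj hrb.
  have h4 := hh_neq0 hj; have h5 := near_comp hKj (@nbhs0_lt _ R _ eta0).
  near=> t; have [->|t0] := eqVneq t 0.
    by rewrite /hh /ff addr0 !subrr expr0n gtn_eqF // mul0r oppr0.
  have := rel j ej t.
  have t3 : `|hh j t| < rp by near: t.
  have t3' : `|hh j t| < rb by near: t.
  have t5 : `|hh j t| < eta by near: t.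
  have /(_ t0) t4 : t != 0 -> hh j t != 0 by near: t.
  rewrite hpsi // hbb // /rho -(subnKC (ltnW mm')) exprD -/r => eq.
  apply: (mulfI (expf_neq0 m t4)); apply: (mulIf (bneq _ t5)).
  transitivity (hh j t ^+ m * hh j t ^+ r * psi (hh j t)).
    by field; exact: bneq.
  by rewrite eq; ring.
(* An exponent of at least 3 is impossible: [hh = O(t)] would make the left side [O(t^3)], whereas
   [|ff t| >= c * t ^+ 2]. *)
exists r, rho, eta, M; split => //; rewrite r0 /= leqNgt; apply/negP => r3.
have lr := lip_near eta0 lrho rho0.
have h1 := near_comp hK lr; have h2 := main i hi erefl.
have K0 : 0 < `|K| + 1 by have := normr_ge0 K; lra.
have nr0 : 0 < `|rho 0| by rewrite normr_gt0.
have h5 : \forall t \near (0 : R), `|t| < Num.min 1 (c / (2 * `|rho 0| * (`|K| + 1) ^+ r)).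
  by apply: nbhs0_lt; rewrite lt_min ltr01 divr_gt0 // mulr_gt0 ?exprn_gt0 // mulr_gt0.
have : \forall t \near (0 : R), t != 0 -> False.
  near=> t => t0.
  have e : hh i t ^+ r * rho (hh i t) = - ff t by near: t.
  have /andP[t2 _] : c * t ^+ 2 <= `|ff t| <= C * t ^+ 2 by near: t; exact: f_quad.
  have /andP[_ t3] : `|rho 0| / 2 <= `|rho (hh i t)| <= 2 * `|rho 0| by near: t.
  have t4 : `|hh i t| <= K * `|t| by near: t.
  have : `|t| < Num.min 1 (c / (2 * `|rho 0| * (`|K| + 1) ^+ r)) by near: t.
  rewrite lt_min => /andP[t7 t8].
  rewrite -normrN -e normrM normrX in t2.
  have nt : 0 < `|t| by rewrite normr_gt0.
  have t5 : `|hh i t| ^+ r <= (`|K| + 1) ^+ r * `|t| ^+ r.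
    rewrite -exprMn; apply: lerXn2r; rewrite ?nnegrE //.
    by apply: le_trans t4 _; rewrite ler_wpM2r // (le_trans (ler_norm K)) // lerDl.
  have t6 : `|t| ^+ r <= `|t| ^+ 3 by rewrite ler_wiXn2l // ltW.
  move: t2; apply/negP; rewrite -ltNge -real_normK ?num_real //.
  apply: (@le_lt_trans _ _ ((`|K| + 1) ^+ r * `|t| ^+ 3 * (2 * `|rho 0|))).
    apply: ler_pM => //.
    by apply: le_trans t5 _; rewrite ler_wpM2l // exprn_ge0 // ltW.
  move: t8; rewrite ltr_pdivlMr ?mulr_gt0 ?exprn_gt0 // => t8.
  have -> : (`|K| + 1) ^+ r * `|t| ^+ 3 * (2 * `|rho 0|) =
     `|t| * (2 * `|rho 0| * (`|K| + 1) ^+ r) * `|t| ^+ 2 by rewrite exprS; ring.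
  by rewrite ltr_pM2r // exprn_gt0.
move=> /near_radiusE[r' [r'0 hr]]; apply: (hr (r' / 2)); first exact: normr_half_lt.
by rewrite gt_eqF // divr_gt0.
Unshelve. all: by end_near. Qed.

(** Near 0 the Lipschitz factor [rho] is nearly a non-zero constant, so [h * rho h] is injective,
    and [h ^+ 2 * rho h] is injective on each sign of [h]. *)
Lemma lip_mul_inj (rho : R -> R) eta L : 0 < eta -> lip rho eta L -> rho 0 != 0 ->
  \forall s \near (0 : R), forall h h', `|h| < s -> `|h'| < s ->
    (h * rho h = h' * rho h' -> h = h') /\
    (0 < h * h' -> h ^+ 2 * rho h = h' ^+ 2 * rho h' -> h = h').
Proof.
move=> eta0 lrho rho0.
have nr : 0 < `|rho 0| by rewrite normr_gt0.
have /near_radiusE[r [r0 hr]] := lip_near eta0 lrho rho0.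
have L0 : 0 < `|L| + 1 by have := normr_ge0 L; lra.
have small : \forall s \near (0 : R), `|s| < Num.min (Num.min eta r) (`|rho 0| / 2 / (`|L| + 1)).
  by apply: nbhs0_lt; rewrite !lt_min eta0 r0 !divr_gt0.
move: small; apply: filterS => s; rewrite !lt_min ltr_pdivlMr // => /andP[/andP[s1 s2] s3] h h' hs hs'.
have sn := ler_norm s.
have he : `|h| < eta by lra.
have he' : `|h'| < eta by lra.
have /andP[lo _] := hr h ltac:(lra).
have hl := lrho h h' he he'.
have d0 := normr_ge0 (h - h').
(* [|rho h|] is at least [|rho 0| / 2], while the right side is at most [|s| |L| |h - h'|], which is
   too small unless [h = h']. *)
have key (x : R) : `|x| <= `|s| -> (h - h') * rho h = - (x * (rho h - rho h')) -> h = h'.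
  move=> xs e; have : `|(h - h') * rho h| = `|- (x * (rho h - rho h'))| by rewrite e.
  rewrite normrN !normrM => e2.
  have i1 : `|x| * `|rho h - rho h'| <= `|s| * (`|L| * `|h - h'|).
    apply: ler_pM => //; apply: le_trans hl _; rewrite ler_wpM2r //; exact: ler_norm.
  apply/eqP; rewrite -subr_eq0 -normr_le0 leNgt; apply/negP => dpos.
  have i2 : `|h - h'| * (`|rho 0| / 2) <= `|h - h'| * (`|s| * `|L|).
    apply: (@le_trans _ _ (`|h - h'| * `|rho h|)); first by rewrite ler_wpM2l.
    by rewrite e2; apply: le_trans i1 _; rewrite le_eqVlt; apply/orP; left; apply/eqP; ring.
  rewrite ler_pM2l // in i2.
  have := normr_ge0 s; nra.
split => [e|hh0 e].
  apply: (key h'); first by lra.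
  have -> : (h - h') * rho h = h * rho h - h' * rho h by ring.
  by rewrite e; ring.
have hp : h + h' != 0.
  by apply/eqP => z; move: hh0; rewrite (_ : h = - h'); [nra | lra].
(* Since [h] and [h'] have the same sign, [|h + h'| >= |h'|] and this quotient is at most [|h'|]. *)
apply: (key (h' ^+ 2 / (h + h'))).
  have np : 0 < `|h + h'| by rewrite normr_gt0.
  rewrite normrM normfV ler_pdivrMr // normrX expr2.
  apply: ler_pM => //; first lra.
  rewrite -(@ler_pXn2r _ 2) ?nnegrE // !real_normK ?num_real //; nra.
apply: (mulfI hp).
have -> : (h + h') * ((h - h') * rho h) = h ^+ 2 * rho h - h' ^+ 2 * rho h by ring.
by rewrite e; field.
Qed.

(** Coinciding entries make [F] vanish to second order in [mu] along the band. Where [b] is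
    non-zero, hence for k near but different from [k0], the affine identity gives
    [f k - f (k + s) = O(s^2)], so [f] has zero derivative there, against its quadratic growth at
    [k0]. *)
Lemma bands_distinct i j : i != j -> ~ flat (E i) -> (forall k, E i k = E j k) -> False.
Proof.
move=> ij hi eij; have [b [hb bps]] := F_coef.
have [m [bb [rb [Lb [rb0 bb0 lbb hbb]]]]] := coef_order hb bps hi.
have [K hK] := hh_lip i.
have nbb : 0 < `|bb 0| by rewrite normr_gt0.
have der : \forall t \near (0 : R), t != 0 -> is_derive (k0 + t) 1 f 0.
  have h1 := near_comp hK (lip_near rb0 lbb bb0).
  have h2 := near_comp hK (@nbhs0_lt _ R _ rb0).
  have h3 := hh_neq0 hi.
  near=> t => t0.
  have /(_ t0) t1 : t != 0 -> hh i t != 0 by near: t.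
  have t2 : `|hh i t| < rb by near: t.
  have /andP[t3 _] : `|bb 0| / 2 <= `|bb (hh i t)| <= 2 * `|bb 0| by near: t.
  pose k := k0 + t; pose mu := (E i k)^-1.
  have bmu : b mu != 0.
    have -> : mu = (E i k0)^-1 + hh i t by rewrite /hh subrKC.
    rewrite hbb // mulf_neq0 ?expf_neq0 // -normr_gt0; apply: lt_le_trans t3; lra.
  have [C1 hC1] := F_eig2 ij (eij k).
  have [a ha] := bps mu.
  have [v [r [L [r0 _ _ hv lv]]]] := ps_factor 0 ltr01 (fun h _ => ha h).
  have bv h : `|h| < r -> b (mu + h) = v h.
    by move=> /hv ->; rewrite /psum big_ord0 add0r expr0 mul1r.
  have v0 : v 0 != 0 by rewrite -bv ?normr0 // addr0.
  have nv : 0 < `|v 0| by rewrite normr_gt0.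
  have [K1 hK1] := inv_expansion k (E_an i) (E_neq0 i).
  pose e s := (E i (k + s))^-1 - mu.
  pose D := derive1 (E i) k / E i k ^+ 2.
  have hK2 : \forall s \near (0 : R), `|e s| <= (`|D| + `|K1|) * `|s|.
    have hs1 : \forall s \near (0 : R), `|s| < 1 by exact: nbhs0_lt.
    near=> s; have s1 : `|s| < 1 by near: s.
    have h : `|e s + D * s| <= K1 * s ^+ 2 by near: s.
    have -> : e s = (e s + D * s) - D * s by ring.
    apply: le_trans (ler_normB _ _) _; rewrite normrM mulrDl addrC lerD2l.
    apply: le_trans h _; apply: (@le_trans _ _ (`|K1| * s ^+ 2)).
      by rewrite ler_wpM2r ?sqr_ge0 // ler_norm.
    by rewrite ler_wpM2l // -real_normK ?num_real // expr2 ler_piMl // ltW.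
  have n1 := near_comp hK2 (@nbhs0_lt _ R _ r0).
  have n2 := near_comp hK2 (lip_near r0 lv v0).
  have n3 := near_comp hK2 (@nbhs0_lt _ R _ ltr01).
  apply: (@quad_is_derive _ _ _ _ (`|C1| * (`|D| + `|K1|) ^+ 2 / (`|v 0| / 2))).
  near=> s; rewrite mul0r subr0.
  have s1 : `|e s| < r by near: s.
  have /andP[s2 _] : `|v 0| / 2 <= `|v (e s)| <= 2 * `|v 0| by near: s.
  have s3 : `|e s| < 1 by near: s.
  have s4 : `|e s| <= (`|D| + `|K1|) * `|s| by near: s.
  have hF : F (mu + e s) (k + s) = 0 by rewrite /e subrKC F_eig.
  have := hb (mu + e s) k (k + s); rewrite hF subr0 bv // => eq.
  have := hC1 (e s) (ltW s3); rewrite -/mu eq normrM => h.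
  rewrite mulrAC ler_pdivlMr; last by lra.
  rewrite distrC mulrC.
  apply: (@le_trans _ _ (`|v (e s)| * `|f k - f (k + s)|)); first by rewrite ler_wpM2r.
  apply: le_trans h _; apply: (@le_trans _ _ (`|C1| * (e s) ^+ 2)).
    by rewrite ler_wpM2r ?sqr_ge0 // ler_norm.
  rewrite -mulrA ler_wpM2l // -[_ ^+ 2]real_normK ?num_real //.
  by rewrite -[s ^+ 2]real_normK ?num_real // -exprMn lerXn2r ?nnegrE.
have /near_radiusE[r [r0 hr]] := der.
(* The derivative is known off [k0] only, so constancy holds on one open side; letting [t] tend to
   0, the upper bound [C * t ^+ 2] contradicts the non-zero value there. *)
have cst t : 0 < t -> t < r / 2 -> ff t = ff (r / 2).
  move=> t0 tr.
  have hd x : x \in `[k0 + t, k0 + r / 2] -> is_derive x 1 f (cst 0 x).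
    rewrite in_itv /= => /andP[x1 x2]; have := hr (x - k0); rewrite subrKC; apply.
      by rewrite gtr0_norm; lra.
    by rewrite gt_eqF //; lra.
  have lt : k0 + t < k0 + r / 2 by lra.
  have [|z _] := MVT lt (fun x hx => hd x (subset_itv_oo_cc hx)).
    by apply: derivable_within_continuous => x hx; have [] := hd x hx.
  by rewrite /ff /= mul0r => /eqP; rewrite subr_eq0 => /eqP ->.
have /near_radiusE[s [s0 hs]] := f_quad.
have /near_radiusE[s' [s'0 hs']] := ff_neq0.
pose kap := `|ff (Num.min (r / 4) (s' / 2))|.
have m0 : 0 < Num.min (r / 4) (s' / 2) by rewrite lt_min; lra.
have kap0 : 0 < kap.
  rewrite normr_gt0 hs' ?gt_eqF // gtr0_norm // gt_min; apply/orP; right; lra.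
have kapE : kap = `|ff (r / 2)|.
  by rewrite /kap cst // gt_min; apply/orP; left; lra.
have C0 : 0 < `|C| + 1 by have := normr_ge0 C; lra.
pose t := Num.min (Num.min (r / 4) (s / 2)) (Num.min 1 (kap / 2 / (`|C| + 1))).
have t0 : 0 < t by rewrite !lt_min ltr01 !divr_gt0.
have t1 : t <= r / 4 by rewrite !ge_min lexx.
have t2 : t <= s / 2 by rewrite !ge_min lexx orbT.
have t3 : t <= 1 by rewrite !ge_min lexx !orbT.
have t4 : t <= kap / 2 / (`|C| + 1) by rewrite !ge_min lexx !orbT.
have /andP[_ h] := hs t ltac:(rewrite gtr0_norm; lra).
rewrite -/(ff t) cst -?kapE in h; [|lra|lra].
rewrite ler_pdivlMr // in t4.
have i1 : C * t ^+ 2 <= `|C| * t ^+ 2 by rewrite ler_wpM2r ?sqr_ge0 // ler_norm.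
have i2 : t ^+ 2 <= t by nra.
have i3 : `|C| * t ^+ 2 <= `|C| * t by rewrite ler_wpM2l.
lra.
Unshelve. all: by end_near. Qed.

(** Symmetry of the spectrum provides an index depending on k; countability of the list and
    analyticity make it constant. *)
Lemma reflected_band i : exists j, forall k, E j (2 * k0 - k) = E i k.
Proof.
have cov x : exists j, E j (2 * k0 - x) - E i x = 0.
  by have [j ej] := E_sym i x; exists j; rewrite ej subrr.
have [j hj] := analytic_countable_cover
  (fun j => analyticB (analytic_refl k0 (E_an j)) (E_an i)) cov.
by exists j => k; apply/eqP; rewrite -subr_eq0 hj.
Qed.

Lemma analytic_eq_near (g h : R -> R) x0 : real_analytic g -> real_analytic h ->
  (\forall t \near (0 : R), g (x0 + t) = h (x0 + t)) -> forall x, g x = h x.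
Proof.
move=> hg hh' e x; apply/eqP; rewrite -subr_eq0; apply/eqP; move: x.
apply: (analytic_identity (analyticB hg hh') (x0 := x0)).
by move: e; apply: filterS => t ->; rewrite subrr.
Qed.

Lemma hh_sign i : DD i != 0 -> \forall t \near (0 : R), t != 0 -> 0 < DD i * t * hh i t.
Proof.
move=> D0; have [K hK] := hh_expansion i.
have nD : 0 < `|DD i| by rewrite normr_gt0.
have K0 : 0 < `|K| + 1 by have := normr_ge0 K; lra.
have h1 : \forall t \near (0 : R), `|t| < `|DD i| / (`|K| + 1).
  by apply: nbhs0_lt; exact: divr_gt0.
near=> t => t0.
have ht : `|hh i t - DD i * t| <= K * t ^+ 2 by near: t.
have : `|t| < `|DD i| / (`|K| + 1) by near: t.
rewrite ltr_pdivlMr // => t1.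
set x := DD i * t in ht *.
have x0 : 0 < `|x| by rewrite normr_gt0 mulf_neq0.
have h2 : `|hh i t - x| < `|x|.
  apply: le_lt_trans ht _; rewrite /x normrM -real_normK ?num_real // expr2 mulrA.
  have nt : 0 < `|t| by rewrite normr_gt0.
  rewrite ltr_pM2r //; have := ler_norm K; nra.
have h3 : hh i t = x + (hh i t - x) by ring.
rewrite h3; move: h2; set y := hh i t - x => h2.
have : `|x * y| < `|x| ^+ 2 by rewrite normrM expr2 ltr_pM2l.
rewrite real_normK ?num_real // ltr_norml => /andP[h4 _].
rewrite mulrDr -expr2; lra.
Unshelve. all: by end_near. Qed.

(* with a vanishing derivative, [h = O(t^2)] and hence [h^2 = o(f k0 - f k)] *)
Lemma DD_neq0 i rho eta L : 0 < eta -> lip rho eta L -> rho 0 != 0 ->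
  (\forall t \near (0 : R), hh i t ^+ 2 * rho (hh i t) = - ff t) -> DD i != 0.
Proof.
move=> eta0 lrho rho0 rel; apply/eqP => D0.
have [K hK] := hh_expansion i; have [K' hK'] := hh_lip i.
have h1 := near_comp hK' (lip_near eta0 lrho rho0).
have nr : 0 < `|rho 0| by rewrite normr_gt0.
pose A := `|K| ^+ 2 * (2 * `|rho 0|) + 1.
have A0 : 0 < A by have := sqr_ge0 `|K|; rewrite /A; nra.
have h2 : \forall t \near (0 : R), `|t| < Num.min 1 (c / A).
  by apply: nbhs0_lt; rewrite lt_min ltr01 divr_gt0.
have : \forall t \near (0 : R), t != 0 -> False.
  near=> t => t0.
  have e : hh i t ^+ 2 * rho (hh i t) = - ff t by near: t.
  have /andP[t2 _] : c * t ^+ 2 <= `|ff t| <= C * t ^+ 2 by near: t; exact: f_quad.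
  have /andP[_ t3] : `|rho 0| / 2 <= `|rho (hh i t)| <= 2 * `|rho 0| by near: t.
  have t4 : `|hh i t - DD i * t| <= K * t ^+ 2 by near: t.
  have : `|t| < Num.min 1 (c / A) by near: t.
  rewrite lt_min => /andP[t5]; rewrite ltr_pdivlMr // => t6.
  rewrite D0 mul0r subr0 in t4.
  rewrite -normrN -e normrM normrX -real_normK ?num_real // in t2.
  have nt : 0 < `|t| by rewrite normr_gt0.
  have t7 : `|hh i t| ^+ 2 <= `|K| ^+ 2 * (`|t| ^+ 2) ^+ 2.
    rewrite -exprMn lerXn2r ?nnegrE //.
    apply: le_trans t4 _; rewrite real_normK ?num_real //.
    by rewrite ler_wpM2r ?sqr_ge0 // ler_norm.
  have t8 : `|hh i t| ^+ 2 * `|rho (hh i t)| <= `|K| ^+ 2 * (`|t| ^+ 2) ^+ 2 * (2 * `|rho 0|).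
    by apply: ler_pM.
  move: (le_trans t2 t8).
  have -> : `|K| ^+ 2 * (`|t| ^+ 2) ^+ 2 * (2 * `|rho 0|) = (A - 1) * `|t| ^+ 2 * `|t| ^+ 2.
    by rewrite /A; ring.
  rewrite ler_pM2r ?exprn_gt0 // => t9.
  have t10 : `|t| ^+ 2 <= `|t| by nra.
  have A1 : 0 <= A - 1 by rewrite /A addrK mulr_ge0 ?exprn_ge0 //; lra.
  have : (A - 1) * `|t| ^+ 2 <= (A - 1) * `|t| by rewrite ler_wpM2l.
  lra.
move=> /near_radiusE[r [r0 hr]]; apply: (hr (r / 2)); first exact: normr_half_lt.
by rewrite gt_eqF // divr_gt0.
Unshelve. all: by end_near. Qed.

(** Uniqueness at [k0] makes the band its own reflection, which kills the first derivative. The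
    second cannot vanish, because the band would then move too slowly to match [ff]. *)
Lemma simple_band i : ~ flat (E i) ->
  (forall j, j != i -> ~ flat (E j) -> E j k0 != E i k0) ->
  (forall k, E i k = E i (2 * k0 - k)) /\ derive1 (E i) k0 = 0 /\ derive1n 2 (E i) k0 != 0.
Proof.
move=> hi uniq.
have [j hj] := reflected_band i.
have k0E : 2 * k0 - k0 = k0 by ring.
(* The reflected entry takes the same value at [k0] and is non-flat along with [E i]. *)
have ji : j = i.
  apply/eqP; apply: boolp.contrapT => /negP ji.
  have hjf : ~ flat (E j).
    by move=> [x hx]; apply: hi; exists x => k; rewrite -hj hx.
  by have := uniq j ji hjf; rewrite -[X in _ != X]hj k0E eqxx.
rewrite {j}ji in hj.
have [e1 [e2 [r [B [r0 hexp _ -> ->]]]]] := analytic_expansion k0 (E_an i).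
have refl t : E i (k0 - t) = E i (k0 + t).
  by rewrite -hj; congr (E i _); ring.
split => [k|]; first by rewrite hj.
(* By reflection the expansions at [t] and [- t] have the same left side, and their difference gives
   [2 * e1 * t = O(t^3)]. *)
have e10 : e1 = 0.
  apply/eqP; rewrite -normr_le0 leNgt; apply/negP => e1n.
  have B0 : 0 < `|B| + 1 by have := normr_ge0 B; lra.
  pose t := Num.min (r / 2) (Num.min 1 (`|e1| / 2 / (`|B| + 1))).
  have t0 : 0 < t by rewrite !lt_min ltr01 !divr_gt0.
  have t1 : t <= r / 2 by rewrite !ge_min lexx.
  have t2 : t <= 1 by rewrite !ge_min lexx orbT.
  have t3 : t <= `|e1| / 2 / (`|B| + 1) by rewrite !ge_min lexx !orbT.
  rewrite ler_pdivlMr // in t3.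
  have := hexp t ltac:(rewrite gtr0_norm; lra); have := hexp (- t) ltac:(rewrite normrN gtr0_norm; lra).
  rewrite refl normrN (gtr0_norm t0) => h1 h2.
  have h3 : `|2 * e1 * t| <= 2 * (B * t ^+ 3).
    have -> : 2 * e1 * t = (E i (k0 + t) - E i k0 - e1 * - t - e2 * (- t) ^+ 2)
       - (E i (k0 + t) - E i k0 - e1 * t - e2 * t ^+ 2) by ring.
    by apply: le_trans (ler_normB _ _) _; lra.
  rewrite !normrM (gtr0_norm t0) ger0_norm // in h3.
  have i1 : B * t ^+ 3 <= (`|B| + 1) * t * t.
    have b1 := ler_norm B; have t33 : t ^+ 3 <= t ^+ 2 by rewrite ler_wiXn2l // ltW.
    have t30 : 0 <= t ^+ 3 by rewrite exprn_ge0 // ltW.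
    have : (`|B| + 1) * t ^+ 3 <= (`|B| + 1) * t ^+ 2 by rewrite ler_wpM2l // ltW.
    rewrite expr2; nra.
  nra.
split => //; apply/eqP => e20.
have {}e20 : e2 = 0 by lra.
(* With [e1 = e2 = 0] one has [hh = O(t^3)]; since [r' >= 1] the left side of the band relation is
   then too small for [|ff t| >= c * t ^+ 2]. *)
have [r' [rho [eta [L [rr eta0 rho0 lrho rel]]]]] := band_relation hi.
have {}rel := rel i hi erefl.
have [K hK] := hh_lip i.
have n1 := near_comp hK (lip_near eta0 lrho rho0).
have n2 := near_comp hK (@nbhs0_lt _ R _ ltr01).
have nr : 0 < `|rho 0| by rewrite normr_gt0.
have nE : 0 < `|E i k0| by rewrite normr_gt0.
have B0 := normr_ge0 B.
pose A := `|B| * (2 / `|E i k0| ^+ 2) * (2 * `|rho 0|) + 1.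
have A1 : 1 <= A by rewrite /A lerDr !mulr_ge0 ?invr_ge0 ?exprn_ge0 //; lra.
have n3 : \forall t \near (0 : R), `|t| < Num.min (Num.min r 1) (Num.min (`|E i k0| / 2 / (`|B| + 1)) (c / A)).
  by apply: nbhs0_lt; rewrite !lt_min r0 ltr01 !divr_gt0 //; lra.
have : \forall t \near (0 : R), t != 0 -> False.
  near=> t => t0.
  have e : hh i t ^+ r' * rho (hh i t) = - ff t by near: t.
  have /andP[t2 _] : c * t ^+ 2 <= `|ff t| <= C * t ^+ 2 by near: t; exact: f_quad.
  have /andP[_ t3] : `|rho 0| / 2 <= `|rho (hh i t)| <= 2 * `|rho 0| by near: t.
  have t4 : `|hh i t| < 1 by near: t.
  have : `|t| < Num.min (Num.min r 1) (Num.min (`|E i k0| / 2 / (`|B| + 1)) (c / A)) by near: t.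
  rewrite !lt_min => /andP[/andP[s1 s2] /andP[s3 s4]].
  rewrite ltr_pdivlMr in s3; last by lra.
  rewrite ltr_pdivlMr in s4; last by lra.
  have nt : 0 < `|t| by rewrite normr_gt0.
  have := hexp t s1; rewrite e10 e20 !mul0r !subr0 => h.
  have {}h : `|E i (k0 + t) - E i k0| <= `|B| * `|t| ^+ 3.
    by apply: le_trans h _; rewrite ler_wpM2r ?exprn_ge0 // ler_norm.
  have h' : `|B| * `|t| ^+ 3 <= `|B| * `|t|.
    by rewrite ler_wpM2l // exprS ler_piMr // exprn_ile1 // ltW.
  have En : `|E i k0| / 2 <= `|E i (k0 + t)|.
    have := ler_normD (E i (k0 + t)) (E i k0 - E i (k0 + t)); rewrite subrKC distrC; lra.
  have hb : `|hh i t| <= `|B| * (2 / `|E i k0| ^+ 2) * `|t| ^+ 3.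
    have -> : hh i t = - (E i (k0 + t) - E i k0) / (E i (k0 + t) * E i k0).
      by rewrite /hh; field; rewrite !E_neq0.
    rewrite normrM normrN normfV normrM ler_pdivrMr; last by rewrite mulr_gt0 // normr_gt0.
    apply: le_trans h _.
    have -> : `|B| * (2 / `|E i k0| ^+ 2) * `|t| ^+ 3 * (`|E i (k0 + t)| * `|E i k0|) =
       `|B| * `|t| ^+ 3 * (2 * `|E i (k0 + t)| / `|E i k0|) by field; rewrite gt_eqF.
    apply: ler_peMr; first by rewrite mulr_ge0 ?exprn_ge0.
    by rewrite ler_pdivlMr // mul1r; lra.
  rewrite -normrN -e normrM normrX -real_normK ?num_real // in t2.
  have hp : `|hh i t| ^+ r' <= `|hh i t|.
    by case: (r') rr => // n _; rewrite exprS ler_piMr // exprn_ile1 // ltW.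
  have : `|hh i t| ^+ r' * `|rho (hh i t)| <= `|B| * (2 / `|E i k0| ^+ 2) * `|t| ^+ 3 * (2 * `|rho 0|).
    by apply: ler_pM => //; apply: le_trans hp hb.
  move/(le_trans t2).
  have -> : `|B| * (2 / `|E i k0| ^+ 2) * `|t| ^+ 3 * (2 * `|rho 0|) = (A - 1) * `|t| * `|t| ^+ 2.
    by rewrite /A; ring.
  rewrite ler_pM2r ?exprn_gt0 // mulrBl mul1r [A * _]mulrC => t9.
  by move: s4 t9 nt; move: (`|t| * A) => X; lra.
move=> /near_radiusE[q [q0 hq]]; apply: (hq (q / 2)); first exact: normr_half_lt.
by rewrite gt_eqF // divr_gt0.
Unshelve. all: by end_near. Qed.

(** Both bands solve the same equation [h ^+ r * rho h = - ff]. Distinctness excludes [r = 1]; for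
    [r = 2] the solutions are the two square-root branches, told apart by sign, and evenness of [ff]
    exchanges them under reflection. *)
Lemma crossing_bands i j : i != j -> ~ flat (E i) -> ~ flat (E j) -> E i k0 = E j k0 ->
  (forall k, E j k = E i (2 * k0 - k)) /\
  derive1 (E i) k0 = - derive1 (E j) k0 /\ derive1 (E i) k0 != 0.
Proof.
move=> ij hi hj eij.
have [r [rho [eta [L [rr eta0 rho0 lrho rel]]]]] := band_relation hi.
have reli := rel i hi erefl; have relj := rel j hj (esym eij).
have [Ki hKi] := hh_lip i; have [Kj hKj] := hh_lip j.
have [s [s0 inj]] : exists s, 0 < s /\ forall h h', `|h| < s -> `|h'| < s ->
    (h * rho h = h' * rho h' -> h = h') /\
    (0 < h * h' -> h ^+ 2 * rho h = h' ^+ 2 * rho h' -> h = h').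
  have /near_radiusE[q [q0 hq]] := lip_mul_inj eta0 lrho rho0.
  exists (q / 2); split; first lra.
  by apply: hq; rewrite gtr0_norm; lra.
have ni := near_comp hKi (@nbhs0_lt _ R _ s0); have nj := near_comp hKj (@nbhs0_lt _ R _ s0).
have hhE t t' : hh i t = hh j t' -> E i (k0 + t) = E j (k0 + t').
  by rewrite /hh eij => /addIr /invr_inj.
have neq : ~ \forall t \near (0 : R), hh i t = hh j t.
  move=> e; apply: (bands_distinct ij hi).
  apply: (analytic_eq_near (x0 := k0) (E_an i) (E_an j)).
  by move: e; apply: filterS => t; exact: hhE.
(* For [r = 1] local injectivity would make the two bands agree near [k0], hence everywhere. *)
have r2 : r = 2%N.
  case: (r) rr reli relj => [|[|[|r']]] // _ reli relj; exfalso; apply: neq; near=> t.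
  have ti : `|hh i t| < s by near: t.
  have tj : `|hh j t| < s by near: t.
  have [] := inj _ _ ti tj.
  move=> h _; apply: h; rewrite -[X in X * _ = _]expr1 -[X in _ = X * _]expr1.
  have -> : hh i t ^+ 1 * rho (hh i t) = - ff t by near: t.
  by have -> : hh j t ^+ 1 * rho (hh j t) = - ff t by near: t.
rewrite r2 in reli relj.
have Di := DD_neq0 eta0 lrho rho0 reli; have Dj := DD_neq0 eta0 lrho rho0 relj.
have si := hh_sign Di; have sj := hh_sign Dj.
have dneq : derive1 (E i) k0 != 0.
  by apply: contraNneq Di => h; rewrite /DD h mul0r oppr0.
(* With slopes of the same sign, [hh i t] and [hh j t] would lie on the same branch and coincide. *)
have Dij : DD i * DD j < 0.
  rewrite lt_neqAle mulf_neq0 //= leNgt; apply/negP => Dp; apply: neq; near=> t.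
  have [->|t0] := eqVneq t 0; first by rewrite /hh addr0 !subrr.
  have ti : `|hh i t| < s by near: t.
  have tj : `|hh j t| < s by near: t.
  have [] := inj _ _ ti tj.
  move=> _; apply.
    have /(_ t0) p1 : t != 0 -> 0 < DD i * t * hh i t by near: t.
    have /(_ t0) p2 : t != 0 -> 0 < DD j * t * hh j t by near: t.
    have := mulr_gt0 p1 p2.
    have -> : DD i * t * hh i t * (DD j * t * hh j t) = DD i * DD j * t ^+ 2 * (hh i t * hh j t) by ring.
    by rewrite (@pmulr_rgt0 _ (DD i * DD j * t ^+ 2)) // pmulr_rgt0 // exprn_even_gt0.
  have -> : hh i t ^+ 2 * rho (hh i t) = - ff t by near: t.
  by have -> : hh j t ^+ 2 * rho (hh j t) = - ff t by near: t.
(* Since the slopes are opposite, [hh i (- t)] and [hh j t] have the same sign and, [ff] being even,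
   satisfy the same equation. *)
have refl : forall k, E j k = E i (2 * k0 - k).
  apply: (analytic_eq_near (x0 := k0) (E_an j) (analytic_refl k0 (E_an i))).
  have nreli := near_opp reli; have nni := near_opp ni; have nsi := near_opp si.
  near=> t.
  have [->|t0] := eqVneq t 0; first by rewrite addr0 -eij; congr (E i _); ring.
  rewrite (_ : 2 * k0 - (k0 + t) = k0 + - t); last by ring.
  symmetry; apply: hhE.
  have ti : `|hh i (- t)| < s by near: t.
  have tj : `|hh j t| < s by near: t.
  have [] := inj _ _ ti tj.
  move=> _; apply.
    have p1 : - t != 0 -> 0 < DD i * - t * hh i (- t) by near: t.
    rewrite oppr_eq0 in p1; have {}p1 := p1 t0.
    have /(_ t0) p2 : t != 0 -> 0 < DD j * t * hh j t by near: t.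
    have := mulr_gt0 p1 p2.
    have -> : DD i * - t * hh i (- t) * (DD j * t * hh j t)
      = - (DD i * DD j) * t ^+ 2 * (hh i (- t) * hh j t) by ring.
    by rewrite (@pmulr_rgt0 _ (- (DD i * DD j) * t ^+ 2)) // pmulr_rgt0 ?oppr_gt0 // exprn_even_gt0.
  have -> : hh i (- t) ^+ 2 * rho (hh i (- t)) = - ff (- t) by near: t.
  rewrite ff_even.
  by have -> : hh j t ^+ 2 * rho (hh j t) = - ff t by near: t.
split => //; split => //.
have [e1 [_ [_ [_ [_ _ di dE _]]]]] := analytic_expansion k0 (E_an i).
have hc : is_derive k0 1 (E i \o (fun k => 2 * k0 - k)) (e1 * -1).
  apply: is_derive1_comp; first by rewrite (_ : 2 * k0 - k0 = k0) //; ring.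
  by rewrite -[-1]sub0r; apply: is_deriveB.
have Ej : E j = E i \o (fun k => 2 * k0 - k) by apply/boolp.funext => k; rewrite refl.
have -> : derive1 (E j) k0 = e1 * -1 by rewrite Ej derive1E; apply: derive_val.
by rewrite dE mulrN1 opprK.
Unshelve. all: by end_near. Qed.

End BandCore.

(** * Integration over the half-line *)

Section HalfLine.
Variable R : realType.
Local Notation mu := (@lebesgue_measure R).
Implicit Types f F g : R -> R.

Lemma continuous_FTC2_cc f F (a b : R) : a < b ->
  (forall t, a <= t <= b -> is_derive t 1 F (f t)) ->
  (forall t, a <= t <= b -> {for t, continuous f}) ->
  (\int[mu]_(x in `[a, b]) (f x)%:E = (F b - F a)%:E)%E.
Proof.
move=> ab dF cf.
have cF t : a <= t <= b -> {for t, continuous F}.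
  move=> tab; apply: differentiable_continuous; apply/derivable1_diffP.
  by have [] := dF t tab.
rewrite (@continuous_FTC2 _ f F) ?EFinB //.
- apply: continuous_in_subspaceT => t /set_mem /=; rewrite in_itv /= => tab; exact: cf.
- split.
  + move=> t; rewrite in_itv /= => /andP[t1 t2].
    by have [] := dF t ltac:(by rewrite (ltW t1) (ltW t2)).
  + by apply: cvg_at_right_filter; apply: cF; rewrite lexx ltW.
  + by apply: cvg_at_left_filter; apply: cF; rewrite lexx ltW.
- move=> t; rewrite in_itv /= => /andP[t1 t2].
  rewrite derive1E; have tab : a <= t <= b by rewrite (ltW t1) (ltW t2).
  by have hd := dF t tab; apply: derive_val.
Qed.

(** Compact exhaustion of the open half-line; starting at [n.+2] keeps the end points distinct. *)
Let A (n : nat) : set R := `[n.+2%:R^-1, n.+2%:R]%classic.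
Let D : set R := `]0, +oo[%classic.

Lemma bigcup_exhaustion : \bigcup_n A n = D.
Proof.
apply/seteqP; split => t.
  move=> [n _]; rewrite /A /D /= !in_itv /= andbT => /andP[t1 _].
  by apply: lt_le_trans t1; rewrite invr_gt0.
rewrite /D /= in_itv /= andbT => t0.
exists (Num.truncn (t + t^-1)) => //; rewrite /A /= in_itv /=.
have ti : 0 < t^-1 by rewrite invr_gt0.
have h : t + t^-1 < (Num.truncn (t + t^-1)).+2%:R.
  apply: lt_trans (truncnS_gt _) _; by rewrite ltr_nat.
apply/andP; split; last lra.
by rewrite -[leRHS]invrK lef_pV2 ?posrE //; lra.
Qed.

Lemma exhaustion_sub n t : A n t -> 0 < t.
Proof.
move=> h; have : D t by (rewrite -bigcup_exhaustion; exists n).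
by rewrite /D /= in_itv /= andbT.
Qed.

Lemma exhaustion_nondecr : nondecreasing_seq A.
Proof.
move=> n m nm; rewrite subsetEset => t; rewrite /A /= !in_itv /= => /andP[t1 t2].
apply/andP; split.
  by apply: le_trans t1; rewrite lef_pV2 ?posrE // ler_nat.
by apply: le_trans t2 _; rewrite ler_nat.
Qed.

Lemma exhaustion_FTC f F n : (forall t : R, 0 < t -> is_derive t 1 F (f t)) ->
  (forall t : R, 0 < t -> {for t, continuous f}) ->
  (\int[mu]_(x in A n) (f x)%:E = (F n.+2%:R - F n.+2%:R^-1)%:E)%E.
Proof.
move=> dF cf.
have n0 : 0 < n.+2%:R^-1 :> R by rewrite invr_gt0.
apply: continuous_FTC2_cc.
- apply: (@lt_trans _ _ 1); first by rewrite invf_lt1 // ltr1n.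
  by rewrite ltr1n.
- by move=> t /andP[t1 _]; apply: dF; exact: lt_le_trans t1.
- by move=> t /andP[t1 _]; apply: cf; exact: lt_le_trans t1.
Qed.

Lemma measurable_halfline f : (forall t : R, 0 < t -> {for t, continuous f}) -> measurable_fun D f.
Proof.
move=> cf; apply: open_continuous_measurable_fun; first exact: interval_open.
by move=> t /set_mem; rewrite /D /= in_itv /= andbT; exact: cf.
Qed.

Lemma integrable_primitive f F M : (forall t : R, 0 < t -> is_derive t 1 F (f t)) ->
  (forall t : R, 0 < t -> {for t, continuous f}) -> (forall t : R, 0 < t -> 0 <= f t) ->
  (forall n, F n.+2%:R - F n.+2%:R^-1 <= M) ->
  mu.-integrable D (EFin \o f).
Proof.
move=> dF cf f0 hM.
have mf : measurable_fun D (EFin \o f).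
  by apply/measurable_EFinP; exact: measurable_halfline.
apply/integrableP; split => //.
have h : (\int[mu]_(x in A i) (EFin \o f) x @[i --> \oo] --> \int[mu]_(x in D) (EFin \o f) x)%E.
  rewrite -bigcup_exhaustion; apply: ge0_nondecreasing_set_cvg_integral.
  - exact: exhaustion_nondecr.
  - by move=> n; exact: measurable_itv.
  - move=> n; apply: measurable_funS mf => //; first exact: measurable_itv.
    by rewrite -bigcup_exhaustion; exact: bigcup_sup.
  - by move=> n t /exhaustion_sub t0; rewrite /= lee_fin f0.
have -> : (\int[mu]_(x in D) `|(EFin \o f) x| = \int[mu]_(x in D) (EFin \o f) x)%E.
  apply: eq_integral => t /set_mem; rewrite /D /= in_itv /= andbT => t0.
  by rewrite ger0_norm ?f0.
apply: (@le_lt_trans _ _ M%:E); last by rewrite ltry.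
apply: (cvge_to_le h); near=> n.
by rewrite exhaustion_FTC // lee_fin hM.
Unshelve. all: by end_near. Qed.

Lemma integrable_dominated f g K : (forall t : R, 0 < t -> {for t, continuous f}) ->
  (forall t : R, 0 < t -> `|f t| <= K * g t) ->
  mu.-integrable D (EFin \o g) -> mu.-integrable D (EFin \o f).
Proof.
move=> cf fg ig.
have igK : mu.-integrable D (fun t => K%:E * (EFin \o g) t)%E.
  by apply: integrableZl => //; exact: measurable_itv.
apply: le_integrable igK => //; first exact: measurable_itv.
  by apply/measurable_EFinP; exact: measurable_halfline.
move=> t; rewrite /D /= in_itv /= andbT => t0.
by rewrite lee_fin; apply: le_trans (fg t t0) (ler_norm _).
Qed.

Lemma Rintegral_halfline f F l : mu.-integrable D (EFin \o f) ->
  (forall t : R, 0 < t -> is_derive t 1 F (f t)) ->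
  (forall t : R, 0 < t -> {for t, continuous f}) ->
  (fun n => F n.+2%:R - F n.+2%:R^-1) @ \oo --> l ->
  \int[mu]_(x in D) f x = l.
Proof.
move=> intf dF cf hl.
have mD : measurable D by exact: measurable_itv.
have mA n : measurable (A n) by exact: measurable_itv.
have mf : measurable_fun D (EFin \o f).
  by apply/measurable_EFinP; exact: measurable_halfline.
pose f_ n := (EFin \o f) \_ (A n).
have AD n : A n `<=` D by rewrite -bigcup_exhaustion; exact: bigcup_sup.
have [] := @dominated_convergence _ _ R mu D mD f_ (EFin \o f) (fun t => `|(EFin \o f) t|)%E.
- move=> n; rewrite /f_; apply/(measurable_restrict (EFin \o f) (mA n) mD).
  by apply: measurable_funS mf => //; exact: subIsetr.
- exact: mf.
- apply: aeW => t Dt; apply: cvg_near_cst.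
  have : (\bigcup_n A n) t by rewrite bigcup_exhaustion.
  move=> [n _ An]; near=> m; rewrite /f_ patchE.
  have -> // : t \in A m.
  apply/mem_set; have := @exhaustion_nondecr n m; rewrite subsetEset; apply => //.
  by near: m; exists n.
- exact: integrable_abse.
- apply: aeW => t n Dt; rewrite /f_ patchE; case: ifP => // _.
  by rewrite abse0 abse_ge0.
move=> _ _ h.
have h2 : (fun n => (F n.+2%:R - F n.+2%:R^-1)%:E) @ \oo --> (\int[mu]_(x in D) (EFin \o f) x)%E.
  apply: cvg_trans h; apply: near_eq_cvg; near=> n.
  rewrite /f_ /=; rewrite -(integral_mkcondr _ _) ?setIidr //.
  by rewrite -(exhaustion_FTC n dF cf).
rewrite /Rintegral.
have h3 : (fun n => (F n.+2%:R - F n.+2%:R^-1)%:E) @ \oo --> l%:E by apply: cvg_EFin hl; near=> n.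
by rewrite (cvg_unique _ h2 h3).
Unshelve. all: by end_near. Qed.

End HalfLine.

(** * The Gamma integrals *)

Section Gamma.
Variable R : realType.
Local Notation mu := (@lebesgue_measure R).
Let D : set R := `]0, +oo[%classic.

(** The Gamma integrand [t^(s-1) e^(-t)] for [t > 0], as a single exponential so that comparisons
    become inequalities between exponents. *)
Definition gker (s t : R) : R := expR ((s - 1) * ln t - t).

Lemma gkerS (s t : R) : 0 < t -> gker (s + 1) t = t * gker s t.
Proof.
move=> t0; rewrite /gker; have {3}-> : t = expR (ln t) by rewrite lnK.
by rewrite -expRD; congr expR; ring.
Qed.

Lemma is_derive_expR_comp (f : R -> R) (x df : R) : is_derive x 1 f df ->
  is_derive x 1 (fun t => expR (f t)) (expR (f x) * df).
Proof. by move=> h; apply: (is_derive1_comp (f := expR)). Qed.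

Lemma is_derive_gker_exp (s t : R) : 0 < t ->
  is_derive t 1 (fun t : R => s * ln t - t) (s * t^-1 - 1).
Proof.
move=> t0; have := is_derive1_ln t0 => hl.
apply: is_deriveB; exact: is_deriveZ.
Qed.

Lemma continuous_of_derive (f : R -> R) (t df : R) : is_derive t 1 f df -> {for t, continuous f}.
Proof.
by move=> [h _]; apply: differentiable_continuous; apply/derivable1_diffP.
Qed.

Lemma continuous_gker (s t : R) : 0 < t -> {for t, continuous (gker s)}.
Proof.
move=> t0; exact: (continuous_of_derive (is_derive_expR_comp (is_derive_gker_exp (s - 1) t0))).
Qed.

(* [ln t <= ln c + t / c - 1] *)
Lemma ln_le_affine (a t : R) : 0 <= a -> 0 < t -> a * ln t <= a * ln (2 * a + 1) + t / 2.
Proof.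
move=> a0 t0; set c := 2 * a + 1.
have c0 : 0 < c by rewrite /c; lra.
have h : ln t <= ln c + t / c.
  have tc : 0 < t / c by rewrite divr_gt0.
  have -> : ln t = ln c + ln (t / c) by rewrite -lnM ?posrE // mulrC divfK // gt_eqF.
  rewrite lerD2l; apply: le_trans (ltW (ln_sublinear tc)) _ => //.
apply: le_trans (ler_wpM2l a0 h) _; rewrite mulrDr lerD2l.
rewrite mulrA mulrAC (mulrC t); apply: ler_wpM2r; first exact: ltW.
by rewrite ler_pdivrMr // /c; lra.
Qed.

(** The integrand is dominated, near 0 and at infinity at once, by a multiple of the derivative of
    [- exp (- sqrt t)]: half of [- t] absorbs the logarithm, the other half gives [- sqrt t] through
    [2 sqrt t <= 1 + t]. *)
Lemma integrable_gker (s : R) : 2^-1 <= s -> mu.-integrable D (EFin \o gker s).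
Proof.
move=> s2.
pose r (t : R) := expR (2^-1 * ln t).
have dr (t : R) : 0 < t -> is_derive t 1 r (r t * (2^-1 * t^-1)).
  by move=> t0; apply: is_derive_expR_comp; apply: is_deriveZ; exact: is_derive1_ln.
have rt (t : R) : 0 < t -> r t * t^-1 = expR (- (2^-1 * ln t)).
  move=> t0; rewrite /r; have {2}-> : t = expR (ln t) by rewrite lnK.
  by rewrite -expRN -expRD; congr expR; lra.
have r0 t : 0 < r t by exact: expR_gt0.
have rr (t : R) : 0 < t -> r t ^+ 2 = t.
  move=> t0; rewrite expr2 /r -expRD -[RHS](lnK t0); congr expR; lra.
clearbody r.
pose g (t : R) := 2^-1 * expR (- (2^-1 * ln t) - r t).
pose G (t : R) := - expR (- r t).
have dG (t : R) : 0 < t -> is_derive t 1 G (g t).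
  move=> t0; have := dr t t0 => hr.
  have -> : g t = - (expR (- r t) * - (r t * (2^-1 * t^-1))).
    rewrite /g expRD -(rt t t0).
    set e := expR _; set w := r t; set v := t^-1; ring.
  by apply: is_deriveN; apply: is_derive_expR_comp; exact: is_deriveN.
have cg (t : R) : 0 < t -> {for t, continuous g}.
  move=> t0; have hr := dr t t0; have hl := is_derive1_ln t0.
  have h1 : is_derive t 1 (fun t : R => - (2^-1 * ln t) - r t) (- (2^-1 * t^-1) - r t * (2^-1 * t^-1)).
    by apply: is_deriveB; apply: is_deriveN; exact: is_deriveZ.
  exact: (continuous_of_derive (is_deriveZ 2^-1 (is_derive_expR_comp h1))).
have ig : mu.-integrable D (EFin \o g).
  apply: (@integrable_primitive _ g G 1) => //.
    by move=> t t0; rewrite /g mulr_ge0 ?expR_ge0.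
  move=> n; rewrite /G opprK.
  have := expR_gt0 (- r n.+2%:R) => h1.
  have : expR (- r n.+2%:R^-1) <= 1 by rewrite -expR0 ler_expR oppr_le0 ltW.
  lra.
pose c := (s - 2^-1) * ln (2 * (s - 2^-1) + 1) + 2^-1.
apply: (@integrable_dominated _ _ g (2 * expR c) _ _ ig); first by move=> t; exact: continuous_gker.
move=> t t0; rewrite ger0_norm ?expR_ge0 // /g /gker mulrACA mulfV // mul1r -expRD ler_expR.
have a0 : 0 <= s - 2^-1 by lra.
have := ln_le_affine a0 t0; rewrite -/c => h.
have : 0 <= (r t - 1) ^+ 2 by exact: sqr_ge0.
rewrite sqrrB rr // mulr1 expr1n /c => h2.
lra.
Qed.

Let mD : measurable D. Proof. exact: measurable_itv. Qed.

Lemma integrable_scale (A : set R) (f : R -> R) (k : R) : measurable A ->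
  mu.-integrable A (EFin \o f) -> mu.-integrable A (EFin \o (fun t => k * f t)).
Proof.
move=> mA i; rewrite (_ : EFin \o _ = fun t => (k%:E * (EFin \o f) t)%E); first exact: integrableZl.
by apply/funext => t /=; rewrite EFinM.
Qed.

Lemma integrable_add (A : set R) (f g : R -> R) : measurable A ->
  mu.-integrable A (EFin \o f) -> mu.-integrable A (EFin \o g) ->
  mu.-integrable A (EFin \o (fun t => f t + g t)).
Proof.
move=> mA i j; rewrite (_ : EFin \o _ = (EFin \o f) \+ (EFin \o g))%E; first exact: integrableD.
by apply/funext => t /=; rewrite EFinD.
Qed.

Lemma integrable_sub (A : set R) (f g : R -> R) : measurable A ->
  mu.-integrable A (EFin \o f) -> mu.-integrable A (EFin \o g) ->
  mu.-integrable A (EFin \o (fun t => f t - g t)).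
Proof.
move=> mA i j; rewrite (_ : EFin \o _ = (EFin \o f) \- (EFin \o g))%E; first exact: integrableB.
by apply/funext => t /=; rewrite EFinB.
Qed.

Definition gam (c : R -> R) (s y : R) : R := \int[mu]_(t in D) (gker s t * c (y * ln t)).

Let DP (t : R) : D t -> 0 < t.
Proof. by rewrite /D /= in_itv /= andbT. Qed.

Lemma continuous_gam (c : R -> R) (s y t : R) : continuous c -> 0 < t ->
  {for t, continuous (fun t : R => gker s t * c (y * ln t))}.
Proof.
move=> cc t0; apply: continuousM; first exact: continuous_gker.
apply: (@continuous_comp _ _ _ (fun t : R => y * ln t) c); last exact: cc.
have hl := is_derive1_ln t0; exact: (continuous_of_derive (is_deriveZ y hl)).
Qed.

Lemma integrable_gam (c : R -> R) (s y : R) : 2^-1 <= s -> continuous c ->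
  (forall x, `|c x| <= 1) -> mu.-integrable D (EFin \o (fun t : R => gker s t * c (y * ln t))).
Proof.
move=> s2 cc c1; apply: (@integrable_dominated _ _ (gker s) 1); last exact: integrable_gker.
  by move=> t; exact: continuous_gam.
move=> t t0; rewrite mul1r normrM ger0_norm ?expR_ge0 //.
by rewrite ler_piMr ?expR_ge0.
Qed.

Lemma gker_ge (s : R) (m : R) : 0 <= s -> 0 < m ->
  gker (s + 1) m <= expR (s * ln (2 * s + 1)) * 2 / m.
Proof.
move=> s0 m0; rewrite /gker addrK.
apply: (@le_trans _ _ (expR (s * ln (2 * s + 1)) * expR (- (m / 2)))).
  by rewrite -expRD ler_expR; have := ln_le_affine s0 m0; lra.
rewrite -mulrA; apply: ler_wpM2l; first exact: expR_ge0.
rewrite expRN -[leRHS]invrK lef_pV2 ?posrE ?expR_gt0 ?invr_gt0 ?divr_gt0 //.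
rewrite invf_div; apply: le_trans (expR_ge1Dx _); lra.
Qed.

Lemma gker_le (s : R) (m : R) : 2^-1 <= s -> 1 <= m -> gker (s + 1) m^-1 <= Num.sqrt m^-1.
Proof.
move=> s2 m1; have m0 : 0 < m by lra.
have l0 : 0 <= ln m by exact: ln_ge0.
have i0 : 0 < m^-1 by rewrite invr_gt0.
rewrite -(@ler_pXn2r _ 2) ?nnegrE ?expR_ge0 ?sqrtr_ge0 // sqr_sqrtr ?(ltW i0) //.
rewrite -[leRHS](lnK i0) /gker addrK expr2 -expRD ler_expR lnV ?posrE //.
have : 2^-1 * ln m <= s * ln m by exact: ler_wpM2r.
lra.
Qed.

(** The functional equation [Gamma (z + 1) = z Gamma z] for [z = s + i y], read on real and
    imaginary parts: the primitive [t^s e^(-t) c (y ln t)] tends to 0 at both ends. *)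
Lemma gam_ibp (c c' : R -> R) (s y : R) : 2^-1 <= s ->
  (forall x : R, is_derive x 1 c (c' x)) -> continuous c' ->
  (forall x, `|c x| <= 1) -> (forall x, `|c' x| <= 1) ->
  gam c (s + 1) y = s * gam c s y + y * gam c' s y.
Proof.
move=> s2 dc cc' c1 c'1.
have s0 : 0 <= s by lra.
have cc : continuous c by move=> x; exact: (continuous_of_derive (dc x)).
have i1 := integrable_gam y s2 cc c1.
have i2 := integrable_gam y s2 cc' c'1.
have s3 : 2^-1 <= s + 1 by lra.
have i3 := integrable_gam y s3 cc c1.
pose f1 (t : R) := s * (gker s t * c (y * ln t)).
pose f2 (t : R) := y * (gker s t * c' (y * ln t)).
pose f3 (t : R) := gker (s + 1) t * c (y * ln t).
have j1 : mu.-integrable D (EFin \o f1) by exact: integrable_scale.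
have j2 : mu.-integrable D (EFin \o f2) by exact: integrable_scale.
have j12 : mu.-integrable D (EFin \o (fun t => f1 t + f2 t)) by exact: integrable_add.
have j : mu.-integrable D (EFin \o (fun t => f1 t + f2 t - f3 t)) by exact: integrable_sub.
pose F (t : R) := gker (s + 1) t * c (y * ln t).
apply/eqP; rewrite eq_sym -subr_eq0; apply/eqP.
rewrite /gam -RintegralZl // -RintegralZl // -RintegralD // -RintegralB //.
apply: (@Rintegral_halfline _ (fun t => f1 t + f2 t - f3 t) F).
- exact: j.
- move=> t t0; have hl := is_derive1_ln t0.
  have d1 : is_derive t 1 (gker (s + 1)) (gker (s + 1) t * ((s + 1 - 1) * t^-1 - 1)).
    by apply: is_derive_expR_comp; exact: is_derive_gker_exp.
  have d2 : is_derive t 1 (fun t : R => c (y * ln t)) (c' (y * ln t) * (y * t^-1)).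
    exact: (@is_derive1_comp _ c (fun t : R => y * ln t) _ _ _ (dc _) (is_deriveZ y hl)).
  apply: is_derive_eq.
  rewrite /GRing.scale /= /f1 /f2 /f3 gkerS //.
  set g := gker s t; set u := c _; set v := c' _.
  have t1 : t != 0 by rewrite gt_eqF.
  by field.
- move=> t t0; apply: continuousB; first apply: continuousD.
  + apply: continuousM; [exact: cst_continuous|exact: continuous_gam].
  + apply: continuousM; [exact: cst_continuous|exact: continuous_gam].
  + exact: continuous_gam.
- set K := expR (s * ln (2 * s + 1)) * 2.
  have hK : K * (2 * (n.+1%:R^-1)) + Num.sqrt n.+1%:R^-1 @[n --> \oo] --> (0:R).
    rewrite -[X in _ --> X]addr0; apply: cvgD.
      rewrite -[X in _ --> X](mulr0 K); apply: cvgMr.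
      rewrite -[X in _ --> X](mulr0 2); apply: cvgMr; exact: cvg_harmonic.
    rewrite -[X in _ --> X](@sqrtr0 R); apply: continuous_cvg; first exact: sqrt_continuous.
    exact: cvg_harmonic.
  have hF (t : R) : `|F t| <= gker (s + 1) t.
    by rewrite normrM ger0_norm ?expR_ge0 // ler_piMr ?expR_ge0.
  have h : `|F n.+2%:R - F n.+2%:R^-1| @[n --> \oo] --> (0 : R); last by apply: norm_cvg0; exact: h.
  apply: squeeze_cvgr (cvg_cst 0) hK; apply: nearW => n; apply/andP; split => //.
  apply: le_trans (ler_normB _ _) _; apply: lerD.
    apply: le_trans (hF _) _; apply: le_trans (gker_ge s0 _) _ => //.
    rewrite -/K; apply: ler_wpM2l; first by rewrite mulr_ge0 ?expR_ge0.
    apply: (@le_trans _ _ n.+1%:R^-1); first by rewrite lef_pV2 ?posrE // ler_nat.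
    by rewrite ler_peMl ?invr_ge0 // ler1n.
  apply: le_trans (hF _) _; apply: le_trans (gker_le s2 _) _; first by rewrite ler1n.
  by apply: ler_wsqrtr; rewrite lef_pV2 ?posrE // ler_nat.
Qed.

End Gamma.

(** * The modulus of the Gamma function *)

Section GammaModulus.
Variable R : realType.
Local Notation mu := (@lebesgue_measure R).
Local Notation D := (`]0%R, +oo[%classic : set R).

Lemma le_of_derive_ge0 (f df : R -> R) (a b : R) : a <= b ->
  (forall x : R, is_derive x 1 f (df x)) -> (forall x, a <= x <= b -> 0 <= df x) -> f a <= f b.
Proof.
move=> ab hd h0.
have [|c] := MVT_segment ab (fun x _ => hd x).
  apply: continuous_subspaceT => x; exact: (continuous_of_derive (hd x)).
rewrite in_itv /= => hc h; rewrite -subr_ge0 h mulr_ge0 ?h0 //; lra.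
Qed.

Lemma sin_le_id (x : R) : 0 <= x -> sin x <= x.
Proof.
move=> x0; have := @le_of_derive_ge0 (fun x => x - sin x) (fun x => 1 - cos x) _ _ x0.
rewrite sin0 subrr subr_ge0; apply => t.
by move=> _; rewrite subr_ge0 cos_le1.
Qed.

Lemma normr_sin_le (x : R) : `|sin x| <= `|x|.
Proof.
wlog x0 : x / 0 <= x.
  move=> h; case: (lerP 0 x) => x0; first exact: h.
  by have := h (- x); rewrite sinN !normrN; apply; lra.
rewrite (ger0_norm x0) ler_norml sin_le_id // andbT.
have := @le_of_derive_ge0 (fun x => x + sin x) (fun x => 1 + cos x) _ _ x0.
rewrite sin0 addr0 => h; suff : 0 <= x + sin x by lra.
apply: h => t _; have := cos_geN1 t; lra.
Qed.

Lemma cos_ge_quadratic (x : R) : 1 - x ^+ 2 / 2 <= cos x.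
Proof.
have -> : x = (x / 2) *+ 2 by rewrite mulr2n; lra.
rewrite cos_mulr2n; have := cos2Dsin2 (x / 2).
have : sin (x / 2) ^+ 2 <= (x / 2) ^+ 2.
  by rewrite -ler_sqrt ?sqr_ge0 // !sqrtr_sqr normr_sin_le.
move: (cos _) (sin _) => c d; rewrite -[x in x - 1]mulr_natr -[x / 2 *+ 2]mulr_natr; lra.
Qed.

(* the right-hand side is [4 (e^(w/2) - e^(-w/2))^2] *)
Lemma sqr_le_expR (w : R) : w ^+ 2 <= 4 * (expR w - 2 + expR (- w)).
Proof.
have ew : expR w = expR (w / 2) ^+ 2 by rewrite expr2 -expRD; congr expR; lra.
have ewN : expR (- w) = expR (- (w / 2)) ^+ 2 by rewrite expr2 -expRD; congr expR; lra.
have e1 : expR (w / 2) * expR (- (w / 2)) = 1 by rewrite -expRD subrr expR0.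
suff : (w / 2) ^+ 2 <= (expR (w / 2) - expR (- (w / 2))) ^+ 2.
  rewrite sqrrB e1 -ew -ewN; lra.
move: (w / 2) => {w ew ewN e1} u.
wlog u0 : u / 0 <= u.
  move=> h; case: (lerP 0 u) => u0; first exact: h.
  have := h (- u); rewrite sqrrN opprK -opprB sqrrN; apply; lra.
rewrite ler_pXn2r ?nnegrE //.
  have := expR_ge1Dx u; have : expR (- u) <= 1 by rewrite -expR0 ler_expR; lra.
  lra.
by rewrite subr_ge0 ler_expR; lra.
Qed.

Local Notation gC := (gam (@cos R)).
Local Notation gS := (gam (@sin R)).

Lemma normr_cos_le1 (x : R) : `|cos x| <= 1.
Proof. by rewrite ler_norml cos_geN1 cos_le1. Qed.

Lemma normr_sin_le1 (x : R) : `|sin x| <= 1.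
Proof. by rewrite ler_norml sin_geN1 sin_le1. Qed.

Let mD : measurable D. Proof. exact: measurable_itv. Qed.

Let DP (t : R) : D t -> 0 < t.
Proof. by rewrite /= in_itv /= andbT. Qed.

Lemma gcosS (s y : R) : 2^-1 <= s -> gC (s + 1) y = s * gC s y - y * gS s y.
Proof.
move=> s2; rewrite (@gam_ibp _ _ (fun x => - sin x)) //; first last.
- by move=> x; rewrite normrN normr_sin_le1.
- exact: normr_cos_le1.
- by move=> x; apply: continuousN; exact: continuous_sin.
congr (_ + _); rewrite -mulrN; congr (_ * _).
rewrite -[RHS]mulN1r /gam -RintegralZl //.
  by apply: eq_Rintegral => t _; rewrite mulN1r mulrN.
by apply: integrable_gam => //; [exact: continuous_sin|exact: normr_sin_le1].
Qed.

Lemma gsinS (s y : R) : 2^-1 <= s -> gS (s + 1) y = s * gS s y + y * gC s y.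
Proof.
move=> s2; apply: gam_ibp => //; first exact: continuous_cos.
  exact: normr_sin_le1.
exact: normr_cos_le1.
Qed.

(* [|Gamma (s + i y)|^2] *)
Definition gnorm2 (s y : R) : R := gC s y ^+ 2 + gS s y ^+ 2.

Lemma gnorm2S (s y : R) : 2^-1 <= s -> gnorm2 (s + 1) y = (s ^+ 2 + y ^+ 2) * gnorm2 s y.
Proof. by move=> s2; rewrite /gnorm2 gcosS // gsinS //; ring. Qed.

(* [Gamma s] *)
Definition g0 (s : R) : R := gC s 0.

Lemma g0S (s : R) : 2^-1 <= s -> g0 (s + 1) = s * g0 s.
Proof. by move=> s2; rewrite /g0 gcosS // mul0r subr0. Qed.

Lemma g0E (s : R) : g0 s = \int[mu]_(t in D) gker s t.
Proof. by apply: eq_Rintegral => t _; rewrite mul0r cos0 mulr1. Qed.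

Lemma g0_1 : g0 1 = 1.
Proof.
rewrite g0E; apply: (@Rintegral_halfline _ (gker 1) (fun t => - expR (- t)) 1).
- by apply: integrable_gker; lra.
- move=> t t0; rewrite /gker subrr mul0r add0r.
  have -> : expR (- t) = - (expR (- t) * (- 1)) by lra.
  by apply: is_deriveN; apply: is_derive_expR_comp.
- by move=> t t0; apply: continuous_gker.
- have h1 : (fun n : nat => (n.+2%:R^-1 : R)) @ \oo --> (0 : R).
    have := @cvg_harmonic R; rewrite -(cvg_shiftS) /=; exact.
  have h2 : (fun n : nat => expR (- (n.+2%:R^-1 : R))) @ \oo --> (1 : R).
    rewrite -[X in _ --> X](@expR0 R) -[X in expR X]oppr0.
    apply: continuous_cvg; first exact: continuous_expR.
    exact: cvgN.
  have h3 : (fun n : nat => expR (- (n.+2%:R : R))) @ \oo --> (0 : R).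
    apply: squeeze_cvgr (cvg_cst 0) h1; apply: nearW => n; rewrite expR_ge0 /=.
    rewrite expRN lef_pV2 ?posrE ?expR_gt0 //; apply: le_trans (expR_ge1Dx _); lra.
  have := cvgD (cvgN h3) h2; rewrite oppr0 add0r => h4.
  have h5 : (fun n : nat => - expR (- n.+2%:R) - - expR (- n.+2%:R^-1)) @ \oo --> (1 : R).
    under eq_fun do rewrite opprK.
    exact: h4.
  exact: h5.
Qed.

(** Integrating the tangent bound [t^(-1/2) >= 3/2 - t/2] against [e^(-t)] gives at least
    [3/2 - 1/2]. *)
Lemma g0_half_gt0 : 0 < g0 2^-1.
Proof.
have g2 : g0 2 = 1 by have := @g0S 1; rewrite g0_1 mulr1; apply; lra.
have i1 : mu.-integrable D (EFin \o gker (1 : R)) by apply: integrable_gker; lra.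
have i2 : mu.-integrable D (EFin \o gker (2 : R)) by apply: integrable_gker; lra.
have ih : mu.-integrable D (EFin \o gker (2^-1 : R)) by apply: integrable_gker; lra.
have j1 := integrable_scale (3 / 2) mD i1.
have j2 := integrable_scale (1 / 2) mD i2.
have : \int[mu]_(t in D) (3 / 2 * gker 1 t - 1 / 2 * gker 2 t) <= g0 2^-1.
  rewrite g0E; apply: le_Rintegral => //; first exact: integrable_sub.
  move=> t /DP t0.
  have l1 : ln t <= t - 1.
    have := @le_ln1Dx R (t - 1); rewrite subrKC; apply; lra.
  have -> : gker 2 t = t * gker 1 t by rewrite -gkerS //; congr gker; lra.
  have -> : gker 2^-1 t = expR (- (2^-1 * ln t)) * gker 1 t.
    by rewrite /gker -expRD; congr expR; lra.
  rewrite mulrA -mulrBl; apply: ler_wpM2r; first exact: expR_ge0.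
  by apply: le_trans (expR_ge1Dx _); lra.
rewrite RintegralB // RintegralZl // RintegralZl // -!g0E g0_1 g2; lra.
Qed.

Lemma g0_gt0 (n : nat) : 0 < g0 ((n.+1)%:R / 2).
Proof.
suff h m : 0 < g0 (m.+1%:R / 2) /\ 0 < g0 (m.+2%:R / 2) by have [] := h n.
elim: m => [|m [h1 h2]].
  by rewrite mul1r g0_half_gt0 divff // g0_1.
split; first exact: h2.
have -> : m.+3%:R / 2 = m.+1%:R / 2 + 1 :> R by rewrite -addn2 natrD; lra.
have h : 2^-1 <= m.+1%:R / 2 :> R.
  have : 1 <= m.+1%:R :> R by rewrite ler1n.
  lra.
rewrite (g0S h); apply: mulr_gt0 h1; lra.
Qed.

Lemma gam_rot (s y a b : R) : 2^-1 <= s ->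
  a * gC s y + b * gS s y = \int[mu]_(t in D) (gker s t * (a * cos (y * ln t) + b * sin (y * ln t))).
Proof.
move=> s2.
have i1 := integrable_gam y s2 (@continuous_cos R) normr_cos_le1.
have i2 := integrable_gam y s2 (@continuous_sin R) normr_sin_le1.
rewrite /gam -RintegralZl // -RintegralZl // -RintegralD //; try exact: integrable_scale.
by apply: eq_Rintegral => t _; ring.
Qed.

Lemma integrable_gam_rot (s y a b : R) : 2^-1 <= s ->
  mu.-integrable D (EFin \o (fun t => gker s t * (a * cos (y * ln t) + b * sin (y * ln t)))).
Proof.
move=> s2.
have i1 := integrable_gam y s2 (@continuous_cos R) normr_cos_le1.
have i2 := integrable_gam y s2 (@continuous_sin R) normr_sin_le1.
have := integrable_add mD (integrable_scale a mD i1) (integrable_scale b mD i2).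
by congr (mu.-integrable D _); apply/funext => t /=; congr EFin; ring.
Qed.

(** The integral is rotated by its own phase and the integrand bounded by its modulus. *)
Lemma gnorm2_le (s y : R) : 2^-1 <= s -> gnorm2 s y <= g0 s ^+ 2.
Proof.
move=> s2; set N := gnorm2 s y.
have N0 : 0 <= N by rewrite addr_ge0 ?sqr_ge0.
have sN : Num.sqrt N ^+ 2 = N by rewrite sqr_sqrtr.
have i0 := integrable_gker s2.
have h : N <= Num.sqrt N * g0 s.
  rewrite {1}/N /gnorm2 !expr2 gam_rot // g0E -RintegralZl //.
  apply: le_Rintegral => //; [exact: integrable_gam_rot|exact: integrable_scale|].
  move=> t _; rewrite mulrC; apply: ler_wpM2r; first exact: expR_ge0.
  apply: le_trans (ler_norm _) _; rewrite -sqrtr_sqr; apply: ler_wsqrtr.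
  rewrite /N /gnorm2; have := cos2Dsin2 (y * ln t).
  set c := cos _; set d := sin _; set a := gC s y; set b := gS s y => e.
  have -> : a ^+ 2 + b ^+ 2 = (a * c + b * d) ^+ 2 + (a * d - b * c) ^+ 2.
    by rewrite -[LHS]mulr1 -e; ring.
  by rewrite lerDl sqr_ge0.
have g00 : 0 <= g0 s by rewrite g0E; apply: Rintegral_ge0 => t _; exact: expR_ge0.
have [|Np] := leP N 0; first by move=> h1; apply: le_trans h1 (sqr_ge0 _).
have sp : 0 < Num.sqrt N by rewrite sqrtr_gt0.
have : Num.sqrt N <= g0 s.
  by rewrite -(ler_pM2l sp) -expr2 sN.
by rewrite -{2}sN => h2; rewrite ler_pXn2r ?nnegrE // ltW.
Qed.

(** The phase is rotated by its value [y ln s] at [t = s], near which the mass concentrates. The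
    loss is at most [2 y^2 (t/s - 2 + s/t)], whose integral is explicit by the functional equation
    and equals [2 y^2 / (s - 1)] times [g0 s]. *)
Lemma gnorm2_ge (s y : R) : 3 / 2 <= s ->
  g0 s ^+ 2 * (1 - 4 * y ^+ 2 / (s - 1)) <= gnorm2 s y.
Proof.
move=> s32; have s2 : 2^-1 <= s by lra.
have s2' : 2^-1 <= s - 1 by lra.
have s2'' : 2^-1 <= s + 1 by lra.
have s0 : 0 < s by lra.
have s10 : 0 < s - 1 by lra.
have i0 := integrable_gker s2.
have im := integrable_gker s2'.
have ip := integrable_gker s2''.
set c := cos (y * ln s); set d := sin (y * ln s).
have h : g0 s * (1 - 2 * y ^+ 2 / (s - 1)) <= c * gC s y + d * gS s y.
  rewrite gam_rot //.
  have -> : g0 s * (1 - 2 * y ^+ 2 / (s - 1)) =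
      (1 + 4 * y ^+ 2) * g0 s - (2 * y ^+ 2 / s * g0 (s + 1) + 2 * y ^+ 2 * s * g0 (s - 1)).
    have e : g0 s = (s - 1) * g0 (s - 1) by rewrite -(g0S s2') subrK.
    have n1 : s - 1 != 0 by rewrite gt_eqF.
    have n2 : s != 0 by rewrite gt_eqF.
    by rewrite g0S // e; field; rewrite n2 n1.
  rewrite !g0E -!RintegralZl // -RintegralD //; try exact: integrable_scale.
  rewrite -RintegralB //; first last.
  - by apply: integrable_add => //; exact: integrable_scale.
  - exact: integrable_scale.
  apply: le_Rintegral => //; [|exact: integrable_gam_rot|].
  - apply: integrable_sub => //; first exact: integrable_scale.
    by apply: integrable_add => //; exact: integrable_scale.
  move=> t /DP t0.
  have -> : gker (s + 1) t = t * gker s t by rewrite gkerS.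
  have -> : gker (s - 1) t = t^-1 * gker s t.
    by rewrite -[in RHS](subrK 1 s) gkerS // mulrA mulVf ?mul1r // gt_eqF.
  have -> : (1 + 4 * y ^+ 2) * gker s t -
      (2 * y ^+ 2 / s * (t * gker s t) + 2 * y ^+ 2 * s * (t^-1 * gker s t)) =
      gker s t * (1 - y ^+ 2 / 2 * (4 * (t / s - 2 + s / t))) by lra.
  apply: ler_wpM2l; first exact: expR_ge0.
  have <- : cos (y * (ln t - ln s)) = c * cos (y * ln t) + d * sin (y * ln t).
    by rewrite /c /d mulrBr cosB; ring.
  apply: le_trans (cos_ge_quadratic _); rewrite lerD2l lerN2.
  have -> : (y * (ln t - ln s)) ^+ 2 / 2 = y ^+ 2 / 2 * (ln t - ln s) ^+ 2 by rewrite exprMn mulrAC.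
  apply: ler_wpM2l; first by rewrite divr_ge0 ?sqr_ge0.
  by apply: le_trans (sqr_le_expR _) _; rewrite expRB !lnK // opprB expRB !lnK.
have g00 : 0 <= g0 s by rewrite g0E; apply: Rintegral_ge0 => t _; exact: expR_ge0.
have := cos2Dsin2 (y * ln s); rewrite -/c -/d => cd.
have hN : (c * gC s y + d * gS s y) ^+ 2 <= gnorm2 s y.
  set a := gC s y; set b := gS s y.
  have -> : gnorm2 s y = (c * a + d * b) ^+ 2 + (a * d - b * c) ^+ 2.
    by rewrite /gnorm2 -/a -/b -[LHS]mul1r -cd; ring.
  by rewrite lerDl sqr_ge0.
set q := 2 * y ^+ 2 / (s - 1) in h.
have -> : 4 * y ^+ 2 / (s - 1) = 2 * q by rewrite /q; lra.
have [q1|q1] := leP q 1; last first.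
  apply: (@le_trans _ _ 0); last by rewrite addr_ge0 ?sqr_ge0.
  by rewrite mulr_ge0_le0 ?sqr_ge0 //; lra.
apply: le_trans hN; apply: (@le_trans _ _ ((g0 s * (1 - q)) ^+ 2)).
  rewrite exprMn; apply: ler_wpM2l; first exact: sqr_ge0.
  by have := sqr_ge0 q; lra.
rewrite ler_pXn2r ?nnegrE //; first by rewrite mulr_ge0 //; lra.
by apply: le_trans h; rewrite mulr_ge0 //; lra.
Qed.

End GammaModulus.

(** * Wallis integrals *)

Section Wallis.
Variable R : realType.
Local Notation mu := (@lebesgue_measure R).

Definition coshR (x : R) : R := (expR x + expR (- x)) / 2.
Definition sinhR (x : R) : R := (expR x - expR (- x)) / 2.

Lemma coshR0 : coshR 0 = 1. Proof. by rewrite /coshR oppr0 expR0; lra. Qed.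
Lemma sinhR0 : sinhR 0 = 0. Proof. by rewrite /sinhR oppr0 expR0; lra. Qed.

Lemma is_derive_expRM (y x : R) : is_derive x 1 (fun x : R => expR (y * x)) (expR (y * x) * y).
Proof.
apply: is_derive_expR_comp; exact: is_derive_eq (is_deriveZ y (is_derive_id x 1)) (mulr1 y).
Qed.

Lemma is_derive_coshM (y x : R) : is_derive x 1 (fun x : R => coshR (y * x)) (y * sinhR (y * x)).
Proof.
have h1 := is_derive_expRM y x; have h2 := is_derive_expRM (- y) x.
have -> : (fun x : R => coshR (y * x)) = (fun x : R => 2^-1 * (expR (y * x) + expR (- y * x))).
  by apply/funext => t; rewrite /coshR mulNr mulrC.
apply: is_derive_eq (is_deriveZ 2^-1 (is_deriveD h1 h2)) _.
by rewrite /GRing.scale /= /sinhR mulNr; lra.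
Qed.

Lemma is_derive_sinhM (y x : R) : is_derive x 1 (fun x : R => sinhR (y * x)) (y * coshR (y * x)).
Proof.
have h1 := is_derive_expRM y x; have h2 := is_derive_expRM (- y) x.
have -> : (fun x : R => sinhR (y * x)) = (fun x : R => 2^-1 * (expR (y * x) - expR (- y * x))).
  by apply/funext => t; rewrite /sinhR mulNr mulrC.
apply: is_derive_eq (is_deriveZ 2^-1 (is_deriveB h1 h2)) _.
by rewrite /GRing.scale /= /coshR mulNr; lra.
Qed.

Lemma coshR_gt0 (x : R) : 0 < coshR x.
Proof. by rewrite /coshR; have := expR_gt0 x; have := expR_gt0 (- x); lra. Qed.

Lemma coshR_sub1 (x : R) : coshR x - 1 = (expR (x / 2) - expR (- (x / 2))) ^+ 2 / 2.
Proof.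
have ew : expR x = expR (x / 2) ^+ 2 by rewrite expr2 -expRD; congr expR; lra.
have ewN : expR (- x) = expR (- (x / 2)) ^+ 2 by rewrite expr2 -expRD; congr expR; lra.
have e1 : expR (x / 2) * expR (- (x / 2)) = 1 by rewrite -expRD subrr expR0.
by rewrite sqrrB e1 -ew -ewN /coshR; lra.
Qed.

Lemma coshR_ge1 (x : R) : 1 <= coshR x.
Proof. by rewrite -subr_ge0 coshR_sub1 divr_ge0 ?sqr_ge0. Qed.

Lemma Rintegral_FTC (f F : R -> R) (a b : R) : a < b ->
  (forall t : R, is_derive t 1 F (f t)) -> continuous f ->
  \int[mu]_(x in `[a, b]) f x = F b - F a.
Proof. by move=> ab dF cf; rewrite /Rintegral (@continuous_FTC2_cc _ f F) // => t _; exact: cf. Qed.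

Local Notation I := (`[0, pi / 2]%classic : set R).

Let pi20 : 0 < pi / 2 :> R. Proof. by rewrite divr_gt0 // pi_gt0. Qed.
Let mI : measurable I. Proof. exact: measurable_itv. Qed.

Lemma integrable_cc (f : R -> R) : continuous f -> mu.-integrable I (EFin \o f).
Proof.
move=> cf; apply: continuous_compact_integrable; first exact: segment_compact.
exact: continuous_subspaceT.
Qed.

Definition wker (n : nat) (y x : R) : R := coshR (2 * y * x) * cos x ^+ n.

(** Its classical value is [pi n! / (2^(n+1) |Gamma (n/2 + 1 + i y)|^2)]; what is proved below is
    that its product with the squared modulus does not depend on y. *)
Definition wallis (n : nat) (y : R) : R := \int[mu]_(x in I) wker n y x.

Lemma is_derive_cosX (n : nat) (x : R) :
  is_derive x 1 (fun x : R => cos x ^+ n) (- (n%:R * cos x ^+ n.-1 * sin x)).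
Proof.
have -> : (fun x : R => cos x ^+ n) = (@cos R) ^+ n by rewrite exprfctE.
by apply: is_derive_eq (is_deriveX n (is_derive_cos x)) _; rewrite /GRing.scale /= mulrN.
Qed.

Lemma continuous_wker n y : continuous (wker n y).
Proof.
move=> x; have h1 := is_derive_coshM (2 * y) x; have h2 := is_derive_cosX n x.
exact: (continuous_of_derive (is_deriveM h1 h2)).
Qed.

(** Two integrations by parts, combined into the single primitive [F], which vanishes at both
    ends. *)
Lemma wallisSS n y : ((n.+2)%:R ^+ 2 + 4 * y ^+ 2) * wallis n.+2 y = n.+2%:R * n.+1%:R * wallis n y.
Proof.
have i2 := integrable_cc (@continuous_wker n.+2 y).
have i0 := integrable_cc (@continuous_wker n y).
apply/eqP; rewrite -subr_eq0; apply/eqP.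
rewrite /wallis -!RintegralZl // -RintegralB //; try exact: integrable_scale.
pose F (x : R) := n.+2%:R * (coshR (2 * y * x) * (cos x ^+ n.+1 * sin x)) + 2 * y * (sinhR (2 * y * x) * cos x ^+ n.+2).
transitivity (F (pi / 2) - F 0); last first.
  by rewrite /F cos_pihalf sin0 mulr0 sinhR0 !expr0n /=; ring.
pose f (x : R) := (n.+2%:R ^+ 2 + 4 * y ^+ 2) * wker n.+2 y x - n.+2%:R * n.+1%:R * wker n y x.
have cf : continuous f.
  suff cx (x : R) : {for x, continuous f} by [].
  by apply: continuousB; apply: continuousM; try exact: cst_continuous; exact: continuous_wker.
suff hF (x : R) : is_derive x 1 F (f x) by exact: (Rintegral_FTC pi20 hF cf).
have h1 := is_derive_coshM (2 * y) x; have h2 := is_derive_sinhM (2 * y) x.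
  have h3 := is_derive_sin x.
  have h5 := is_derive_cosX n.+1 x; have h6 := is_derive_cosX n.+2 x.
  apply: is_derive_eq (is_deriveD (is_deriveZ n.+2%:R (is_deriveM h1 (is_deriveM h5 h3)))
    (is_deriveZ (2 * y) (is_deriveM h2 h6))) _.
  rewrite /GRing.scale /= /f /wker mulrfctE /=.
  have : sin x ^+ 2 = 1 - cos x ^+ 2 by have := cos2Dsin2 x; lra.
  set s := sin x; set c := cos x; set u := coshR _; set v := sinhR _ => e.
  rewrite !exprS.
  have -> : n.+2%:R = n%:R + 2 :> R by rewrite -addn2 natrD.
  have -> : n.+1%:R = n%:R + 1 :> R by rewrite -addn1 natrD.
  set N := n%:R; set w := c ^+ n.
  apply/eqP; rewrite -subr_eq0; apply/eqP.
  transitivity (- (N + 2) * (N + 1) * u * w * (s ^+ 2 - (1 - c ^+ 2))); last by rewrite e subrr mulr0.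
  ring.
Qed.

Lemma wallis0 y : y != 0 -> wallis 0 y = sinhR (pi * y) / (2 * y).
Proof.
move=> y0; pose F (x : R) := (2 * y)^-1 * sinhR (2 * y * x).
transitivity (F (pi / 2) - F 0); last first.
  by rewrite /F mulr0 sinhR0 mulr0 subr0 mulrC; congr (sinhR _ / _); lra.
apply: (@Rintegral_FTC (wker 0 y) F) => //; last exact: continuous_wker.
move=> x; have h2 := is_derive_sinhM (2 * y) x.
  apply: is_derive_eq (is_deriveZ (2 * y)^-1 h2) _.
  by rewrite /GRing.scale /= /wker expr0 mulr1 mulrA mulVf ?mul1r // mulf_neq0.
Qed.

Lemma wallis00 : wallis 0 0 = pi / 2.
Proof.
transitivity (pi / 2 - 0 : R); last by rewrite subr0.
apply: (@Rintegral_FTC (wker 0 0) id) => //; last exact: continuous_wker.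
by move=> x; apply: is_derive_eq (is_derive_id x 1) _; rewrite /wker mulr0 mul0r coshR0 expr0 mulr1.
Qed.

Lemma wallis1 y : (1 + 4 * y ^+ 2) * wallis 1 y = coshR (pi * y).
Proof.
have i1 := integrable_cc (@continuous_wker 1 y).
rewrite /wallis -RintegralZl //.
pose F (x : R) := coshR (2 * y * x) * sin x + 2 * y * (sinhR (2 * y * x) * cos x).
transitivity (F (pi / 2) - F 0); last first.
  rewrite /F cos_pihalf sin_pihalf sin0 !mulr0 sinhR0 !(mul0r, mulr0) !addr0 mulr1 subr0.
  by congr coshR; lra.
pose f (x : R) := (1 + 4 * y ^+ 2) * wker 1 y x.
have cf : continuous f.
  suff cx (x : R) : {for x, continuous f} by [].
  by apply: continuousM; [exact: cst_continuous|exact: continuous_wker].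
suff hF (x : R) : is_derive x 1 F (f x) by exact: (Rintegral_FTC pi20 hF cf).
have h1 := is_derive_coshM (2 * y) x; have h2 := is_derive_sinhM (2 * y) x.
have h3 := is_derive_sin x; have h4 := is_derive_cos x.
apply: is_derive_eq (is_deriveD (is_deriveM h1 h3) (is_deriveZ (2 * y) (is_deriveM h2 h4))) _.
rewrite /GRing.scale /= /f /wker expr1.
by set s := sin x; set c := cos x; set u := coshR _; set v := sinhR _; ring.
Qed.

Lemma wallis_gt0 n : 0 < wallis n 0.
Proof.
suff h m : 0 < wallis m 0 /\ 0 < wallis m.+1 0 by have [] := h n.
elim: m => [|m [h1 h2]].
  rewrite wallis00; have := wallis1 0; rewrite expr0n /= !mulr0 addr0 mul1r coshR0 => ->.
  by split.
split => //; have := wallisSS m 0; rewrite expr0n /= mulr0 addr0 => e.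
by rewrite -(@pmulr_rgt0 _ (m.+2%:R ^+ 2)) ?exprn_gt0 // e !mulr_gt0.
Qed.

Lemma id_le_3sin (x : R) : 0 <= x <= pi / 2 -> x <= 3 * sin x.
Proof.
move=> /andP[x0 x2].
have xp : x <= pi by have := pi20; lra.
have s0 : 0 <= sin x by apply: sin_ge0_pi; rewrite x0 xp.
have c0 : 0 <= cos x by apply: cos_ge0_pihalf; rewrite x2 andbT; lra.
have p2 := @pihalf_lt2 R.
have h1 : x * cos x <= sin x.
  have := @le_of_derive_ge0 R (fun x => sin x - x * cos x) (fun x => x * sin x) _ _ x0.
  rewrite sin0 mul0r subrr subr_ge0; apply.
    move=> t; apply: is_derive_eq (is_deriveB (is_derive_sin t) (is_deriveM (is_derive_id t 1) (is_derive_cos t))) _.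
    by rewrite /GRing.scale /= mulr1; ring.
  by move=> t /andP[t0 tx]; rewrite mulr_ge0 // sin_ge0_pi // t0 /=; lra.
have := cos2Dsin2 x; have := sin_le1 x; have := cos_le1 x => c1 s1 e.
have h2 : 1 - sin x <= cos x by nra.
nra.
Qed.

(** The bound is in [sin x ^+ 2] because against [cos x ^+ n] this factor gains [1 / (n + 2)]. The
    constant 18 is [2 * 3 ^ 2], from [x <= 3 * sin x], and [4 * |y|] comes from
    [x <= pi / 2 < 2]. *)
Lemma cosh_sub1_le (y x : R) : 0 <= x <= pi / 2 ->
  coshR (2 * y * x) - 1 <= 18 * y ^+ 2 * expR (4 * `|y|) * sin x ^+ 2.
Proof.
move=> hx; have /andP[x0 x2] := hx; have p2 := @pihalf_lt2 R.
rewrite coshR_sub1; have -> : 2 * y * x / 2 = y * x by lra.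
have h (v : R) : (expR v - expR (- v)) ^+ 2 <= 4 * v ^+ 2 * expR (2 * `|v|).
  wlog v0 : v / 0 <= v.
    move=> h; case: (lerP 0 v) => v0; first exact: h.
    have := h (- v); rewrite normrN opprK sqrrN -opprB sqrrN; apply; lra.
  rewrite ger0_norm //.
  have -> : 4 * v ^+ 2 * expR (2 * v) = (2 * v * expR v) ^+ 2.
    by rewrite !exprMn -expRM_natl; congr (_ * _ * expR _); lra.
  rewrite ler_pXn2r ?nnegrE ?mulr_ge0 ?expR_ge0 //.
    have e1 : expR v * expR (- v) = 1 by rewrite -expRD subrr expR0.
    have := expR_ge1Dx (- (2 * v)).
    have -> : expR (- (2 * v)) = expR (- v) ^+ 2 by rewrite expr2 -expRD; congr expR; lra.
    have := expR_gt0 v; move: e1; set a := expR v; set b := expR (- v) => e1 a0 hb.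
    have -> : b = a * b ^+ 2 by rewrite expr2 mulrA e1 mul1r.
    nra.
  by rewrite subr_ge0 ler_expR; lra.
apply: (@le_trans _ _ (2 * (y * x) ^+ 2 * expR (2 * `|y * x|))).
  by have := h (y * x); lra.
have h3 := id_le_3sin hx.
have s0 : 0 <= sin x by lra.
have e : expR (2 * `|y * x|) <= expR (4 * `|y|).
  rewrite ler_expR normrM (ger0_norm x0); have := normr_ge0 y; nra.
apply: (@le_trans _ _ (2 * (y * x) ^+ 2 * expR (4 * `|y|))).
  by apply: ler_wpM2l => //; rewrite mulr_ge0 ?sqr_ge0.
have -> : 18 * y ^+ 2 * expR (4 * `|y|) * sin x ^+ 2 = 2 * (y * (3 * sin x)) ^+ 2 * expR (4 * `|y|) by ring.
apply: ler_wpM2r; first exact: expR_ge0.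
apply: ler_wpM2l => //; rewrite !exprMn; apply: ler_wpM2l; first exact: sqr_ge0.
by rewrite -exprMn ler_pXn2r ?nnegrE //; lra.
Qed.

Lemma wallis_ge n y : wallis n 0 <= wallis n y.
Proof.
apply: le_Rintegral => //; try (apply: integrable_cc; exact: continuous_wker).
move=> x; rewrite /= in_itv /= => /andP[x0 x2].
rewrite /wker mulr0 mul0r coshR0; apply: ler_wpM2r; last exact: coshR_ge1.
by rewrite exprn_ge0 // cos_ge0_pihalf // x2 andbT; lra.
Qed.

(** Writing [sin x ^+ 2] as [1 - cos x ^+ 2] turns the excess into [wallis n 0 - wallis n.+2 0],
    which is [wallis n 0 / (n + 2)]. *)
Lemma wallis_le y : exists2 C, 0 <= C & forall n, wallis n y <= wallis n 0 * (1 + C / n.+2%:R).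
Proof.
pose C := 18 * y ^+ 2 * expR (4 * `|y|).
have C0 : 0 <= C by rewrite mulr_ge0 ?expR_ge0 // mulr_ge0 ?sqr_ge0.
exists C => // n.
have e : n.+2%:R * wallis n.+2 0 = n.+1%:R * wallis n 0.
  have := wallisSS n 0; rewrite expr0n /= mulr0 addr0 expr2 -!mulrA => /mulfI; apply.
  by rewrite pnatr_eq0.
have -> : wallis n 0 * (1 + C / n.+2%:R) = (1 + C) * wallis n 0 - C * wallis n.+2 0.
  have n0 : n.+2%:R != 0 :> R by rewrite pnatr_eq0.
  have -> : wallis n.+2 0 = n.+1%:R / n.+2%:R * wallis n 0 by rewrite mulrAC -e mulrC mulKf.
  have -> : n.+1%:R = n.+2%:R - 1 :> R by rewrite -[in RHS]addn1 natrD addrK.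
  by field.
have i0 := integrable_cc (@continuous_wker n 0).
have i2 := integrable_cc (@continuous_wker n.+2 0).
have iy := integrable_cc (@continuous_wker n y).
rewrite /wallis -!RintegralZl // -RintegralB //; try exact: integrable_scale.
apply: le_Rintegral => //; first by apply: integrable_sub => //; exact: integrable_scale.
move=> x; rewrite /= in_itv /= => hx; have /andP[x0 x2] := hx.
have hc := cosh_sub1_le y hx; rewrite -/C in hc.
rewrite /wker mulr0 mul0r coshR0 !mul1r; have -> : cos x ^+ n.+2 = cos x ^+ n * cos x ^+ 2 by rewrite -exprD addn2.
have -> : (1 + C) * cos x ^+ n - C * (cos x ^+ n * cos x ^+ 2) = (1 + C * (1 - cos x ^+ 2)) * cos x ^+ n by ring.
apply: ler_wpM2r.
  by rewrite exprn_ge0 // cos_ge0_pihalf // x2 andbT; lra.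
have -> : 1 - cos x ^+ 2 = sin x ^+ 2 by have := cos2Dsin2 x; lra.
by lra.
Qed.

Lemma natrSS (m : nat) : m.+2%:R = m%:R + 2 :> R.
Proof. by rewrite -addn2 natrD. Qed.

Definition halfn (n : nat) : R := n%:R / 2 + 1.

Lemma gamma_wallisSS n y :
  gnorm2 (halfn n.+2) y * wallis n.+2 y = (n.+2%:R * n.+1%:R / 4) * (gnorm2 (halfn n) y * wallis n y).
Proof.
have h2 : 2^-1 <= halfn n by rewrite /halfn; have := ler0n R n; lra.
have -> : halfn n.+2 = halfn n + 1 by rewrite /halfn (natrSS n); lra.
rewrite gnorm2S //.
have -> : halfn n ^+ 2 + y ^+ 2 = (n.+2%:R ^+ 2 + 4 * y ^+ 2) / 4 by rewrite /halfn (natrSS n); field.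
have := wallisSS n y; set a := n.+2%:R ^+ 2 + _; set b := n.+2%:R * _; set w := wallis n y => e.
transitivity (gnorm2 (halfn n) y * (a * wallis n.+2 y) / 4); first by ring.
by rewrite e; ring.
Qed.

(* Both sides obey the same recurrence in [n], and their ratio tends to 1. *)
Lemma gamma_wallis n y :
  gnorm2 (halfn n) y * wallis n y = g0 (halfn n) ^+ 2 * wallis n 0.
Proof.
pose a m := gnorm2 (halfn m) y * wallis m y.
pose b m := g0 (halfn m) ^+ 2 * wallis m 0.
have b0 m : 0 < b m.
  rewrite mulr_gt0 ?wallis_gt0 // exprn_gt0 //.
  have -> : halfn m = m.+2%:R / 2 by rewrite /halfn (natrSS m); lra.
  exact: g0_gt0.
have h2 m : 2^-1 <= halfn m by rewrite /halfn; have := ler0n R m; lra.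
have aS m : a m.+2 = (m.+2%:R * m.+1%:R / 4) * a m by exact: gamma_wallisSS.
have bE m : b m = gnorm2 (halfn m) 0 * wallis m 0.
  congr (_ * _); apply/eqP; rewrite eq_le gnorm2_le // andbT.
  by rewrite /g0 /gnorm2 lerDl sqr_ge0.
have bS m : b m.+2 = (m.+2%:R * m.+1%:R / 4) * b m by rewrite !bE; exact: gamma_wallisSS.
have inv m : a (n + m.*2)%N * b n = b (n + m.*2)%N * a n.
  elim: m => [|m IH]; first by rewrite addn0 mulrC.
  by rewrite doubleS !addnS aS bS -[LHS]mulrA IH mulrA.
have [C C0 hC] := wallis_le y.
have le_a m : a m <= b m * (1 + C / m.+2%:R).
  rewrite /a /b -mulrA; apply: ler_pM => //; try exact: gnorm2_le.
    by rewrite addr_ge0 ?sqr_ge0.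
  by apply: le_trans (wallis_ge m y); exact: ltW (wallis_gt0 m).
have ge_a m : b m.+1 * (1 - 8 * y ^+ 2 / m.+1%:R) <= a m.+1.
  apply: (@le_trans _ _ (gnorm2 (halfn m.+1) y * wallis m.+1 0)); last first.
    by apply: ler_wpM2l; [rewrite addr_ge0 ?sqr_ge0|exact: wallis_ge].
  rewrite /b mulrAC; apply: ler_wpM2r; first exact: ltW (wallis_gt0 _).
  have h3 : 3 / 2 <= halfn m.+1 by rewrite /halfn -(natr1 m); have := ler0n R m; lra.
  have := gnorm2_ge y h3.
  by have -> : 4 * y ^+ 2 / (halfn m.+1 - 1) = 8 * y ^+ 2 / m.+1%:R by rewrite /halfn addrK; field.
(* The ratio is the same at every [n + 2 m], and the two-sided bounds there give
   [|q - 1| <= K / (m + 1)] for all [m]. *)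
pose q := a n / b n.
have aq m : a (n + m.*2)%N = q * b (n + m.*2)%N.
  by rewrite /q mulrAC (mulrC (a n)) -inv mulfK //; exact: lt0r_neq0.
pose K := C + 8 * y ^+ 2 + 1.
have K0 : 0 < K by rewrite /K; have := sqr_ge0 y; lra.
have hq m : `|q - 1| <= K / m.+1%:R.
  have hm : (n + m.+1.*2 = (n + m.*2).+2)%N by rewrite doubleS !addnS.
  have := le_a (n + m.+1.*2)%N; rewrite aq mulrC ler_pM2l // => h1.
  have := ge_a (n + m.*2).+1; rewrite -hm aq (mulrC q) ler_pM2l // => h3.
  have hinv (j : nat) : (m <= j)%N -> j.+1%:R^-1 <= m.+1%:R^-1 :> R.
    by move=> mj; rewrite lef_pV2 ?posrE // ler_nat.
  have l1 : C / (n + m.+1.*2).+2%:R <= C / m.+1%:R by apply: ler_wpM2l => //; apply: hinv; lia.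
  have l2 : 8 * y ^+ 2 / (n + m.+1.*2)%:R <= 8 * y ^+ 2 / m.+1%:R.
    by apply: ler_wpM2l; [rewrite mulr_ge0 ?sqr_ge0|rewrite hm; apply: hinv; lia].
  have p1 : 0 <= C / m.+1%:R by rewrite divr_ge0.
  have p2 : 0 <= 8 * y ^+ 2 / m.+1%:R by rewrite divr_ge0 // mulr_ge0 // sqr_ge0.
  have p3 : 0 <= m.+1%:R^-1 :> R by rewrite invr_ge0.
  rewrite /K (mulrDl _ 1) (mulrDl C) mul1r ler_norml; move: h1 h3 l1 l2 p1 p2 p3.
  move: (C / (n + m.+1.*2).+2%:R) (8 * y ^+ 2 / (n + m.+1.*2)%:R) (C / m.+1%:R).
  move: (8 * y ^+ 2 / m.+1%:R) (m.+1%:R^-1) => a1 a2 a3 a4 a5 *; apply/andP; split; lra.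
suff q1 : q = 1 by move: (aq 0%N); rewrite addn0 q1 mul1r.
apply/eqP; rewrite -subr_eq0 -normr_eq0; apply/negP => /negP hne.
have d0 : 0 < `|q - 1| by rewrite lt_def hne /=.
have := hq (Num.truncn (K / `|q - 1|)).
have := truncnS_gt (K / `|q - 1|); set N := _.+1%:R => hN.
have N0 : 0 < N by rewrite /N.
rewrite ler_pdivlMr // leNgt => /negP; apply.
by rewrite ltr_pdivrMr // mulrC in hN.
Qed.

(** The case [n = 0], where the Wallis integral is elementary and yields [sinh]. *)
Lemma gnorm2_one y : gnorm2 1 y * sinhR (pi * y) = pi * y.
Proof.
have [->|y0] := eqVneq y 0; first by rewrite !mulr0 sinhR0 mulr0.
have := gamma_wallis 0 y; rewrite wallis0 // wallis00 /halfn mul0r add0r g0_1 expr1n mul1r => e.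
have h : 2 * y != 0 by rewrite mulf_neq0.
apply: (@mulIf _ (2 * y)^-1); first by rewrite invr_eq0.
rewrite -mulrA e; field.
by rewrite y0.
Qed.

(** The case [n = 1], where the Wallis integral yields [cosh]; one step of the functional equation
    goes down from 3/2 to 1/2. *)
Lemma gnorm2_half y : gnorm2 2^-1 y * coshR (pi * y) = g0 2^-1 ^+ 2.
Proof.
have := gamma_wallis 1 y.
have -> : halfn 1 = 2^-1 + 1 by rewrite /halfn; lra.
have h2 : 2^-1 <= 2^-1 :> R by [].
rewrite (gnorm2S _ h2) (g0S h2) -wallis1.
have := wallis1 0; rewrite mulr0 coshR0 expr0n /= mulr0 addr0 mul1r => -> e.
by move: e; set w := wallis 1 y; set N := gnorm2 _ y; set g := g0 _ => e; lra.
Qed.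

End Wallis.

(** * The matrix of the Hankel operator *)

Lemma RintegralN (d : measure_display) (A : measurableType d) (R : realType) (mu : {measure set A -> \bar R}) (D : set A) (f : A -> R) :
  \int[mu]_(x in D) (- f x) = - \int[mu]_(x in D) f x.
Proof.
rewrite /Rintegral integralE [in RHS]integralE.
have -> : (fun x => (- f x)%:E) = (\- (EFin \o f))%E by apply/funext.
rewrite funeposN funenegN.
set a := (\int[mu]_(x in D) _ ^\- x)%E; set b := (\int[mu]_(x in D) _ ^\+ x)%E.
have a0 : (0 <= a)%E by apply: integral_ge0.
have b0 : (0 <= b)%E by apply: integral_ge0.
case: a a0 => [a| |] //; case: b b0 => [b| |] //= _ _; rewrite ?oppr0 //.
by rewrite opprB.
Qed.

Section HankelMatrix.
Variable R : realType.
Implicit Types (T k : R) (p : R -> R).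

Lemma GammaCE (x y : R) : GammaC (mkC x y) = mkC (gam (@cos R) x y) (gam (@sin R) x y).
Proof.
have e (t : R) : `]0, +oo[%classic t -> t `^ (x - 1) * expR (- t) = gker x t.
  rewrite /= in_itv /= andbT => t0.
  by rewrite /powR gt_eqF // -expRD.
by rewrite /GammaC /gam; congr mkC; apply: eq_Rintegral => t /set_mem /e ->.
Qed.

Lemma GammaC_conj (x y : R) : GammaC (mkC x (- y)) = ((GammaC (mkC x y))^*)%C.
Proof.
rewrite !GammaCE /= /mkC /gam -RintegralN; congr Complex; apply: eq_Rintegral => t _.
  by rewrite mulNr cosN.
by rewrite mulNr sinN mulrN.
Qed.

Lemma normc_GammaC (x y : R) : normc (GammaC (mkC x y)) = Num.sqrt (gnorm2 x y).
Proof. by rewrite GammaCE. Qed.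

Lemma gnorm2N (x y : R) : gnorm2 x (- y) = gnorm2 x y.
Proof.
have := GammaC_conj x y; rewrite !GammaCE => -[e1 e2].
by rewrite /gnorm2 e1 e2 sqrrN.
Qed.

Lemma fourier_coefN T p (l : int) : fourier_coef T p (- l) = ((fourier_coef T p l)^*)%C.
Proof.
have e (x : R) : (- l)%:~R * omega T * x = - (l%:~R * omega T * x) by rewrite rmorphN !mulNr.
rewrite /fourier_coef /=; congr Complex.
  by congr (_ * _); apply: eq_Rintegral => x _; rewrite e cosN.
congr (- _); rewrite -mulrN -RintegralN; congr (_ * _).
by apply: eq_Rintegral => x _; rewrite e sinN mulNr.
Qed.

Definition hankD T k (n : int) : R[i] := GammaC (mkC 2^-1 (- (omega T * n%:~R) - k)).
(** The denominator [Gamma (z1 + z2)] of the beta function depends on [n - m] only, hence joins the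
    Fourier coefficient in the Toeplitz symbol. *)
Definition hankq T p (l : int) : R[i] := fourier_coef T p l / GammaC (mkC 1 (- (omega T * l%:~R))).

Lemma HkE T p k n m : Hk T p k n m = hankD T k n * hankq T p (n - m) * ((hankD T k m)^*)%C.
Proof.
rewrite /Hk /BetaC /hankD /hankq.
have -> : mkC 2^-1 (omega T * m%:~R + k) = mkC 2^-1 (- (- (omega T * m%:~R) - k)).
  by congr mkC; lra.
rewrite GammaC_conj.
have -> : mkC 2^-1 (- (omega T * n%:~R) - k) + mkC 2^-1 (- (- (omega T * m%:~R) - k))
    = mkC 1 (- (omega T * (n - m)%:~R)) :> R[i].
  rewrite rmorphB /=; apply/eqP; rewrite eq_complex /=; apply/andP; split; apply/eqP; lra.
by rewrite -!mulrA; congr (_ * _); rewrite mulrCA mulrA mulrC.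
Qed.

(** [Gamma (1/2)^2], the constant in [|Gamma (1/2 + i y)|^2 = w0 sech (pi y)]. *)
Definition w0 : R := g0 2^-1 ^+ 2.

Lemma w0_gt0 : 0 < w0. Proof. by rewrite exprn_gt0 // g0_half_gt0. Qed.

Lemma coshR_sech (u : R) : sech u = (coshR u)^-1.
Proof.
have e := expR_gt0 u.
rewrite /sech /coshR expRN; field.
by rewrite !gt_eqF // ?addr_gt0 // ?exprn_gt0.
Qed.

Lemma normc_hankD T k n : normc (hankD T k n) =
  Num.sqrt (w0 * sech (pi * k + pi * omega T * n%:~R)).
Proof.
rewrite normc_GammaC; congr Num.sqrt.
have := gnorm2_half (- (omega T * n%:~R) - k); rewrite -/w0 => <-.
rewrite coshR_sech.
have -> : pi * (- (omega T * n%:~R) - k) = - (pi * k + pi * omega T * n%:~R) by lra.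
set u := pi * k + _; have -> : coshR (- u) = coshR u by rewrite /coshR opprK addrC.
by rewrite mulfK // gt_eqF // coshR_gt0.
Qed.

Lemma hankD_neq0 T k n : hankD T k n != 0.
Proof.
apply/eqP => h; have := normc_hankD T k n; rewrite h normc0 => /esym/eqP.
by rewrite gt_eqF // sqrtr_gt0 mulr_gt0 ?w0_gt0 ?sech_gt0.
Qed.

Lemma normcV (z : R[i]) : normc z^-1 = (normc z)^-1.
Proof.
have [->|z0] := eqVneq z 0; first by rewrite invr0 normc0 invr0.
apply: (@mulfI _ (normc z)); first by rewrite gt_eqF // normc_gt0.
by rewrite -normcM mulfV // normc1 mulfV // gt_eqF // normc_gt0.
Qed.

Lemma normc_conj (z : R[i]) : normc (z^*)%C = normc z.
Proof. by case: z => a b /=; rewrite sqrrN. Qed.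

Lemma normc_hankq T p l : normc (hankq T p l) =
  modC (fourier_coef T p l) / Num.sqrt (gnorm2 1 (omega T * l%:~R)).
Proof.
rewrite normcM normcV normc_GammaC gnorm2N; congr (_ * _).
Qed.

Lemma normc_Hk T p k n m : normc (Hk T p k n m) =
  w0 * Num.sqrt (sech (pi * k + pi * omega T * n%:~R) * sech (pi * k + pi * omega T * m%:~R))
   * normc (hankq T p (n - m)).
Proof.
have e x : Num.sqrt (w0 * sech x) = Num.sqrt w0 * Num.sqrt (sech x) by exact: (sqrtrM _ (ltW w0_gt0)).
rewrite HkE [LHS]normcM [X in X * _]normcM normc_conj !normc_hankD !e (sqrtrM _ (ltW (sech_gt0 _))).
rewrite -[X in _ = X * _ * _](sqr_sqrtr (ltW w0_gt0)).
ring.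
Qed.

End HankelMatrix.

Section HankelSummable.
Variable R : realType.

(** [tanh (u / 2)]: increasing and bounded, so that a bound of the matrix entries by its increments
    can be summed by telescoping. *)
Definition tauh (u : R) : R := (expR u - 1) / (expR u + 1).

Lemma tauh_mono (u v : R) : u <= v -> tauh u <= tauh v.
Proof.
move=> uv; rewrite /tauh; have e1 := expR_gt0 u; have e2 := expR_gt0 v.
have : expR u <= expR v by rewrite ler_expR.
move: e1 e2; set a := expR u; set b := expR v => a0 b0 ab.
rewrite ler_pdivrMr ?addr_gt0 // mulrAC ler_pdivlMr ?addr_gt0 //; nra.
Qed.

Lemma tauh_bd (u : R) : -1 <= tauh u <= 1.
Proof.
rewrite /tauh; have e1 := expR_gt0 u.
by rewrite ler_pdivlMr ?addr_gt0 // ler_pdivrMr ?addr_gt0 //; apply/andP; split; lra.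
Qed.

(* with [p = e^u], [q = e^v]: [tanh u - tanh v = 2 (p^2 - q^2) / ((p^2+1) (q^2+1))] *)
Lemma sech_sinh_le (b u v : R) : 0 < b -> b <= u - v ->
  sinhR (u - v) * (sech u * sech v) <=
    (2 * (expR b + 1) / (expR b - 1)) * (tauh u - tauh v) ^+ 2.
Proof.
move=> b0 buv; set c := expR b.
have c1 : 1 < c by rewrite /c expR_gt1.
have p0 := expR_gt0 u; have q0 := expR_gt0 v.
have pq : c * expR v <= expR u by rewrite /c -expRD ler_expR; lra.
rewrite /sinhR /sech /tauh opprB !expRB; move: p0 q0 pq; set p := expR u; set q := expR v => p0 q0 pq.
have -> : (p / q - q / p) / 2 * (2 * p / (p ^+ 2 + 1) * (2 * q / (q ^+ 2 + 1))) =
    (p - q) * (2 * (p + q)) / ((p ^+ 2 + 1) * (q ^+ 2 + 1)).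
  field; rewrite !gt_eqF // ?addr_gt0 // ?exprn_gt0 //.
have -> : ((p - 1) / (p + 1) - (q - 1) / (q + 1)) ^+ 2 = 4 * (p - q) ^+ 2 / ((p + 1) ^+ 2 * (q + 1) ^+ 2).
  field; rewrite !gt_eqF // ?addr_gt0 //.
have h1 : 2 * (p + q) <= 2 * (c + 1) / (c - 1) * (p - q).
  rewrite mulrAC ler_pdivlMr ?subr_gt0 //; nra.
have p20 : 0 < p ^+ 2 + 1 by rewrite addr_gt0 ?exprn_gt0.
have q20 : 0 < q ^+ 2 + 1 by rewrite addr_gt0 ?exprn_gt0.
have pqn : 0 <= p - q by nra.
have k0 : 0 <= 2 * (c + 1) / (c - 1) by rewrite divr_ge0 ?subr_ge0 ?mulr_ge0 ?addr_ge0 ?(ltW c1) //; lra.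
move: h1 k0; move: (2 * (c + 1) / (c - 1)) => kap h1 k0.
have h2 : (p + 1) ^+ 2 <= 2 * (p ^+ 2 + 1) by have := sqr_ge0 (p - 1); nra.
have h3 : (q + 1) ^+ 2 <= 2 * (q ^+ 2 + 1) by have := sqr_ge0 (q - 1); nra.
have h4 := ler_pM (sqr_ge0 _) (sqr_ge0 _) h2 h3.
have p1 : 0 < (p + 1) ^+ 2 * (q + 1) ^+ 2 by rewrite mulr_gt0 ?exprn_gt0 ?addr_gt0.
move: p20 q20 h4 p1; set P := p ^+ 2 + 1; set Q := q ^+ 2 + 1; set V := (p + 1) ^+ 2 * _ => P0 Q0 h4 V0.
rewrite ler_pdivrMr ?mulr_gt0 //.
apply: (@le_trans _ _ (kap * (p - q) ^+ 2)).
  by have := ler_wpM2l pqn h1; rewrite expr2; lra.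
have -> : kap * (4 * (p - q) ^+ 2 / V) * (P * Q) = kap * (p - q) ^+ 2 * (4 * (P * Q) / V) by ring.
rewrite -[leLHS]mulr1; apply: ler_wpM2l; first by rewrite mulr_ge0 ?sqr_ge0.
rewrite ler_pdivlMr //; lra.
Qed.

End HankelSummable.

(** * Summability of the matrix *)

Section HankelSum.
Variable R : realType.

Lemma ler_wsum_window (a b : int) (L M : nat) (s : int -> R) : (forall n, 0 <= s n) ->
  b <= a -> a + L%:Z <= b + M%:Z -> wsum a L s <= wsum b M s.
Proof. by move=> s0 ba h; have [l [r [-> ->]]] := subwindow ba h; exact: ler_wsum_sub. Qed.

(** An increment over [l] steps is a sum of [|l|] unit increments, each of which telescopes to at
    most 2 over a window. *)
Lemma telescoping_sum (g : int -> R) : (forall n, g n <= g (n + 1)) -> (forall n, -1 <= g n <= 1) ->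
  forall (l : int) a L, wsum a L (fun m => `|g (m + l) - g m|) <= 2 * `|l|%:~R.
Proof.
move=> gm gb.
have h1 a L : wsum a L (fun m => `|g (m + 1) - g m|) <= 2.
  rewrite (@eq_wsum _ _ _ _ (fun m => g (m + 1) - g m)); last first.
    by move=> n _ _; rewrite ger0_norm // subr_ge0.
  rewrite wsum_telescope; have /andP[] := gb a; have /andP[] := gb (a + L%:Z); lra.
have hp (j : nat) a L : wsum a L (fun m => `|g (m + j%:Z) - g m|) <= 2 * j%:R.
  elim: j a L => [|j IH] a L.
    by rewrite wsum0 ?mulr0 // => n _ _; rewrite addr0 subrr normr0.
  apply: (@le_trans _ _ (wsum a L (fun m => `|g (m + 1 + j%:Z) - g (m + 1)| + `|g (m + 1) - g m|))).
    apply: ler_wsum => n _ _.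
    have -> : n + j.+1%:Z = n + 1 + j%:Z by rewrite -addrA -PoszD.
    by apply: le_trans (ler_normD _ _); rewrite addrA subrK.
  rewrite wsum_add (wsum_shift a L 1 (fun m => `|g (m + j%:Z) - g m|)).
  by rewrite -(natr1 j) mulrDr mulr1 lerD.
case=> [j|j] a L; first exact: hp.
have := wsum_shift a L (Negz j) (fun m => `|g (m + j.+1%:Z) - g m|).
rewrite (@eq_wsum _ _ _ _ (fun m => `|g (m + Negz j) - g m|)); last first.
  by move=> n _ _; rewrite NegzE subrK distrC.
by move=> ->; apply: le_trans (hp _ _ _) _.
Qed.

Lemma sqrt_le_weight (l : int) : Num.sqrt (`|l|%:~R) <= (1 + l%:~R ^+ 2) `^ (4^-1) :> R.
Proof.
have h : 0 <= 1 + l%:~R ^+ 2 :> R by rewrite addr_ge0 ?sqr_ge0.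
have -> : 4^-1 = 2^-1 * 2^-1 :> R by lra.
rewrite powRrM !powR12_sqrt ?sqrtr_ge0 //; apply: ler_wsqrtr.
by rewrite intr_norm -sqrtr_sqr; apply: ler_wsqrtr; rewrite lerDr.
Qed.

Variables (T : R) (p : R -> R).
Hypothesis T0 : 0 < T.

Lemma omega_gt0 : 0 < omega T.
Proof. by rewrite divr_gt0 // mulr_gt0 // pi_gt0. Qed.

Let b := pi * omega T.
Let b0 : 0 < b. Proof. by rewrite mulr_gt0 ?pi_gt0 ?omega_gt0. Qed.
Let kap : R := 2 * (expR b + 1) / (expR b - 1).

Lemma kap_ge0 : 0 <= kap.
Proof.
have := expR_gt1 b; rewrite b0 => h.
apply: divr_ge0; last by rewrite subr_ge0 ltW.
by rewrite mulr_ge0 ?addr_ge0 ?expR_ge0.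
Qed.

(** [1 / |Gamma (1 + i omega l)|^2] equals [sinh (b l) / (b l)]. Its exponential growth is absorbed
    by the two [sech] factors, and what remains is a squared increment of [tauh] over [|l|]. *)
Lemma sech_gnorm2_le (x : R) (n m : int) : n != m ->
  sech (x + b * n%:~R) * sech (x + b * m%:~R) / gnorm2 1 (omega T * (n - m)%:~R) <=
    kap / b * ((tauh (x + b * n%:~R) - tauh (x + b * m%:~R)) ^+ 2 / `|n - m|%:~R).
Proof.
wlog nm : n m / m < n.
  move=> h hnm; have [hm|hm|e] := ltgtP m n; last by rewrite e eqxx in hnm.
    exact: h.
  have := h m n hm; rewrite eq_sym => /(_ hnm).
  have -> : m - n = - (n - m) by rewrite opprB.
  rewrite rmorphN mulrN gnorm2N normrN -[(tauh _ - _) ^+ 2]sqrrN opprB.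
  by rewrite [sech _ * sech _]mulrC.
move=> _; set l := n - m.
have l1 : 1 <= l%:~R :> R by rewrite -[1]/(1%:~R) ler_int /l; lia.
have l0 : 0 < l%:~R :> R by lra.
have bl : b <= b * l%:~R by rewrite ler_peMr // ltW.
have bl0 : 0 < b * l%:~R by rewrite mulr_gt0.
have e := gnorm2_one (omega T * l%:~R); rewrite mulrA -/b in e.
have s0 : 0 < sinhR (b * l%:~R).
  by rewrite /sinhR divr_gt0 // subr_gt0 ltr_expR; lra.
have -> : (gnorm2 1 (omega T * l%:~R))^-1 = sinhR (b * l%:~R) / (b * l%:~R).
  have g0 : gnorm2 1 (omega T * l%:~R) != 0.
    by apply/eqP => h; move: e; rewrite h mul0r; lra.
  move: (sinhR _) e s0 => s e s0.
  by rewrite -e invfM mulrCA mulfV ?mulr1 // gt_eqF.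
have -> : `|l| = l by rewrite ger0_norm // /l; lia.
have uv : x + b * n%:~R - (x + b * m%:~R) = b * l%:~R by rewrite /l rmorphB /=; ring.
have := @sech_sinh_le R b (x + b * n%:~R) (x + b * m%:~R) b0; rewrite uv => /(_ bl).
set S := sech _ * sech _; set D := (tauh _ - tauh _) ^+ 2; rewrite -/kap => h.
have -> : S * (sinhR (b * l%:~R) / (b * l%:~R)) = sinhR (b * l%:~R) * S / (b * l%:~R) by ring.
rewrite ler_pdivrMr //; apply: le_trans h _.
have -> // : kap / b * (D / l%:~R) * (b * l%:~R) = kap * D.
by field; rewrite !gt_eqF.
Qed.

Lemma normc_Hk_le k n m : n != m ->
  normc (Hk T p k n m) <= w0 R * Num.sqrt (kap / b) * modC (fourier_coef T p (n - m)) *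
    (`|tauh (pi * k + b * n%:~R) - tauh (pi * k + b * m%:~R)| / Num.sqrt (`|n - m|%:~R)).
Proof.
move=> nm; rewrite normc_Hk normc_hankq -/b.
have kb : 0 <= kap / b by rewrite divr_ge0 ?kap_ge0 ?ltW.
set x := pi * k; set S := sech _ * sech _; set d := tauh _ - tauh _; set mc := modC _.
set G := gnorm2 1 _; set N : R := `|n - m|%:~R.
have S0 : 0 <= S by rewrite mulr_ge0 ?ltW ?sech_gt0.
have mc0 : 0 <= mc by exact: sqrtr_ge0.
have N0 : 0 <= N by rewrite ler0z.
have -> : w0 R * Num.sqrt S * (mc / Num.sqrt G) = w0 R * mc * Num.sqrt (S / G).
  rewrite (sqrtrM _ S0) sqrtrV; last by rewrite addr_ge0 ?sqr_ge0.
  ring.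
have -> : w0 R * Num.sqrt (kap / b) * mc * (`|d| / Num.sqrt N) =
    w0 R * mc * Num.sqrt (kap / b * (d ^+ 2 / N)).
  rewrite (sqrtrM _ kb) (sqrtrM _ (sqr_ge0 d)) sqrtr_sqr sqrtrV //; ring.
apply: ler_wpM2l; first exact: mulr_ge0 (ltW (w0_gt0 R)) mc0.
by apply: ler_wsqrtr; exact: sech_gnorm2_le.
Qed.

(** Off the main diagonal, entries are [O(|p_l| / sqrt |l|)] times increments of [tauh] over [l]
    steps, whose sum is at most [2 |l|]. The resulting [sqrt |l|] is what the weight of exponent 1/4
    controls. *)
Lemma Hk_diag_sum k : exists2 C, 0 <= C & forall (l : int) a L,
  wsum a L (fun m => normc (Hk T p k (m + l) m)) <=
    C * (modC (fourier_coef T p l) * (1 + l%:~R ^+ 2) `^ (4^-1)).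
Proof.
have [M hM] := @wsum_sech R b b0.
have M0 : 0 <= M.
  by apply: le_trans (hM 0 0 0%N); rewrite /wsum big_ord0.
pose C1 := w0 R * Num.sqrt (kap / b) * 2.
pose C2 := w0 R * M / Num.sqrt (gnorm2 1 0).
have w00 : 0 <= w0 R by exact: ltW (w0_gt0 R).
have C10 : 0 <= C1 by rewrite mulr_ge0 // mulr_ge0 ?sqrtr_ge0.
have C20 : 0 <= C2 by rewrite divr_ge0 ?sqrtr_ge0 // mulr_ge0.
exists (C1 + C2) => [|l a L]; first exact: addr_ge0.
set mc := modC _; have mc0 : 0 <= mc by exact: sqrtr_ge0.
set W := _ `^ _; have W0 : 0 <= W by exact: powR_ge0.
have [l0|l0] := eqVneq l 0.
  apply: (@le_trans _ _ (C2 * (mc * W))); last first.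
    by apply: ler_wpM2r; [exact: mulr_ge0|rewrite lerDr].
  have -> : W = 1 by rewrite /W l0 expr0n /= addr0 powR1.
  apply: (@le_trans _ _ (wsum a L (fun m => w0 R * mc / Num.sqrt (gnorm2 1 0) * sech (pi * k + b * m%:~R)))).
    apply: ler_wsum => m _ _; rewrite normc_Hk normc_hankq -/b.
    have -> : m + l - m = l by rewrite addrAC subrr add0r.
    rewrite -/mc l0 addr0 mulr0 -expr2 sqrtr_sqr gtr0_norm ?sech_gt0 //.
    by rewrite le_eqVlt; apply/orP; left; apply/eqP; ring.
  rewrite wsumZ mulr1 /C2; apply: (@le_trans _ _ (w0 R * mc / Num.sqrt (gnorm2 1 0) * M)).
    by apply: ler_wpM2l; [rewrite divr_ge0 ?sqrtr_ge0 // mulr_ge0|exact: hM].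
  by rewrite le_eqVlt; apply/orP; left; apply/eqP; ring.
apply: (@le_trans _ _ (C1 * (mc * W))); last first.
  by apply: ler_wpM2r; [exact: mulr_ge0|rewrite lerDl].
pose g (n : int) := tauh (pi * k + b * n%:~R).
have N0 : 0 < `|l|%:~R :> R by rewrite ltr0z normr_gt0.
apply: (@le_trans _ _ (wsum a L (fun m => w0 R * Num.sqrt (kap / b) * mc / Num.sqrt `|l|%:~R * `|g (m + l) - g m|))).
  apply: ler_wsum => m _ _.
  have e : m + l - m = l by rewrite addrAC subrr add0r.
  have nm : m + l != m by rewrite -subr_eq0 e.
  apply: le_trans (normc_Hk_le k nm) _; rewrite e -/mc -/(g (m + l)) -/(g m).
  by rewrite le_eqVlt; apply/orP; left; apply/eqP; ring.
rewrite wsumZ.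
have hg := @telescoping_sum g _ _ l a L.
apply: (@le_trans _ _ (w0 R * Num.sqrt (kap / b) * mc / Num.sqrt `|l|%:~R * (2 * `|l|%:~R))).
  apply: ler_wpM2l; first by rewrite divr_ge0 ?sqrtr_ge0 // mulr_ge0 // mulr_ge0 ?sqrtr_ge0.
  apply: hg => n; last exact: tauh_bd.
  by apply: tauh_mono; rewrite lerD2l ler_pM2l // ler_int; lia.
have e : `|l|%:~R = Num.sqrt `|l|%:~R ^+ 2 :> R by rewrite sqr_sqrtr // ltW.
have s0 : Num.sqrt `|l|%:~R != 0 :> R by rewrite gt_eqF // sqrtr_gt0.
rewrite [X in 2 * X]e.
have -> : w0 R * Num.sqrt (kap / b) * mc / Num.sqrt `|l|%:~R * (2 * Num.sqrt `|l|%:~R ^+ 2) = C1 * (mc * Num.sqrt `|l|%:~R).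
  by rewrite /C1; field.
apply: ler_wpM2l => //; apply: ler_wpM2l => //; exact: sqrt_le_weight.
Qed.

Theorem Hk_summable2 k : fourier_summable T p -> summable2 (Hk T p k).
Proof.
move=> [M hM]; have [C C0 hC] := Hk_diag_sum k.
exists (C * M) => a L; rewrite /ssumC /ssum.
pose A (m l : int) := normc (Hk T p k (m + l) m).
(* The section is summed along diagonals: for [m] in the window the difference [n - m] stays in
   [-L..L]. *)
apply: (@le_trans _ _ (wsum a L (fun m => wsum (- L%:Z) (2 * L).+1 (A m)))).
  apply: ler_wsum => m m1 m2.
  have -> : wsum a L (fun n => normc (Hk T p k n m)) = wsum (a - m) L (A m).
    by rewrite -wsum_shift; apply: eq_wsum => n _ _; rewrite /A addrC subrK.
  apply: ler_wsum_window; [by move=> l; exact: normc_ge0|lia|lia].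
rewrite exchange_wsum.
apply: (@le_trans _ _ (wsum (- L%:Z) (2 * L).+1 (fun l => C * (modC (fourier_coef T p l) * (1 + l%:~R ^+ 2) `^ (4^-1))))).
  by apply: ler_wsum => l _ _; exact: hC.
rewrite wsumZ; apply: ler_wpM2l => //; apply: le_trans (hM L).
by rewrite le_eqVlt; apply/orP; left; apply/eqP; apply: eq_bigr => j _; rewrite [- L%:Z + _]addrC.
Qed.

End HankelSum.

(** * Reflection of eigenvectors *)

Section Reflection.
Variable R : realType.

Lemma wsum_reflect (a z : int) (L : nat) (s : int -> R) :
  wsum a L (fun m => s (- m - z)) = wsum (1 - z - a - L%:Z) L s.
Proof.
rewrite /wsum (reindex_inj rev_ord_inj) /=; apply: eq_bigr => j _; congr s.
by have := ltn_ord j; lia.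
Qed.

Lemma wlim_shifted_sym (u : int -> nat -> R) l (z : int) : wlim u l ->
  (fun N : nat => u (- N%:Z - z) (2 * N).+1) @ \oo --> l.
Proof.
move=> hu; apply/cvgrPdist_lt => e e0; have [N0 hN] := hu e e0.
exists (N0 + `|z|)%N => // N /= hN0; rewrite distrC; apply: hN; lia.
Qed.

Lemma row_wsummable (K : int -> int -> R[i]) (n : int) : summable2 K ->
  wsummable (fun m => normc (K n m)).
Proof.
move=> [M hM]; exists M => a L.
pose N := (`|a| + `|n| + L)%N.
apply: le_trans (hM (- N%:Z) (2 * N).+1).
rewrite /ssumC /ssum.
have h : wsum a L (fun m => `|normc (K n m)|) <= wsum (- N%:Z) (2 * N).+1 (fun m => normc (K n m)).
  rewrite (@eq_wsum _ _ _ _ (fun m => normc (K n m))); last first.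
    by move=> m _ _; rewrite ger0_norm ?normc_ge0.
  apply: ler_wsum_window; [by move=> m; exact: normc_ge0|rewrite /N; lia|rewrite /N; lia].
apply: le_trans h _; apply: ler_wsum => m _ _.
have := @ler_wsum_window R n (- N%:Z) 1 (2 * N).+1 (fun j => normc (K j m)).
rewrite {1}/wsum big_ord1 addr0; apply; [by move=> j; exact: normc_ge0|rewrite /N; lia|rewrite /N; lia].
Qed.

Lemma l2_reflect (v : int -> R[i]) (z : int) : l2 v -> l2 (fun n => ((v (- n - z))^*)%C).
Proof.
move=> [M hM]; exists M => N.
pose t n := reC (v n) ^+ 2 + imC (v n) ^+ 2.
have t0 n : 0 <= t n by rewrite addr_ge0 ?sqr_ge0.
have e : \sum_(j < (2 * N).+1) (let n : int := (j%:Z - N%:Z)%R in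
   reC ((v (- n - z))^*)%C ^+ 2 + imC ((v (- n - z))^*)%C ^+ 2) = wsum (- N%:Z) (2 * N).+1 (fun m => t (- m - z)).
  apply: eq_bigr => j _ /=; rewrite [- N%:Z + _]addrC /t.
  by case: (v _) => x y /=; rewrite /reC /imC /= sqrrN.
rewrite e wsum_reflect; apply: le_trans (hM (N + `|z|)%N).
have -> : \sum_(j < (2 * (N + `|z|)).+1) (let n : int := (j%:Z - (N + `|z|)%:Z)%R in
   reC (v n) ^+ 2 + imC (v n) ^+ 2) = wsum (- (N + `|z|)%:Z) (2 * (N + `|z|)).+1 t.
  by apply: eq_bigr => j _ /=; rewrite [- _ + _]addrC.
by apply: ler_wsum_window => //; lia.
Qed.

(** Conjugation and reversal of the indices carry one equation to the other. Reversal moves the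
    symmetric windows off centre by [z], which is harmless because the row sums converge
    absolutely. *)
Lemma eigen_reflect (K K' : int -> int -> R[i]) (z : int) (l : R) (v : int -> R[i]) :
  summable2 K -> (forall n m, K' n m = ((K (- n - z) (- m - z))^*)%C) ->
  l2 v -> eigen_eq K l%:C%C v -> eigen_eq K' l%:C%C (fun n => ((v (- n - z))^*)%C).
Proof.
move=> sK hK lv ev n; set n' := - n - z.
have [X hX] := l2_bounded lv.
have rs := row_wsummable n' sK.
have bd j : normc (K n' j * v j) <= X * `|normc (K n' j)|.
  rewrite normcM mulrC ger0_norm ?normc_ge0 //; apply: ler_wpM2r => //; exact: normc_ge0.
(* Applied to the real part with [c = 1] and to the imaginary part with [c = -1], the signs under
   conjugation. *)
have key (part : R[i] -> R) (c : R) : (forall w, `|part w| <= normc w) ->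
    (forall w, part (w^*)%C = c * part w) -> 
    (fun N => wsum (- N%:Z) (2 * N).+1 (fun m => part (K n' m * v m))) @ \oo --> part (l%:C%C * v n') ->
    (fun N => wsum (- N%:Z) (2 * N).+1 (fun m => part (K' n m * ((v (- m - z))^*)%C))) @ \oo --> c * part (l%:C%C * v n').
  move=> pb pc h.
  pose s j := part (K n' j * v j).
  have ss : wsummable s.
    by apply: (@wsummable_le _ s _ X _ rs) => j; apply: le_trans (pb _) (bd j).
  have [l0 hl0] := wsummable_wlim ss.
  have e1 : part (l%:C%C * v n') = l0.
    have := wlim_shifted_sym 0 hl0; under eq_fun do rewrite subr0.
    by move=> h2; apply: (cvg_unique _ h h2).
  rewrite e1; have h3 := cvgMr (a := c) (wlim_shifted_sym z hl0).
  rewrite (_ : (fun N => _) = (fun N => c * wsum (- N%:Z - z) (2 * N).+1 s)); first exact: h3.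
  apply/funext => N; rewrite -wsumZ.
  have -> : - N%:Z - z = 1 - z - (- N%:Z) - (2 * N).+1%:Z by lia.
  rewrite -wsum_reflect; apply: eq_wsum => m _ _.
  by rewrite hK -rmorphM pc.
have [hre him] := ev n'.
split.
- have := key (@complex.Re R) 1 (@ler_Re_normc R).
  rewrite /reC; under [in X in _ -> X]eq_fun do rewrite [complex.Re _]Re_matvec.
  have -> : complex.Re (l%:C%C * ((v n')^*)%C) = 1 * complex.Re (l%:C%C * v n').
    by case: (v n') => x y /=; ring.
  apply; first by case=> x y /=; rewrite mul1r.
  by move: hre; rewrite /reC; under eq_fun do rewrite [complex.Re _]Re_matvec.
- have := key (@complex.Im R) (-1) (@ler_Im_normc R).
  rewrite /imC; under [in X in _ -> X]eq_fun do rewrite [complex.Im _]Im_matvec.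
  have -> : complex.Im (l%:C%C * ((v n')^*)%C) = -1 * complex.Im (l%:C%C * v n').
    by case: (v n') => x y /=; ring.
  apply; first by case=> x y /=; rewrite mulN1r.
  by move: him; rewrite /imC; under eq_fun do rewrite [complex.Im _]Im_matvec.
Qed.
End Reflection.

(** * Reduction to the weighted Toeplitz matrix *)

Section HankelDet.
Variables (R : realType) (T : R) (p : R -> R).

Let b := pi * omega T.

Lemma mul_conjC (z : R[i]) : z * (z^*)%C = (normc z ^+ 2)%:C%C.
Proof.
case: z => x y; rewrite /= sqr_sqrtr ?addr_ge0 ?sqr_ge0 //.
by apply/eqP; rewrite eq_complex /=; apply/andP; split; apply/eqP; ring.
Qed.

Definition hankw (mu : R) (l : int) : R[i] := (mu * w0 R)%:C%C * hankq T p l.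

(** The conjugate of [hankD] is its squared modulus [w0 * sech] divided by [hankD]; so a diagonal
    conjugation replaces the Gamma factors by symmetric square roots of [sech]. *)
Lemma toepK_Hk mu k n m :
  - toepK b (hankw mu) (pi * k) n m =
  (Num.sqrt (sech (pi * k + b * n%:~R)))%:C%C / hankD T k n * (- mu%:C%C * Hk T p k n m)
    / ((Num.sqrt (sech (pi * k + b * m%:~R)))%:C%C / hankD T k m).
Proof.
rewrite HkE /toepK /hankw.
have Dn := hankD_neq0 T k n; have Dm := hankD_neq0 T k m.
have -> : ((hankD T k m)^*)%C = (w0 R * sech (pi * k + b * m%:~R))%:C%C / hankD T k m.
  apply: (@mulfI _ (hankD T k m)) => //; rewrite mul_conjC normc_hankD sqr_sqrtr.
    by rewrite [RHS]mulrCA mulfV // mulr1.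
  by rewrite mulr_ge0 ?(ltW (w0_gt0 R)) ?(ltW (sech_gt0 _)).
have sm := sqrt_sech_neq0 (pi * k + b * m%:~R).
have -> : (w0 R * sech (pi * k + b * m%:~R))%:C%C = (w0 R)%:C%C * (Num.sqrt (sech (pi * k + b * m%:~R)))%:C%C ^+ 2 :> R[i].
  by rewrite -rmorphXn /= sqr_sqrtr ?(ltW (sech_gt0 _)) // -rmorphM.
rewrite rmorphM /=; move: sm Dn Dm; set s := _%:C%C; set s' := _%:C%C; move: (hankD T k n) (hankD T k m) => d d' h1 h2 h3.
move: s s' h1 => s s' h1; field; by rewrite h1 h2 h3.
Qed.

Lemma wdet_Hk mu k a L :
  wdet (fun n m => - toepK b (hankw mu) (pi * k) n m) a L = wdet (fun n m => - mu%:C%C * Hk T p k n m) a L.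
Proof.
rewrite (eq_wdet _ _ (toepK_Hk mu k)).
apply: (@wdet_conj _ (fun n m => - mu%:C%C * Hk T p k n m)
  (fun n => (Num.sqrt (sech (pi * k + b * n%:~R)))%:C%C / hankD T k n)) => n.
by rewrite mulf_neq0 ?invr_eq0 ?hankD_neq0 ?sqrt_sech_neq0.
Qed.

Lemma normc_toepK mu k n m :
  normc (toepK b (hankw mu) (pi * k) n m) = `|mu| * normc (Hk T p k n m).
Proof.
have e : normc (mu * w0 R)%:C%C = `|mu| * w0 R by rewrite normc_real normrM (ger0_norm (ltW (w0_gt0 R))).
have es x : normc (Num.sqrt (sech x))%:C%C = Num.sqrt (sech x) :> R by rewrite normc_real ger0_norm ?sqrtr_ge0.
rewrite normc_Hk -/b /toepK /hankw [LHS]normcM [X in X * _]normcM [X in _ * X * _]normcM e !es.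
rewrite (sqrtrM _ (ltW (sech_gt0 _))); ring.
Qed.

(** Since [2 k0 = omega z], this is the reflection about [k0]. It rests on [Gamma] commuting with
    conjugation and on [p] being real. *)
Lemma conj_Hk (z : int) k n m :
  Hk T p (omega T * z%:~R - k) n m = ((Hk T p k (- n - z) (- m - z))^*)%C.
Proof.
have hD j : hankD T (omega T * z%:~R - k) j = ((hankD T k (- j - z))^*)%C.
  rewrite /hankD -GammaC_conj; congr (GammaC (mkC _ _)).
  rewrite rmorphB rmorphN /=; ring.
have hq l : hankq T p (- l) = ((hankq T p l)^*)%C.
  rewrite /hankq fourier_coefN rmorphM; congr (_ * _); rewrite -[RHS]/((_^-1)^*)%C conjc_inv -GammaC_conj.
  by rewrite rmorphN mulrN.
have cM (x y : R[i]) : ((x * y)^*)%C = (x^*)%C * (y^*)%C by exact: rmorphM.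
rewrite !HkE !hD [RHS]cM [X in _ = X * _]cM -hq; congr (_ * hankq T p _ * _); lia.
Qed.

End HankelDet.

Section Final.
Variable R : realType.

Lemma lin_indep1 (v : 'I_1 -> int -> R[i]) : lin_indep v <-> exists n, v ord0 n != 0.
Proof.
split=> [h|[n hn] c hc j].
  apply: boolp.contrapT => hn.
  have : (1 : R[i]) = 0.
    apply: (h (fun=> 1) _ ord0) => n; rewrite big_ord1 mul1r.
    by apply/eqP; apply: boolp.contrapT => /negP hv; apply: hn; exists n.
  by move/eqP; rewrite oner_eq0.
have := hc n; rewrite big_ord1 => /eqP; rewrite mulf_eq0 (negbTE hn) orbF => /eqP.
by rewrite (ord1 j).
Qed.

Lemma eig_mult1_reflect (K K' : int -> int -> R[i]) (z : int) (l : R) : summable2 K ->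
  (forall n m, K' n m = ((K (- n - z) (- m - z))^*)%C) ->
  eig_mult_ge K l%:C%C 1 -> eig_mult_ge K' l%:C%C 1.
Proof.
move=> sK hK [v [/lin_indep1[n hn] hv]]; have [lv ev] := hv ord0.
exists (fun j n => ((v ord0 (- n - z))^*)%C); split.
  apply/lin_indep1; exists (- n - z).
  have -> : - (- n - z) - z = n by lia.
  by rewrite conjc_eq0.
by move=> j; split; [exact: l2_reflect|exact: (eigen_reflect sK hK lv ev)].
Qed.

End Final.

Theorem theorem6p4 (R : realType) (T : R) (p : R -> R) (I : countType)
    (E : I -> R -> R) (k0 : R) :
  0 < T ->
  (forall x, p (x + T) = p x) ->
  (@lebesgue_measure R).-integrable `[0, T] (EFin \o p) ->
  fourier_summable T p ->
  band_functions T p E ->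
  (exists z : int, k0 = omega T / 2 * z%:~R) ->
  (forall i : I, ~ flat (E i) ->
     (forall j : I, j != i -> ~ flat (E j) -> E j k0 != E i k0) ->
     (forall k, E i k = E i (2 * k0 - k)) /\
     derive1 (E i) k0 = 0 /\ derive1n 2 (E i) k0 != 0)
  /\
  (forall i j : I, i != j -> ~ flat (E i) -> ~ flat (E j) -> E i k0 = E j k0 ->
     (forall k, E j k = E i (2 * k0 - k)) /\
     derive1 (E i) k0 = - derive1 (E j) k0 /\ derive1 (E i) k0 != 0).
Proof.
move=> T0 _ _ fsum [E_an [E_neq0 E_eig]] [z hz].
pose b := pi * omega T.
have pi0 : 0 < pi :> R by exact: pi_gt0.
have b0 : 0 < b by rewrite mulr_gt0 ?omega_gt0.
have sumK k := Hk_summable2 T0 k fsum.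
have sumKmu mu k : summable2 (fun n m => - mu%:C%C * Hk T p k n m).
  apply: (@summable2Z _ `|mu| (Hk T p k)) => // n m.
  by rewrite normcM normcN normc_real.
have [f hf] := boolp.choice (fun x => wsummable_wlim (wsummable_sech x b0)).
have [G hG] := boolp.choice (fun u : R * R => wdet_wlim (sumKmu u.1 u.2)).
pose F mu k := G (mu, k).
have hF mu k := hG (mu, k).
have {}hF mu k : wlim (fun a L => complex.Re (wdet (fun n m => - mu%:C%C * Hk T p k n m) a L)) (F mu k) by exact: hF.
clearbody F.
(* The sech sum lives in the variable [x = pi k] with step [b = pi omega]; this rescaling brings the
   factor [pi ^+ 2] into the quadratic bounds. *)
pose fk k := f (pi * k).
have per (y : int) x : f (x + b * y%:~R) = f x.
  have pern (n : nat) u : f (u + b * n%:R) = f u.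
    elim: n u => [|n IH] u; first by rewrite mulr0 addr0.
    by rewrite -(natr1 n) mulrDr mulr1 addrA (sech_sum_period hf) IH.
  case: y => n; first exact: pern.
  by rewrite NegzE -(pern n.+1) rmorphN mulrN subrK.
have f_even k : fk (2 * k0 - k) = fk k.
  rewrite /fk; have -> : pi * (2 * k0 - k) = - (pi * k) + b * z%:~R by rewrite hz /b; field.
  by rewrite per (sech_sum_even b0 hf).
have [d [c [C [d0 c0 C0 hq]]]] := sech_sum_quadratic b0 hf z.
have f_quad : \forall t \near (0 : R),
    c * pi ^+ 2 * t ^+ 2 <= `|fk (k0 + t) - fk k0| <= C * pi ^+ 2 * t ^+ 2.
  have ht : \forall t \near (0 : R), `|t| < d / pi by apply: nbhs0_lt; exact: divr_gt0.
  near=> t; have htd : `|t| < d / pi by near: t.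
  have e0 : b / 2 * z%:~R = pi * k0 by rewrite hz /b; field.
  have := hq (pi * (k0 + t)); rewrite e0 mulrDr [pi * k0 + _ - _]addrAC subrr add0r.
  rewrite normrM gtr0_norm // exprMn !mulrA -mulrDr /fk; apply.
  by move: htd; rewrite ltr_pdivlMr // mulrC => /ltW.
have F0 k : F 0 k = 1.
  apply: (wlim_unique (hF 0 k)) => e e0; exists 0%N => a L _ _.
  have -> : wdet (fun n m => - 0%:C%C * Hk T p k n m) a L = 1.
    rewrite /wdet (_ : sec _ _ _ = 0) ?addr0 ?det1 //.
    by apply/matrixP => i j; rewrite !mxE oppr0 mul0r.
  by rewrite subrr normr0.
(* The parameter [mu] is absorbed into the Toeplitz symbol, so the affine identity is used for each
   [mu] separately and its constant becomes a function of [mu]. *)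
have F_affine mu : exists B, forall k k', F mu k - F mu k' = B * (fk k - fk k').
  have [] := @toeplitz_wdet_affine _ b (hankw T p mu) b0 (fun x => F mu (x / pi)) f.
  - move=> x; have -> : x = pi * (x / pi) by rewrite mulrC divfK ?gt_eqF.
    by apply: (@summable2Z _ `|mu| (Hk T p (x / pi))) => // n m; rewrite normc_toepK.
  - move=> x; have hx : x = pi * (x / pi) by rewrite mulrC divfK ?gt_eqF.
    move=> e e0; have [N hN] := hF mu (x / pi) e e0; exists N => a L h1 h2.
    by rewrite {1}hx wdet_Hk; exact: hN.
  - exact: hf.
  move=> B hB; exists B => k k'.
  have := hB (pi * k) (pi * k').
  have e (u : R) : pi * u / pi = u by rewrite mulrC mulKf ?gt_eqF.
  by rewrite !e.
have F_ps mu0 k : exists a, forall h, psum a h @ \oo --> F (mu0 + h) k.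
  exact: (wdet_power_series mu0 (sumK k) (fun mu => hF mu k)).
have F_eig i k : F (E i k)^-1 k = 0.
  apply: (eig_mult1 (sumK k) (fun mu => hF mu k)) => //.
  apply/(E_eig k) => //; first by rewrite eq_complex /= eqxx andbT E_neq0.
  by exists (fun=> i); split=> [u v _|j //]; rewrite !ord1.
have F_eig2 i j k : i != j -> E i k = E j k ->
    exists C, forall e, `|e| <= 1 -> `|F ((E i k)^-1 + e) k| <= C * e ^+ 2.
  move=> ij eij; apply: (eig_mult2 (sumK k) (fun mu => hF mu k)) => //.
  apply/(E_eig k); first by rewrite eq_complex /= eqxx andbT E_neq0.
  have h1 (w : 'I_2) : w <> ord0 -> val w = 1%N.
    by case: w => [[|[|w]] lw] //= h; case: h; apply: val_inj.
  exists (fun u : 'I_2 => if u == ord0 then i else j); split.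
    move=> u v; case: eqP => [->|hu]; case: eqP => [->|hv] // e.
    - by rewrite e eqxx in ij.
    - by rewrite e eqxx in ij.
    by apply/val_inj; rewrite (h1 u hu) (h1 v hv).
  by move=> u; case: eqP => _ //; rewrite eij.
(* Multiplicity one is enough: it is only necessary that the reflected eigenvalue occur somewhere in
   the list at [2 * k0 - k]. *)
have E_sym i k : exists j, E j (2 * k0 - k) = E i k.
  have h1 : eig_mult_ge (Hk T p k) (E i k)%:C%C 1.
    apply/(E_eig k); first by rewrite eq_complex /= eqxx andbT E_neq0.
    by exists (fun=> i); split=> [u v _|j //]; rewrite !ord1.
  have e2 : 2 * k0 = omega T * z%:~R by rewrite hz; field.
  have := eig_mult1_reflect (sumK k) (conj_Hk T p z k) h1; rewrite -e2.
  move/(E_eig (2 * k0 - k)) => [|g [_ hg]]; first by rewrite eq_complex /= eqxx andbT E_neq0.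
  by exists (g ord0); case: (hg ord0).
split=> [i|i j].
  by apply: (@simple_band _ _ E fk F k0 (c * pi ^+ 2) (C * pi ^+ 2)) => //; rewrite mulr_gt0 ?exprn_gt0.
by apply: (@crossing_bands _ _ E fk F k0 (c * pi ^+ 2) (C * pi ^+ 2)) => //; rewrite mulr_gt0 ?exprn_gt0.
Unshelve. all: by end_near. Qed.
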